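(* Let $\mathcal{D}$ and $A$ be unital $C^*$-algebras. If $\mathcal{D}$ is separable, strongly self-absorbing and $K_1$-injective, then $[\mathcal{D},A\otimes\mathcal{D}]$ reduces to a singleton.
   Context: For unital $C^*$-algebras $\mathcal{D}$ and $B$, $[\mathcal{D},B]$ denotes the set of homotopy classes of unital $*$-homomorphisms from $\mathcal{D}$ to $B$ (homotopies are through unital $*$-homomorphisms, continuous in the point-norm topology). For a unital $C^*$-algebra $B$, $\mathcal{U}(B)$ is its unitary group and $\mathcal{U}_0(B)$ the connected component of $\mathbf{1}_B$ in $\mathcal{U}(B)$ (norm topology). Two $*$-homomorphisms $\sigma,\gamma:C\to B$ are approximately unitarily equivalent, $\sigma\approx_{\mathrm{u}}\gamma$, if there is a sequence $(u_n)_{n\in\mathbb{N}}$ of unitaries in $B$ with $\|u_n\sigma(c)u_n^*-\gamma(c)\|\to 0$ for every $c\in C$. A separable unital $C^*$-algebra $\mathcal{D}$ is strongly self-absorbing if $\mathcal{D}\neq\mathbb{C}$ and there is an isomorphism $\varphi:\mathcal{D}\to\mathcal{D}\otimes\mathcal{D}$ such that $\varphi\approx_{\mathrm{u}}\mathrm{id}_{\mathcal{D}}\otimes\mathbf{1}_{\mathcal{D}}$, where $\mathrm{id}_{\mathcal{D}}\otimes\mathbf{1}_{\mathcal{D}}$ is the map $d\mapsto d\otimes\mathbf{1}_{\mathcal{D}}$. Strongly self-absorbing $C^*$-algebras are known to be simple and nuclear, so $C^*$-tensor products with $\mathcal{D}$ are unambiguous. A unital $C^*$-algebra $\mathcal{D}$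 is $K_1$-injective if the canonical map $\mathcal{U}(\mathcal{D})/\mathcal{U}_0(\mathcal{D})\to K_1(\mathcal{D})$ is injective. *)

(* Defs.v *)
From HB Require Import structures.
From mathcomp Require Import all_boot all_order all_algebra.
From mathcomp Require Import complex.
From mathcomp Require Import all_classical all_reals all_analysis.

Set Implicit Arguments.
Unset Strict Implicit.
Unset Printing Implicit Defensive.

Import Order.TTheory GRing.Theory Num.Theory.
Import numFieldNormedType.Exports.

Local Open Scope classical_set_scope.
Local Open Scope ring_scope.
Local Open Scope complex_scope.

(* Unital C*-algebras over the complex numbers R[i].  It is not required that
   1 <> 0, so that the zero algebra is allowed.  The multiplication is part of
   the mixin because Hierarchy Builder rejects a join of the ring and the normed
   module structures (their join is taken by numDomainType); the ring structure
   is recovered just below, and only its notations are used afterwards. *)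
HB.mixin Record isCStarAlgebra (R : realType) A
    of CompleteNormedModule R[i] A := {
  cstar_one : A;
  cstar_mul : A -> A -> A;
  star : A -> A;
  cstar_mulA : associative cstar_mul;
  cstar_mul1x : left_id cstar_one cstar_mul;
  cstar_mulx1 : right_id cstar_one cstar_mul;
  cstar_mulDl : left_distributive cstar_mul +%R;
  cstar_mulDr : right_distributive cstar_mul +%R;
  cstar_scalerAl_subproof : forall (c : R[i]) (x y : A),
    c *: cstar_mul x y = cstar_mul (c *: x) y;
  cstar_scalerAr_subproof : forall (c : R[i]) (x y : A),
    c *: cstar_mul x y = cstar_mul x (c *: y);
  cstar_normM_le_subproof : forall x y : A, `|cstar_mul x y| <= `|x| * `|y|;
  starK : involutive star;
  starD : {morph star : x y / x + y};
  starM_subproof : forall x y : A, star (cstar_mul x y) = cstar_mul (star y) (star x);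
  starZ : forall (c : R[i]) (x : A), star (c *: x) = c^* *: star x;
  cstar_identity_subproof : forall x : A, `|cstar_mul (star x) x| = `|x| ^+ 2
}.

#[short(type="cstarAlgType")]
HB.structure Definition CStarAlgebra (R : realType) :=
  {A of isCStarAlgebra R A & CompleteNormedModule R[i] A}.

#[non_forgetful_inheritance]
HB.instance Definition _ (R : realType) (A : cstarAlgType R) :=
  GRing.Zmodule_isPzRing.Build A (@cstar_mulA R A) (@cstar_mul1x R A)
    (@cstar_mulx1 R A) (@cstar_mulDl R A) (@cstar_mulDr R A).

Section cstar_axioms.
Variables (R : realType) (A : cstarAlgType R).
Implicit Types (c : R[i]) (x y : A).

Lemma cstar_scalerAl c x y : c *: (x * y) = (c *: x) * y.
Proof. exact: cstar_scalerAl_subproof. Qed.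

Lemma cstar_scalerAr c x y : c *: (x * y) = x * (c *: y).
Proof. exact: cstar_scalerAr_subproof. Qed.

Lemma cstar_normM_le x y : `|x * y| <= `|x| * `|y|.
Proof. exact: cstar_normM_le_subproof. Qed.

Lemma starM x y : star (x * y) = star y * star x.
Proof. exact: starM_subproof. Qed.

Lemma cstar_identity x : `|star x * x| = `|x| ^+ 2.
Proof. exact: cstar_identity_subproof. Qed.

End cstar_axioms.

HB.mixin Record isHilbertSpace (R : realType) H
    of CompleteNormedModule R[i] H := {
  inner : {dot H for @conjc R};
  inner_norm : forall x : H, inner x x = `|x| ^+ 2
}.

#[short(type="hilbertType")]
HB.structure Definition HilbertSpace (R : realType) :=
  {H of isHilbertSpace R H & CompleteNormedModule R[i] H}.

Section cstar_theory.
Variable R : realType.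
Implicit Types A B D T : cstarAlgType R.

(* Unital *-homomorphisms. *)
Record star_hom A B (f : A -> B) : Prop := StarHom {
  star_hom_linear : linear f;
  star_hom_monoid : monoid_morphism f;
  star_hom_star : {morph f : x / star x}
}.

Definition unitaries A : set A := [set u | star u * u = 1 /\ u * star u = 1].

(* The convergence is in the topology of B, i.e. in norm. *)
Definition approx_unitarily_equiv A B (f g : A -> B) : Prop :=
  exists u : nat -> B, (forall n, unitaries (u n)) /\
    forall c, (fun n => u n * f c * star (u n)) @ \oo --> g c.

Definition homotopic A B (f g : A -> B) : Prop :=
  exists h : R -> A -> B,
    [/\ forall t, t \in `[0, 1] -> star_hom (h t),
        h 0 = f, h 1 = g &
        forall a, {within `[0, 1], continuous (fun t => h t a)}].

(* [A, B], each class being the set of its members. *)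
Definition homotopy_classes A B : set (set (A -> B)) :=
  [set [set g | homotopic f g] | f in [set f : A -> B | star_hom f]].

Definition separable_space (T : topologicalType) : Prop :=
  exists2 S : set T, countable S & dense S.

(* When f is bilinear this is the linear span of the values of f. *)
Definition sums X Y (V : nmodType) (f : X -> Y -> V) : set V :=
  [set v | exists n (x : 'I_n -> X) (y : 'I_n -> Y),
     v = \sum_(k < n) f (x k) (y k)].

(* Faithful unital representations of A by bounded operators on H. *)
Record faithful_rep A (H : hilbertType R) (pi : {bilinear A -> H -> H}) : Prop :=
  FaithfulRep {
  rep_bounded : forall a, continuous (pi a);
  rep_one : forall x, pi 1 x = x;
  rep_mul : forall a b x, pi (a * b) x = pi a (pi b x);
  rep_star : forall a x y, inner (pi a x) y = inner x (pi (star a) y);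
  rep_inj : forall a b, pi a =1 pi b -> a = b
}.

(* L, with the map (h, k) |-> h (x) k, is the Hilbert space tensor product of
   H and K. *)
Definition hilbert_tensor (H K L : hilbertType R)
    (t : {bilinear H -> K -> L}) : Prop :=
  (forall h k h' k', inner (t h k) (t h' k') = inner h h' * inner k k') /\
  dense (sums t).

(* T, with the embeddings i : a |-> a (x) 1 and j : b |-> 1 (x) b, is the
   spatial (i.e. minimal) tensor product of A and B: for some faithful
   representations of A on H and of B on K, T is the norm closure of the
   algebraic tensor product of A and B acting on the Hilbert space tensor
   product of H and K.  The elementary tensor a (x) b is i a * j b.  As always
   for the spatial norm, the representations chosen are irrelevant. *)
Definition spatial_tensor A B T (i : A -> T) (j : B -> T) : Prop :=
  [/\ star_hom i, star_hom j, dense (sums (fun a b => i a * j b)) &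
   exists (H K L : hilbertType R) (t : {bilinear H -> K -> L})
     (pi : {bilinear A -> H -> H}) (rho : {bilinear B -> K -> K})
     (theta : {bilinear T -> L -> L}),
     [/\ hilbert_tensor t, faithful_rep pi, faithful_rep rho,
         faithful_rep theta &
         forall a b h k, theta (i a * j b) (t h k) = t (pi a h) (rho b k)]].

Definition is_complex_numbers A : Prop :=
  exists f : A -> R[i],
    [/\ bijective f, linear_for *%R f, monoid_morphism f &
        forall x, f (star x) = (f x)^*].

Definition strongly_self_absorbing D : Prop :=
  ~ is_complex_numbers D /\
  exists (DD : cstarAlgType R) (i j : D -> DD) (phi : D -> DD),
    [/\ spatial_tensor i j, star_hom phi, bijective phi &
        approx_unitarily_equiv phi i].

Definition unitary_component A : set A := connected_component (@unitaries A) 1.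

(* The class of u in U(A) / U_0(A). *)
Definition unitary_class A (u : A) : set A :=
  [set w * u | w in @unitary_component A].

Definition mxstar A n (u : 'M[A]_n) : 'M[A]_n := (map_mx (@star R A) u)^T.

Definition unitaries_mx A n : set 'M[A]_n :=
  [set u | mxstar u *m u = 1%:M /\ u *m mxstar u = 1%:M].

(* Matrices carry the topology of entrywise convergence, which is the one
   given by the C*-norm of M_n(A). *)
Definition unitary_component_mx A n : set 'M[A]_n :=
  connected_component (@unitaries_mx A n) 1%:M.

Definition stabilize A n k (u : 'M[A]_n) : 'M[A]_(n + k) := block_mx u 0 0 1%:M.

(* Equality of the classes of u and v in the direct limit K_1(A) of the groups
   U_n(A) / U_n(A)_0 along u |-> diag(u, 1). *)
Definition K1_equiv A n m (u : 'M[A]_n) (v : 'M[A]_m) : Prop :=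
  exists k l (e : (n + k = m + l)%N),
    @unitary_component_mx A (m + l)
      (castmx (e, e) (stabilize k u) *m mxstar (stabilize l v)).

Definition K1_class A n (u : 'M[A]_n) : set {m & 'M[A]_m} :=
  [set w | unitaries_mx (projT2 w) /\ K1_equiv u (projT2 w)].

(* The canonical map sends the class of u to the class of the 1 x 1 matrix u. *)
Definition K1_injective A : Prop :=
  forall u v : A, unitaries u -> unitaries v ->
    K1_class (u%:M : 'M[A]_1) = K1_class (v%:M : 'M[A]_1) ->
    unitary_class u = unitary_class v.

End cstar_theory.

Arguments homotopy_classes {R} A B.

(* Main.v *)
Require Import Defs.
From mathcomp Require Import all_boot all_order all_algebra.
From mathcomp Require Import complex.
From mathcomp Require Import all_classical all_reals all_analysis.
From mathcomp Require Import ring lra.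

Set Implicit Arguments.
Unset Strict Implicit.
Unset Printing Implicit Defensive.

Import Order.TTheory GRing.Theory Num.Theory.
Import numFieldNormedType.Exports.

Local Open Scope classical_set_scope.
Local Open Scope ring_scope.
Local Open Scope complex_scope.

(** Proof.  The algebra [D] is its own tensor square through two commuting
    endomorphisms [lam] and [mu], with [lam] approximately unitarily equivalent
    to the identity; comparing the flip of the two factors with its product with
    the identity shows that [mu] is approximately inner as well.
    K_1-injectivity puts every commutator of unitaries in the component of [1],
    so the implementing unitaries may be taken in this component; and
    conjugating by a unitary flipping [lam] to [mu] turns any path from [1] to an
    almost central unitary into an almost central path.  Concatenating such
    paths, [lam] and [mu] are homotopic to the identity.  For
    [sigma : D -> A (x) D], the homotopy from [lam] to [mu] composed with
    [sigma (x) id] leads from [sigma (x) 1], which is homotopic to [sigma], to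
    the embedding of the last factor of [A (x) D (x) D], which does not depend
    on [sigma].

    The tensor products of homomorphisms exist because the spatial norm is
    determined by positivity on finite families of vectors, and positivity of a
    matrix over a C*-algebra holds in all representations once it holds in a
    faithful one: for a contraction [w] the entries of the powers [w ^ (2 ^ k)]
    stay bounded in norm, and this bounds [w] in any other representation. *)

(** No spectral theory enters. The analysis rests on one iteration for [1 - sqrt (1 - y)]. It writes
    a self-adjoint contraction as the real part of a unitary, which makes homomorphisms and
    representations contractive; it provides the absolute value behind the isometry of faithful
    representations; and it provides short paths of unitaries. Tensor products are never
    constructed: only [AD] and the square occurring in [strongly_self_absorbing] are given.
    Transporting the latter along its isomorphism makes [D] its own square, and then [AD] itself
    serves as the triple product A (x) D (x) D. Almost central paths are what the concatenation
    requires. If [u n] and [u n.+1] both conjugate an endomorphism close to the identity on a finite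
    set, their quotient almost commutes with that set; joining them by an arbitrary path would lose
    the approximation midway, whereas a path that almost commutes with the set keeps it. *)

(* [abel] decides equalities in abelian groups by comparing, for each atom, the
   integer coefficients of both sides. *)
Inductive zexpr := ZVar of nat | ZZero | ZAdd of zexpr & zexpr | ZOpp of zexpr.

Fixpoint zeval (V : zmodType) (env : seq V) (e : zexpr) : V :=
  match e with
  | ZVar k => env`_k
  | ZZero => 0
  | ZAdd e1 e2 => zeval env e1 + zeval env e2
  | ZOpp e1 => - zeval env e1
  end.

Fixpoint zcoef (e : zexpr) (k : nat) : int :=
  match e with
  | ZVar l => (k == l)%:R
  | ZZero => 0
  | ZAdd e1 e2 => zcoef e1 k + zcoef e2 k
  | ZOpp e1 => - zcoef e1 k
  end.

Lemma zeval_coef (V : zmodType) (env : seq V) (e : zexpr) :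
  zeval env e = \sum_(k < size env) env`_k *~ zcoef e k.
Proof.
elim: e => [l||e1 ih1 e2 ih2|e ih] /=.
- have [ls|ls] := ltnP l (size env); last first.
    rewrite nth_default // big1 // => k _.
    by rewrite (ltn_eqF (leq_trans (ltn_ord k) ls)).
  rewrite (bigD1 (Ordinal ls)) //= eqxx mulr1z big1 ?addr0 // => k.
  by rewrite -val_eqE /= => /negPf ->.
- by rewrite big1 // => k _; rewrite mulr0z.
- by rewrite ih1 ih2 -big_split; apply: eq_bigr => k _; rewrite mulrzDr.
- by rewrite ih -sumrN; apply: eq_bigr => k _; rewrite mulrNz.
Qed.

Lemma zeval_eq (V : zmodType) (env : seq V) (e1 e2 : zexpr) :
  all (fun k => zcoef e1 k == zcoef e2 k) (iota 0 (size env)) ->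
  zeval env e1 = zeval env e2.
Proof.
move=> /allP h; rewrite !zeval_coef; apply: eq_bigr => k _.
by rewrite (eqP (h k _)) // mem_iota /= add0n.
Qed.

(* Canonical instances reached along different inheritance paths are
   convertible without being syntactically equal. *)
Ltac zsame x y :=
  first
    [ constr_eq x y
    | lazymatch constr:((x, y)) with
      | ((?a * ?b)%R, (?c * ?d)%R) => zsame a c; zsame b d
      | ((?a + ?b)%R, (?c + ?d)%R) => zsame a c; zsame b d
      | ((?a *: ?b)%R, (?c *: ?d)%R) => zsame a c; zsame b d
      | ((- ?a)%R, (- ?c)%R) => zsame a c
      | (1%R, 1%R) => idtac
      | (?f ?a, ?g ?b) => constr_eq f g; zsame a b
      end ].

Ltac zmem x env :=
  lazymatch env with
  | nil => false
  | ?y :: ?l =>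
      match goal with
      | _ => let t := match goal with _ => zsame x y end in true
      | _ => zmem x l
      end
  end.

Ltac zindex x env :=
  lazymatch env with
  | ?y :: ?l =>
      match goal with
      | _ => let t := match goal with _ => zsame x y end in constr:(0%N)
      | _ => let n := zindex x l in constr:(n.+1)
      end
  end.

Ltac zatoms env e :=
  lazymatch e with
  | (?a + ?b)%R => let env1 := zatoms env a in zatoms env1 b
  | (- ?a)%R => zatoms env a
  | 0%R => env
  | _ => lazymatch zmem e env with
         | true => env
         | false => constr:(e :: env)
         end
  end.

Ltac zreify env e :=
  lazymatch e with
  | (?a + ?b)%R =>
      let x := zreify env a in let y := zreify env b in constr:(ZAdd x y)
  | (- ?a)%R => let x := zreify env a in constr:(ZOpp x)
  | 0%R => constr:(ZZero)
  | _ => let n := zindex e env in constr:(ZVar n)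
  end.

Ltac abel :=
  lazymatch goal with
  | |- @eq ?T ?a ?b =>
      let env0 := zatoms (@nil T) a in
      let env := zatoms env0 b in
      let x := zreify env a in
      let y := zreify env b in
      apply: (@zeval_eq _ env x y); reflexivity
  end.

(** * Real-valued norms *)

Section norm.
Context {R : realType}.

(* The library's norms take their values in [R[i]]. *)
Definition nm (V : normedZmodType R[i]) (x : V) : R := complex.Re `|x|.

Lemma nmE (V : normedZmodType R[i]) (x : V) : `|x| = (nm x)%:C.
Proof. by rewrite /nm RRe_real // normr_real. Qed.

Lemma nm_ge0 (V : normedZmodType R[i]) (x : V) : 0 <= nm x.
Proof. by have := normr_ge0 x; rewrite nmE ler0c. Qed.

Lemma nm0 (V : normedZmodType R[i]) : nm (0 : V) = 0.
Proof. by rewrite /nm normr0. Qed.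

Lemma nm_eq0 (V : normedZmodType R[i]) (x : V) : (nm x == 0) = (x == 0).
Proof. by rewrite -(normr_eq0 x) nmE eq_complex /= eqxx andbT. Qed.

Lemma nm0_eq0 (V : normedZmodType R[i]) (x : V) : nm x = 0 -> x = 0.
Proof. by move/eqP; rewrite nm_eq0 => /eqP. Qed.

Lemma nm_le0_eq0 (V : normedZmodType R[i]) (x : V) : nm x <= 0 -> x = 0.
Proof. by move=> x0; apply: nm0_eq0; apply/le_anti; rewrite x0 nm_ge0. Qed.

Lemma ler_nmD (V : normedZmodType R[i]) (x y : V) : nm (x + y) <= nm x + nm y.
Proof. by have := ler_normD x y; rewrite !nmE -rmorphD lecR. Qed.

Lemma nmN (V : normedZmodType R[i]) (x : V) : nm (- x) = nm x.
Proof. by rewrite /nm normrN. Qed.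

Lemma nmB (V : normedZmodType R[i]) (x y : V) : nm (x - y) = nm (y - x).
Proof. by rewrite /nm distrC. Qed.

Lemma ler_nmB (V : normedZmodType R[i]) (x y : V) : nm (x - y) <= nm x + nm y.
Proof. by rewrite -(nmN y) ler_nmD. Qed.

Lemma ler_nmdD (V : normedZmodType R[i]) (z x y : V) :
  nm (x - y) <= nm (x - z) + nm (z - y).
Proof. by rewrite -[x - y](subrKA z) ler_nmD. Qed.

Lemma nm_sum (V : normedZmodType R[i]) (I : Type) (s : seq I) (P : pred I) (F : I -> V) :
  nm (\sum_(k <- s | P k) F k) <= \sum_(k <- s | P k) nm (F k).
Proof.
elim/big_rec2: _ => [|k y x _ xy]; first by rewrite nm0.
by apply: (le_trans (ler_nmD _ _)); rewrite lerD2l.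
Qed.

Lemma nmZ (V : normedModType R[i]) (c : R[i]) (x : V) : nm (c *: x) = nm c * nm x.
Proof. by apply: complexI; rewrite -nmE normrZ !nmE rmorphM. Qed.

Lemma nmR (r : R) : nm (r%:C) = `|r|.
Proof. by rewrite /nm normc_def /= expr0n addr0 sqrtr_sqr. Qed.

Lemma nmM (x y : R[i]) : nm (x * y) = nm x * nm y.
Proof. by apply: complexI; rewrite -nmE normrM !nmE rmorphM. Qed.

Lemma nmi : nm ('i : R[i]) = 1.
Proof. by rewrite /nm normc_def /= expr0n expr1n add0r sqrtr1. Qed.

Lemma nm_conj (c : R[i]) : nm c^* = nm c.
Proof. by rewrite /nm normcJ. Qed.

Lemma ler_Re_nm (c : R[i]) : complex.Re c <= nm c.
Proof.
have := normc_ge_Re c; rewrite nmE lecR; apply: le_trans; exact: ler_norm.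
Qed.

Lemma nmZr (V : normedModType R[i]) (r : R) (x : V) : nm (r%:C *: x) = `|r| * nm x.
Proof. by rewrite nmZ nmR. Qed.

Lemma nm_cvgP (V : normedModType R[i]) (T : Type) (F : set_system T) {FF : Filter F}
    (f : T -> V) (l : V) :
  (f @ F --> l) <-> (forall e : R, 0 < e -> \forall x \near F, nm (l - f x) < e).
Proof.
split.
  move/cvgrPdist_lt => fl e e0.
  have /fl : 0 < e%:C :> R[i] by rewrite ltcR.
  by apply: filterS => x; rewrite nmE ltcR.
move=> fl; apply/cvgrPdist_lt => -[e e'] /[dup]; rewrite {1}ltcE /= => /andP[/eqP ->] e0 _.
by apply: filterS (fl e e0) => x; rewrite nmE ltcR.
Qed.

Lemma nm_continuousP (V : normedModType R[i]) (T : topologicalType) (f : T -> V) (x : T) :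
  {for x, continuous f} <-> (forall e : R, 0 < e -> \forall y \near x, nm (f x - f y) < e).
Proof. exact: nm_cvgP. Qed.

Lemma nm_small (V : normedZmodType R[i]) (x : V) :
  (forall e : R, 0 < e -> nm x <= e) -> x = 0.
Proof.
move=> h; apply: nm_le0_eq0; apply/ler_addgt0Pl => e e0; rewrite addr0; exact: h.
Qed.

Lemma nm_eq_small (V : normedZmodType R[i]) (x y : V) :
  (forall e : R, 0 < e -> nm (x - y) <= e) -> x = y.
Proof. by move=> /nm_small /subr0_eq. Qed.

Lemma inv_succ_small (e : R) : 0 < e ->
  exists N, forall n, (N <= n)%N -> n.+1%:R^-1 < e.
Proof.
move=> e0; have ei : 0 < e^-1 by rewrite invr_gt0.
exists (Num.bound e^-1) => n Nn; rewrite invf_plt ?posrE //.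
apply: (lt_le_trans (archi_boundP (ltW ei))); rewrite ler_nat.
exact: leqW.
Qed.

Lemma nm_complete (V : completeNormedModType R[i]) (x : nat -> V) :
  (forall e : R, 0 < e -> exists N, forall m n, (N <= m)%N -> (N <= n)%N -> nm (x m - x n) < e) ->
  exists l, forall e : R, 0 < e -> exists N, forall n, (N <= n)%N -> nm (l - x n) < e.
Proof.
move=> xC.
have /cauchy_cvg /cvg_ex [l xl] : cauchy (x @ \oo).
  apply/cauchyP => -[e e']; rewrite ltcE /= => /andP[/eqP -> e0].
  have [N xN] := xC e e0; exists (x N); exists N => // n /= Nn.
  by rewrite -ball_normE /= nmE ltcR; exact: xN.
exists l => e e0; have /nm_cvgP /(_ e e0) [N _ h] := xl.
by exists N => n Nn; exact: h.
Qed.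

End norm.

(** * Square roots and unitaries in C*-algebras *)

Section cstar_basics.
Context {R : realType} {A : cstarAlgType R}.
Implicit Types (a b s x y z u v w : A) (r : R).

Lemma star0 : star (0 : A) = 0.
Proof. by apply: (addrI (star 0)); rewrite -starD !addr0. Qed.

Lemma starN x : star (- x) = - star x.
Proof. by apply: (addrI (star x)); rewrite -starD !subrr star0. Qed.

Lemma starB x y : star (x - y) = star x - star y.
Proof. by rewrite starD starN. Qed.

Lemma star1 : star (1 : A) = 1.
Proof. by have := starM (star 1) (1 : A); rewrite mulr1 starK mulr1 => <-. Qed.

Lemma starZc (c : R[i]) x : star (c *: x) = conjc c *: star x.
Proof. exact: starZ. Qed.

Lemma starZr r x : star (r%:C *: x) = r%:C *: star x.
Proof. by rewrite starZc conjc_real. Qed.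

Lemma star_sum (I : Type) (s : seq I) (P : pred I) (F : I -> A) :
  star (\sum_(k <- s | P k) F k) = \sum_(k <- s | P k) star (F k).
Proof.
by elim/big_rec2: _ => [|k y x _ <-]; [exact: star0|rewrite starD].
Qed.

Lemma nmM_le x y : nm (x * y) <= nm x * nm y.
Proof. by have := cstar_normM_le x y; rewrite !nmE -rmorphM lecR. Qed.

Lemma nm_cstar x : nm (star x * x) = nm x ^+ 2.
Proof. by have := cstar_identity x; rewrite !nmE -rmorphXn => /complexI. Qed.

Lemma nm_star x : nm (star x) = nm x.
Proof.
have le y : nm y <= nm (star y).
  have [->|y0] := eqVneq (nm y) 0; first exact: nm_ge0.
  have yp : 0 < nm y by rewrite lt_neqAle eq_sym y0 nm_ge0.
  by rewrite -(ler_pM2r yp) -expr2 -nm_cstar nmM_le.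
by apply/le_anti; rewrite le andbT -{2}[x]starK le.
Qed.

Lemma nm_sqr_selfadj x : star x = x -> nm (x * x) = nm x ^+ 2.
Proof. by move=> xs; rewrite -nm_cstar xs. Qed.

(** Only an inequality, because in the zero algebra [1] has norm [0]. *)
Lemma nm1_le1 : nm (1 : A) <= 1.
Proof.
have := nm_cstar 1; rewrite star1 mulr1 => h; have := nm_ge0 (1 : A); nra.
Qed.

Lemma unitary1 : unitaries (1 : A).
Proof. by split; rewrite star1 mulr1. Qed.

Lemma unitaryV u : unitaries u -> unitaries (star u).
Proof. by case=> ? ?; split; rewrite starK. Qed.

Lemma unitaryM u v : unitaries u -> unitaries v -> unitaries (u * v).
Proof.
move=> [u1 u2] [v1 v2]; split; rewrite starM.
  by rewrite mulrA -(mulrA (star v)) u1 mulr1.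
by rewrite mulrA -(mulrA u) v2 mulr1.
Qed.

Lemma unitary_nm_le1 u : unitaries u -> nm u <= 1.
Proof.
move=> [u1 _]; have := nm_cstar u; rewrite u1 => h.
by have := nm1_le1; have := nm_ge0 u; nra.
Qed.

Lemma nmMu u x : unitaries u -> nm (u * x) = nm x.
Proof.
move=> uU; apply/le_anti/andP; split.
  apply: (le_trans (nmM_le _ _)); rewrite ler_piMl ?nm_ge0 //.
  exact: unitary_nm_le1.
have {1}-> : x = star u * (u * x) by rewrite mulrA uU.1 mul1r.
apply: (le_trans (nmM_le _ _)); rewrite ler_piMl ?nm_ge0 //.
exact/unitary_nm_le1/unitaryV.
Qed.

Lemma nmuM u x : unitaries u -> nm (x * u) = nm x.
Proof.
by move=> uU; rewrite -nm_star starM nmMu ?nm_star //; exact: unitaryV.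
Qed.

Lemma mulZr r x y : (r%:C *: x) * y = r%:C *: (x * y).
Proof. by rewrite cstar_scalerAl. Qed.

Lemma mulrZ r x y : x * (r%:C *: y) = r%:C *: (x * y).
Proof. by rewrite cstar_scalerAr. Qed.

Lemma scale_halfD x : (1 / 2)%:C *: (x + x) = x.
Proof.
by rewrite scalerDr -scalerDl -rmorphD /= -splitr scale1r.
Qed.

Lemma nm_double x : nm (x + x) = 2 * nm x.
Proof.
have : nm x = (1 / 2) * nm (x + x).
  by rewrite -{1}(scale_halfD x) nmZr ger0_norm //; lra.
lra.
Qed.

Lemma unitary_re_im a s : star a = a -> star s = s -> a * s = s * a ->
  a * a + s * s = 1 -> unitaries (a + 'i *: s).
Proof.
move=> aS sS ass as1.
have ic : conjc ('i : R[i]) = - 'i by apply/eqP; rewrite eq_complex /= oppr0 !eqxx.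
have i2 : ('i : R[i]) * 'i = -1 by rewrite -expr2 sqr_i.
by split; rewrite starD aS starZc sS ic scaleNr !mulrDl !mulrDr
  ?mulNr ?mulrN -!cstar_scalerAl -!cstar_scalerAr !scalerA i2 scaleN1r opprK ass
  addrA -(addrA (a * a)) ?subrr ?addNr addr0 as1.
Qed.

Lemma nm_re_unitary u : unitaries u -> nm ((1 / 2)%:C *: (u + star u)) <= 1.
Proof.
move=> uU; rewrite nmZr ger0_norm; last by lra.
have := ler_nmD u (star u); have := unitary_nm_le1 uU.
have := unitary_nm_le1 (unitaryV uU); lra.
Qed.

Lemma re_imE a s : star a = a -> star s = s ->
  (1 / 2)%:C *: ((a + 'i *: s) + star (a + 'i *: s)) = a.
Proof.
move=> aS sS.
have ic : conjc ('i : R[i]) = - 'i by apply/eqP; rewrite eq_complex /= oppr0 !eqxx.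
by rewrite starD aS starZc sS ic scaleNr addrACA subrr addr0 scale_halfD.
Qed.

(** [a] is the real part of the unitary [a + i s]. Norm bounds for self-adjoint elements are
    obtained below by exhibiting such an [s], in place of a spectral argument. *)
Lemma nm_le1_sumsq a s : star a = a -> star s = s -> a * s = s * a ->
  a * a + s * s = 1 -> nm a <= 1.
Proof.
move=> aS sS ass as1; rewrite -(re_imE aS sS); apply: nm_re_unitary.
exact: unitary_re_im.
Qed.

Lemma nm_sqrB_le x y : nm (x * x - y * y) <= (nm x + nm y) * nm (x - y).
Proof.
have -> : x * x - y * y = x * (x - y) + (x - y) * y.
  by rewrite mulrBr mulrBl addrA subrK.
apply: (le_trans (ler_nmD _ _)); rewrite [leRHS]mulrDl lerD ?nmM_le //.
by apply: (le_trans (nmM_le _ _)); rewrite mulrC.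
Qed.

End cstar_basics.

(* The majorant [q] satisfies the recursion at the norm bound [1], so the
   increments of [p] are dominated by those of the bounded monotone [q]. *)
Section sqrt.
Context {R : realType} {A : cstarAlgType R}.
Implicit Types (a b s x y z u v w : A) (r : R).

(** Iterates of [z |-> (y + z ^ 2) / 2], whose fixed point is [1 - sqrt (1 - y)]; no inverse is
    taken, and every iterate is a polynomial in [y]. *)
Fixpoint sqrt_approx y n : A :=
  if n is n.+1 then (1 / 2)%:C *: (y + sqrt_approx y n * sqrt_approx y n) else 0.

Fixpoint sqrt_majorant n : R :=
  if n is n.+1 then (1 + sqrt_majorant n ^+ 2) / 2 else 0.

Local Notation p := sqrt_approx.
Local Notation q := sqrt_majorant.

Lemma sqrt_majorant_bound n : 0 <= q n <= 1.
Proof. by elim: n => [|n /andP[? ?]] /=; [lra|apply/andP; split; nra]. Qed.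

Lemma sqrt_approx_bound y n : nm y <= 1 -> nm (p y n) <= q n.
Proof.
move=> y1; elim: n => [|n ih] /=; first by rewrite nm0.
rewrite nmZr ger0_norm; last by lra.
have := ler_nmD y (p y n * p y n); have := nmM_le (p y n) (p y n).
have := nm_ge0 (p y n); nra.
Qed.

Lemma sqrt_approx_incr y n : nm y <= 1 ->
  nm (p y n.+1 - p y n) <= q n.+1 - q n.
Proof.
move=> y1; elim: n => [|n ih].
  rewrite /= subr0 mulr0 addr0 nmZr ger0_norm; last by lra.
  by lra.
have -> : p y n.+2 - p y n.+1 = (1 / 2)%:C *: (p y n.+1 * p y n.+1 - p y n * p y n).
  by rewrite -scalerBr opprD addrACA subrr add0r.
rewrite nmZr ger0_norm; last by lra.
have := nm_sqrB_le (p y n.+1) (p y n).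
have -> : q n.+2 - q n.+1 = (q n.+1 + q n) * (q n.+1 - q n) / 2.
  by rewrite /=; ring.
have : (nm (p y n.+1) + nm (p y n)) * nm (p y n.+1 - p y n) <=
    (q n.+1 + q n) * (q n.+1 - q n).
  by apply: ler_pM; rewrite ?addr_ge0 ?nm_ge0 ?lerD ?(sqrt_approx_bound _ y1).
lra.
Qed.

Lemma sqrt_approx_cauchy y m n : nm y <= 1 -> (n <= m)%N ->
  nm (p y m - p y n) <= q m - q n.
Proof.
move=> y1; elim: m => [|m ih]; first by rewrite leqn0 => /eqP->; rewrite !subrr nm0.
rewrite leq_eqVlt => /orP[/eqP->|]; first by rewrite !subrr nm0.
rewrite ltnS => /ih {}ih; apply: (le_trans (ler_nmdD (p y m) _ _)).
by have := sqrt_approx_incr m y1; lra.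
Qed.

Lemma sqrt_majorant_cauchy (e : R) : 0 < e ->
  exists N, forall m n, (N <= m)%N -> (N <= n)%N -> q m - q n < e.
Proof.
move=> e0.
have qi : nondecreasing_seq q.
  apply/nondecreasing_seqP => n; rewrite -subr_ge0.
  apply: (le_trans (nm_ge0 _)); apply: (@sqrt_approx_incr 0).
  by rewrite nm0 ler01.
have : cvgn q.
  apply: nondecreasing_is_cvgn => //; exists 1 => _ [n _ <-].
  by have /andP[] := sqrt_majorant_bound n.
move=> /cvg_ex [l /cvgrPdist_lt /(_ (e / 2))].
case; first by lra.
move=> N _ h; exists N => m n /h /= hm /h /= hn.
by move: hm hn; rewrite !ltr_norml; lra.
Qed.

(** The equation says that [1 - z] squares to [1 - y]. The limit inherits from the iterates that
    they commute with whatever commutes with [y]. The last clause prepares [sqrt_unique]: [1 / 2] is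
    a fixed point of [q |-> (3 / 4 + q ^ 2) / 2]. *)
Lemma sqrt_exists y : star y = y -> nm y <= 1 ->
  exists z, [/\ star z = z, nm z <= 1, z + z = y + z * z,
    (forall x, x * y = y * x -> x * z = z * x) &
    (nm y <= 3 / 4 -> nm z <= 1 / 2)].
Proof.
move=> ys y1.
have [e e0|z zl] := @nm_complete _ A (p y).
  have [N hN] := sqrt_majorant_cauchy e0.
  exists N => m n Nm Nn; have [nm|/ltnW mn] := leqP n m.
    by apply: (le_lt_trans (sqrt_approx_cauchy y1 nm)); exact: hN.
  by rewrite nmB; apply: (le_lt_trans (sqrt_approx_cauchy y1 mn)); exact: hN.
have zb (b : R) : (forall n, nm (p y n) <= b) -> nm z <= b.
  move=> pb; apply/ler_addgt0Pl => e e0; have [N /(_ N (leqnn N)) h] := zl e e0.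
  by have := ler_nmD (z - p y N) (p y N); rewrite subrK; have := pb N; lra.
have z1 : nm z <= 1.
  apply: zb => n; apply: (le_trans (sqrt_approx_bound n y1)).
  by have /andP[] := sqrt_majorant_bound n.
exists z; split => //.
- apply: nm_eq_small => e e0; have [|N h] := zl (e / 2); first by lra.
  have pS n : star (p y n) = p y n.
    by elim: n => [|n ih] /=; rewrite ?star0 // starZr starD starM ih ys.
  have := ler_nmdD (p y N) (star z) z; rewrite -{1}(pS N) -starB nm_star.
  by have := h N (leqnn N); rewrite (nmB (p y N)); lra.
- apply: nm_eq_small => e e0; have [|N h] := zl (e / 4); first by lra.
  have -> : z + z - (y + z * z) =
     (z - p y N.+1) + (z - p y N.+1) + (p y N * p y N - z * z).
    have -> : p y N * p y N = p y N.+1 + p y N.+1 - y.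
      by rewrite /= -scalerDr scale_halfD addrC addKr.
    abel.
  have := ler_nmD (z - p y N.+1 + (z - p y N.+1)) (p y N * p y N - z * z).
  have := ler_nmD (z - p y N.+1) (z - p y N.+1).
  have := h N (leqnn N); have := h N.+1 (leqnSn N).
  have := nm_sqrB_le (p y N) z; rewrite (nmB _ z).
  have pN1 : nm (p y N) <= 1.
    apply: (le_trans (sqrt_approx_bound N y1)).
    by have /andP[] := sqrt_majorant_bound N.
  have := nm_ge0 (z - p y N); have := nm_ge0 z; have := nm_ge0 (p y N).
  have : (nm (p y N) + nm z) * nm (z - p y N) <= 2 * nm (z - p y N).
    by rewrite ler_wpM2r ?nm_ge0 //; lra.
  lra.
- move=> x xy; apply: nm_eq_small => e e0.
  have xp n : x * p y n = p y n * x.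
    elim: n => [|n ih] /=; first by rewrite mulr0 mul0r.
    by rewrite mulrZ mulZr mulrDr mulrDl xy mulrA ih -mulrA ih mulrA.
  have [|N h] := zl (e / (2 * (nm x + 1))).
    by rewrite divr_gt0 // mulr_gt0 //; have := nm_ge0 x; lra.
  have -> : x * z - z * x = x * (z - p y N) - (z - p y N) * x.
    by rewrite mulrBr mulrBl xp opprB addrA subrK.
  apply: (le_trans (ler_nmB _ _)).
  have := nmM_le x (z - p y N); have := nmM_le (z - p y N) x.
  have := h N (leqnn N); rewrite ltr_pdivlMr; last by have := nm_ge0 x; lra.
  have := nm_ge0 x; have := nm_ge0 (z - p y N); nra.
- move=> y34; apply: zb; elim=> [|n ih] /=; first by rewrite nm0; lra.
  rewrite nmZr ger0_norm; last by lra.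
  have := ler_nmD y (p y n * p y n); have := nmM_le (p y n) (p y n).
  have := nm_ge0 (p y n); nra.
Qed.

Lemma sqrt_1B y z : z + z = y + z * z -> (1 - z) * (1 - z) = 1 - y.
Proof.
move=> h; rewrite mulrBl !mulrBr !mulr1 mul1r.
have -> : y = z + z - z * z by rewrite h addrK.
abel.
Qed.

(** On the ball of radius [1 / 2] squaring is 1-Lipschitz, while [z + z] doubles differences; the
    gap leaves a Lipschitz dependence on [y]. It yields both uniqueness and the continuity of square
    roots along a path. *)
Lemma sqrt_unique y y' z z' : nm z <= 1 / 2 -> nm z' <= 1 / 2 ->
  z + z = y + z * z -> z' + z' = y' + z' * z' -> nm (z - z') <= nm (y - y').
Proof.
move=> z1 z1' h h'.
have e : (z - z') + (z - z') = (y - y') + (z * z - z' * z').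
  by rewrite addrACA -opprD h h' opprD addrACA.
have : nm ((z - z') + (z - z')) = 2 * nm (z - z').
  exact: nm_double.
rewrite e; have := ler_nmD (y - y') (z * z - z' * z').
have := nm_sqrB_le z z'; have := nm_ge0 (z - z'); have := nm_ge0 (y - y').
have : (nm z + nm z') * nm (z - z') <= 1 * nm (z - z').
  by rewrite ler_wpM2r ?nm_ge0 //; lra.
lra.
Qed.

(** The unitary is [a + i s], where [s] is the square root of [1 - a ^ 2] and commutes with [a]. *)
Lemma selfadj_unitary a : star a = a -> nm a <= 1 ->
  exists2 u, unitaries u & a = (1 / 2)%:C *: (u + star u).
Proof.
move=> aS a1.
have aaS : star (a * a) = a * a by rewrite starM aS.
have aa1 : nm (a * a) <= 1.
  by rewrite nm_sqr_selfadj //; have := nm_ge0 a; nra.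
have [z [zS _ ze zC _]] := sqrt_exists aaS aa1.
have sS : star (1 - z) = 1 - z by rewrite starB star1 zS.
exists (a + 'i *: (1 - z)); last by rewrite re_imE.
apply: unitary_re_im => //; last by rewrite (sqrt_1B ze) addrC subrK.
by rewrite mulrBr mulrBl mulr1 mul1r zC // mulrA.
Qed.

End sqrt.

(** * Representations on Hilbert spaces *)

Section inner.
Context {R : realType} {H : hilbertType R}.
Implicit Types (x y z : H) (c : R[i]).

Lemma innerDl x y z : inner (x + y) z = inner x z + inner y z.
Proof. exact: linearDl. Qed.

Lemma innerDr x y z : inner x (y + z) = inner x y + inner x z.
Proof. exact: linearDr. Qed.

Lemma innerBl x y z : inner (x - y) z = inner x z - inner y z.
Proof. exact: linearBl. Qed.

Lemma innerBr x y z : inner x (y - z) = inner x y - inner x z.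
Proof. exact: linearBr. Qed.

Lemma inner0l x : inner 0 x = 0.
Proof. exact: linear0l. Qed.

Lemma inner0r x : inner x 0 = 0.
Proof. exact: linear0r. Qed.

Lemma innerZl c x y : inner (c *: x) y = c * inner x y.
Proof. exact: linearZl_LR. Qed.

Lemma innerZr c x y : inner x (c *: y) = conjc c * inner x y.
Proof. exact: linearZr_LR. Qed.

Lemma inner_conj x y : inner x y = conjc (inner y x).
Proof. by rewrite hermC expr0 mul1r. Qed.

Lemma inner_suml (I : Type) (s : seq I) (P : pred I) (F : I -> H) y :
  inner (\sum_(k <- s | P k) F k) y = \sum_(k <- s | P k) inner (F k) y.
Proof. exact: linear_sumlz. Qed.

Lemma inner_sumr (I : Type) (s : seq I) (P : pred I) (F : I -> H) y :
  inner y (\sum_(k <- s | P k) F k) = \sum_(k <- s | P k) inner y (F k).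
Proof. exact: linear_sumr. Qed.

Lemma inner_nm x : inner x x = (nm x ^+ 2)%:C.
Proof. by rewrite inner_norm nmE rmorphXn. Qed.

Lemma nm_sqrB x y (t s : R) : nm (t%:C *: x - s%:C *: y) ^+ 2 =
  t ^+ 2 * nm x ^+ 2 - 2 * t * s * complex.Re (inner x y) + s ^+ 2 * nm y ^+ 2.
Proof.
have /(congr1 (@complex.Re R)) /= := inner_nm (t%:C *: x - s%:C *: y) => <-.
rewrite innerBl !innerBr !innerZl !innerZr !conjc_real !inner_nm.
rewrite (inner_conj y x); case: (inner x y) => a b /=.
by ring.
Qed.

Lemma Re_inner_le x y : complex.Re (inner x y) <= nm x * nm y.
Proof.
(* The squared norm of [nm y *: x - nm x *: y] is [2 |x| |y| (|x| |y| - Re <x, y>)]. *)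
have := nm_sqrB x y (nm y) (nm x); set d := nm (_ - _).
have := sqr_ge0 d; move: (d ^+ 2) => D D0 DE.
have [x0|x0] := eqVneq (nm x) 0.
  by rewrite (nm0_eq0 x0) inner0l nm0 mul0r.
have [y0|y0] := eqVneq (nm y) 0.
  by rewrite (nm0_eq0 y0) inner0r nm0 mulr0.
have xp : 0 < nm x by rewrite lt_neqAle eq_sym x0 nm_ge0.
have yp : 0 < nm y by rewrite lt_neqAle eq_sym y0 nm_ge0.
have p0 : 0 < nm x * nm y by rewrite mulr_gt0.
rewrite -(ler_pM2l p0); move: DE D0; move: (complex.Re _) => u; lra.
Qed.

Lemma nm_inner_le x y : nm (inner x y) <= nm x * nm y.
Proof.
have [->|z0] := eqVneq (inner x y) 0; first by rewrite nm0 mulr_ge0 ?nm_ge0.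
set z := inner x y in z0 *.
have zp : 0 < nm z by rewrite lt_neqAle nm_ge0 andbT eq_sym nm_eq0.
(* The scalar is the phase that turns the inner product into its modulus. *)
have := Re_inner_le ((nm z)^-1%:C * conjc z *: x) y.
rewrite innerZl -/z -mulrA [conjc z * z]mulrC -sqr_normc nmE.
rewrite -rmorphXn -rmorphM /= expr2 mulKf ?gt_eqF // nmZ nmM nmR nm_conj.
by rewrite ger0_norm ?invr_ge0 ?nm_ge0 // mulVf ?gt_eqF // mul1r.
Qed.

Lemma inner_eq0 x : (forall y, inner x y = 0) -> x = 0.
Proof.
move=> h; apply: nm0_eq0; apply/eqP; rewrite -sqrf_eq0; apply/eqP/complexI.
by rewrite -inner_nm h.
Qed.

End inner.

Section representations.
Context {R : realType} {A : cstarAlgType R} {H : hilbertType R}.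
Implicit Types (a b : A) (x y : H) (c : R[i]).

(** Linearity is a property of a bare function, so that composites such as [r \o f] qualify
    directly. Boundedness is a consequence, [nm_star_rep_le]. *)
Record star_rep (r : A -> H -> H) : Prop := StarRep {
  star_repPl : forall c a b x, r (c *: a + b) x = c *: r a x + r b x;
  star_repPr : forall c a x y, r a (c *: x + y) = c *: r a x + r a y;
  star_rep1 : forall x, r 1 x = x;
  star_repM : forall a b x, r (a * b) x = r a (r b x);
  star_repS : forall a x y, inner (r a x) y = inner x (r (star a) y)
}.

Lemma faithful_star_rep (pi : {bilinear A -> H -> H}) :
  faithful_rep pi -> star_rep pi.
Proof.
move=> f; split.
- by move=> c a b x; rewrite linearPl.
- by move=> c a x y; rewrite linearPr.
- exact: rep_one.
- exact: rep_mul.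
- exact: rep_star.
Qed.

Context (r : A -> H -> H) (rR : star_rep r).

Lemma star_repDl a b x : r (a + b) x = r a x + r b x.
Proof. by rewrite -{1}[a]scale1r (star_repPl rR) scale1r. Qed.

Lemma star_rep0l x : r 0 x = 0.
Proof. by apply: (addrI (r 0 x)); rewrite -star_repDl !addr0. Qed.

Lemma star_repZl c a x : r (c *: a) x = c *: r a x.
Proof. by rewrite -[c *: a]addr0 (star_repPl rR) star_rep0l addr0. Qed.

Lemma star_repNl a x : r (- a) x = - r a x.
Proof. by rewrite -scaleN1r star_repZl scaleN1r. Qed.

Lemma star_repBl a b x : r (a - b) x = r a x - r b x.
Proof. by rewrite star_repDl star_repNl. Qed.

Lemma star_repDr a x y : r a (x + y) = r a x + r a y.
Proof. by rewrite -{1}[x]scale1r (star_repPr rR) scale1r. Qed.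

Lemma star_rep0r a : r a 0 = 0.
Proof. by apply: (addrI (r a 0)); rewrite -star_repDr !addr0. Qed.

Lemma star_repZr c a x : r a (c *: x) = c *: r a x.
Proof. by rewrite -[c *: x]addr0 (star_repPr rR) star_rep0r addr0. Qed.

Lemma star_repNr a x : r a (- x) = - r a x.
Proof. by rewrite -scaleN1r star_repZr scaleN1r. Qed.

Lemma star_repBr a x y : r a (x - y) = r a x - r a y.
Proof. by rewrite star_repDr star_repNr. Qed.

Lemma star_rep_suml (I : Type) (s : seq I) (P : pred I) (F : I -> A) x :
  r (\sum_(k <- s | P k) F k) x = \sum_(k <- s | P k) r (F k) x.
Proof.
elim/big_rec2: _ => [|k y z _ <-]; [exact: star_rep0l|exact: star_repDl].
Qed.

Lemma star_rep_sumr (I : Type) (s : seq I) (P : pred I) (F : I -> H) a :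
  r a (\sum_(k <- s | P k) F k) = \sum_(k <- s | P k) r a (F k).
Proof.
elim/big_rec2: _ => [|k y z _ <-]; [exact: star_rep0r|exact: star_repDr].
Qed.

Lemma star_repS2 a x y : inner x (r a y) = inner (r (star a) x) y.
Proof. by rewrite (star_repS rR) starK. Qed.

Lemma nm_star_rep_sqr a x : (nm (r a x) ^+ 2)%:C = inner (r (star a * a) x) x.
Proof.
by rewrite -inner_nm star_repS2 (star_repM rR).
Qed.

Lemma nm_star_rep_unitary u x : unitaries u -> nm (r u x) = nm x.
Proof.
move=> [u1 _]; have := nm_star_rep_sqr u x; rewrite u1 (star_rep1 rR) inner_nm.
by move=> /complexI /eqP; rewrite eqrXn2 ?nm_ge0 // => /eqP.
Qed.

(** Unitaries act isometrically and a self-adjoint contraction is the average of two of them.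
    Scaling covers all self-adjoint elements, and [star a * a] the general case. *)
Lemma nm_star_rep_le a x : nm (r a x) <= nm a * nm x.
Proof.
have selfadj_le1 b y : star b = b -> nm b <= 1 -> nm (r b y) <= nm y.
  move=> bS b1; have [u uU ->] := selfadj_unitary bS b1.
  rewrite star_repZl nmZr star_repDl ger0_norm; last by lra.
  have := ler_nmD (r u y) (r (star u) y).
  rewrite (nm_star_rep_unitary _ uU) (nm_star_rep_unitary _ (unitaryV uU)); lra.
have selfadj_le b y : star b = b -> nm (r b y) <= nm b * nm y.
  move=> bS; have [b0|b0] := eqVneq (nm b) 0.
    by rewrite (nm0_eq0 b0) star_rep0l !nm0 mul0r.
  have bp : 0 < nm b by rewrite lt_neqAle eq_sym b0 nm_ge0.
  have := @selfadj_le1 ((nm b)^-1%:C *: b) y; rewrite starZr bS nmZr.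
  rewrite ger0_norm ?invr_ge0 ?nm_ge0 // mulVf // lexx star_repZl nmZr.
  rewrite ger0_norm ?invr_ge0 ?nm_ge0 // => /(_ erefl isT).
  by rewrite ler_pdivrMl.
have aaS : star (star a * a) = star a * a by rewrite starM starK.
rewrite -(@ler_pXn2r _ 2) ?nnegrE ?mulr_ge0 ?nm_ge0 // exprMn.
have -> : nm (r a x) ^+ 2 = complex.Re (inner (r (star a * a) x) x).
  by rewrite -nm_star_rep_sqr.
apply: (le_trans (Re_inner_le _ _)).
rewrite -nm_cstar [nm x ^+ 2]expr2 mulrA ler_wpM2r ?nm_ge0 //.
exact: selfadj_le.
Qed.

Context (rF : forall a, (forall x, r a x = 0) -> a = 0).

(* The element [h + b], where [h = |b|] and [b <= 0] in the representation, is
   killed by [r]; hence [1 - a ^ 2], a multiple of [h], is a square. *)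
Lemma faithful_selfadj_le1 a : star a = a -> (forall x, nm (r a x) <= nm x) ->
  nm a <= 1.
Proof.
move=> aS a1.
(* Chosen so that [k ^ 2 * (nm a ^ 2 + 1) <= 1], which makes [b] a contraction. *)
pose k : R := (nm a + 1)^-1.
have a0 := nm_ge0 a.
have k0 : 0 < k by rewrite invr_gt0; lra.
have ka : k * (nm a + 1) = 1 by rewrite mulVf // gt_eqF //; lra.
pose b : A := (k ^+ 2)%:C *: (a * a - 1).
have bS : star b = b by rewrite starZr starB starM star1 aS.
have b1 : nm b <= 1.
  rewrite nmZr ger0_norm ?sqr_ge0 //.
  apply: (@le_trans _ _ (k ^+ 2 * (nm a * nm a + 1))).
    rewrite ler_wpM2l ?sqr_ge0 //; apply: (le_trans (ler_nmB _ _)).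
    by rewrite lerD ?nm1_le1 // nmM_le.
  have : k ^+ 2 * (nm a + 1) ^+ 2 = 1 by rewrite -exprMn ka expr1n.
  have := mulr_ge0 (sqr_ge0 k) a0; lra.
have bbS : star (b * b) = b * b by rewrite starM bS.
have bb1 : nm (b * b) <= 1.
  by rewrite nm_sqr_selfadj // expr_le1 // nm_ge0.
(* [1 - z0] is a square root of [1 - b ^ 2]. It serves to bound [1 - b ^ 2] by 1, so that
   [sqrt_exists] applies once more and gives the square root [h] of [b ^ 2]; then [x] is a square
   root of [h]. *)
have [z0 [z0S _ /sqrt_1B z0E z0C _]] := sqrt_exists bbS bb1.
have xS : star (1 - z0) = 1 - z0 by rewrite starB star1 z0S.
have x1 : nm (1 - z0) <= 1.
  apply: (nm_le1_sumsq xS bS); last by rewrite z0E subrK.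
  by rewrite mulrBl mulrBr mulr1 mul1r z0C // mulrA.
have yS : star (1 - b * b) = 1 - b * b by rewrite starB star1 bbS.
have y1 : nm (1 - b * b) <= 1.
  by rewrite -z0E nm_sqr_selfadj // expr_le1 // nm_ge0.
have [z [zS z1 /sqrt_1B + zC _]] := sqrt_exists yS y1.
rewrite subKr => zE.
have [w [wS _ /sqrt_1B wE wC _]] := sqrt_exists zS z1.
pose h : A := 1 - z; pose x : A := 1 - w; rewrite -/h in zE wE; rewrite -/x in wE.
have xS' : star x = x by rewrite starB star1 wS.
have comm1B (p q : A) : p * q = q * p -> p * (1 - q) = (1 - q) * p.
  by move=> pq; rewrite mulrBr mulrBl mulr1 mul1r pq.
have bh : b * h = h * b.
  by apply: (comm1B); apply: zC; apply: (comm1B); rewrite mulrA.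
have ab : a * b = b * a.
  by rewrite mulrZ mulZr mulrBl mulrBr mulr1 mul1r mulrA.
have ax : a * x = x * a.
  apply: (comm1B); apply: wC; apply: zC; apply: (comm1B).
  by rewrite mulrA ab -mulrA ab mulrA.
have hS : star h = h by rewrite starB star1 zS.
clearbody h x.
(* As [(h - b) * (h + b) = 0], the numbers [<h eta, eta> >= 0] and [<b eta, eta> <= 0] coincide and
   therefore vanish. *)
have he0 : h * (h + b) = 0.
  apply: rF => xi; pose eta := r (h + b) xi.
  have e1 : inner (r h eta) eta - inner (r b eta) eta = 0.
    rewrite -innerBl -star_repBl /eta -(star_repM rR) mulrBl !mulrDr.
    by rewrite zE bh opprD addrA addrK subrr star_rep0l inner0l.
  have e2 : inner (r h eta) eta = (nm (r x eta) ^+ 2)%:C.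
    by rewrite nm_star_rep_sqr xS' wE.
  have e3 : inner (r b eta) eta = (k ^+ 2 * (nm (r a eta) ^+ 2 - nm eta ^+ 2))%:C.
    rewrite star_repZl innerZl star_repBl innerBl (star_rep1 rR) inner_nm.
    by rewrite -{1}aS -nm_star_rep_sqr -rmorphB -rmorphM.
  have x0 : r x eta = 0.
    move: e1; rewrite e2 e3 -rmorphB => /complexI h0.
    have := a1 eta; rewrite -(@ler_pXn2r _ 2) ?nnegrE ?nm_ge0 // -subr_le0.
    move/(mulr_ge0_le0 (sqr_ge0 k)) => h1.
    apply: nm_le0_eq0; rewrite -(@ler_pXn2r _ 2) ?nnegrE ?nm_ge0 //.
    by move: h0 h1; rewrite expr0n /=; lra.
  by rewrite (star_repM rR) -/eta -wE (star_repM rR) x0 star_rep0r.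
have e0 : h + b = 0.
  apply: nm0_eq0; apply/eqP; rewrite -sqrf_eq0 -nm_sqr_selfadj.
    rewrite mulrDl he0 add0r mulrDr bh -zE addrC -mulrDr he0 nm0 //.
  by rewrite starD bS hS.
(* Undoing the scaling: [s ^ 2 = h / k ^ 2 = - b / k ^ 2 = 1 - a ^ 2]. *)
pose s : A := (nm a + 1)%:C *: x.
apply: (@nm_le1_sumsq _ _ a s) => //.
- by rewrite starZr xS'.
- by rewrite mulrZ mulZr ax.
rewrite mulrZ mulZr scalerA -rmorphM wE.
have -> : h = - b by apply/eqP; rewrite -addr_eq0 e0.
rewrite /b -scalerN scalerA -rmorphM /=.
have -> : (nm a + 1) * (nm a + 1) * k ^+ 2 = 1.
  by rewrite -expr2 -exprMn mulrC ka expr1n.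
by rewrite scale1r opprB addrC subrK.
Qed.

(** The self-adjoint case is applied to [star a * a] divided by [M ^ 2], which requires the bound
    [M] for the adjoint operator as well; this is [sM]. *)
Lemma faithful_isometric a (M : R) : 0 <= M ->
  (forall x, nm (r a x) <= M * nm x) -> nm a <= M.
Proof.
move=> M0 aM.
have sM x : nm (r (star a) x) <= M * nm x.
  have [e0|e0] := eqVneq (nm (r (star a) x)) 0.
    by rewrite e0 mulr_ge0 ?nm_ge0.
  have ep : 0 < nm (r (star a) x) by rewrite lt_neqAle eq_sym e0 nm_ge0.
  rewrite -(ler_pM2r ep) -expr2.
  have -> : nm (r (star a) x) ^+ 2 = complex.Re (inner (r a (r (star a) x)) x).
    by have := nm_star_rep_sqr (star a) x; rewrite starK (star_repM rR) => <-.
  apply: (le_trans (Re_inner_le _ _)); rewrite mulrAC.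
  by rewrite ler_wpM2r ?nm_ge0.
have [M00|Mn0] := eqVneq M 0.
  have -> : a = 0 by apply: rF => x; apply: nm_le0_eq0; have := aM x; rewrite M00 mul0r.
  by rewrite nm0.
have Mp : 0 < M by rewrite lt_neqAle eq_sym Mn0.
rewrite -(@ler_pXn2r _ 2) ?nnegrE ?nm_ge0 // -nm_cstar.
rewrite -[leRHS]mulr1 -ler_pdivrMl ?exprn_gt0 //.
have -> : (M ^+ 2)^-1 * nm (star a * a) = nm ((M ^+ 2)^-1%:C *: (star a * a)).
  by rewrite nmZr ger0_norm // invr_ge0 sqr_ge0.
apply: faithful_selfadj_le1; first by rewrite starZr starM starK.
move=> x; rewrite star_repZl nmZr ger0_norm ?invr_ge0 ?sqr_ge0 //.
rewrite ler_pdivrMl ?exprn_gt0 // (star_repM rR).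
by apply: (le_trans (sM _)); rewrite expr2 -mulrA ler_wpM2l.
Qed.

End representations.

Section star_homs.
Context {R : realType}.
Implicit Types A B C : cstarAlgType R.

Section one.
Context {A B} (f : A -> B) (fH : star_hom f).

Lemma star_homP (c : R[i]) a b : f (c *: a + b) = c *: f a + f b.
Proof. exact: (star_hom_linear fH). Qed.

Lemma star_homD a b : f (a + b) = f a + f b.
Proof. by rewrite -{1}[a]scale1r star_homP scale1r. Qed.

Lemma star_hom0 : f 0 = 0.
Proof. by apply: (addrI (f 0)); rewrite -star_homD !addr0. Qed.

Lemma star_homZ (c : R[i]) a : f (c *: a) = c *: f a.
Proof. by rewrite -[c *: a]addr0 star_homP star_hom0 addr0. Qed.

Lemma star_homN a : f (- a) = - f a.
Proof. by rewrite -scaleN1r star_homZ scaleN1r. Qed.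

Lemma star_homB a b : f (a - b) = f a - f b.
Proof. by rewrite star_homD star_homN. Qed.

Lemma star_hom1 : f 1 = 1.
Proof. by have [] := star_hom_monoid fH. Qed.

Lemma star_homM a b : f (a * b) = f a * f b.
Proof. by have [_] := star_hom_monoid fH; apply. Qed.

Lemma star_homS a : f (star a) = star (f a).
Proof. exact: (star_hom_star fH). Qed.

Lemma star_hom_sum (I : Type) (s : seq I) (P : pred I) (F : I -> A) :
  f (\sum_(k <- s | P k) F k) = \sum_(k <- s | P k) f (F k).
Proof.
elim/big_rec2: _ => [|k y z _ <-]; [exact: star_hom0|exact: star_homD].
Qed.

Lemma star_hom_unitary u : unitaries u -> unitaries (f u).
Proof. by move=> [u1 u2]; split; rewrite -star_homS -star_homM ?u1 ?u2 star_hom1. Qed.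

(** The image of the real part of a unitary is again the real part of a unitary; this settles
    self-adjoint contractions, and the C*-identity reduces everything to them. *)
Lemma star_hom_nm_le a : nm (f a) <= nm a.
Proof.
have selfadj_le1 b : star b = b -> nm b <= 1 -> nm (f b) <= 1.
  move=> bS b1; have [u uU ->] := selfadj_unitary bS b1.
  rewrite star_homZ star_homD star_homS; apply: nm_re_unitary.
  exact: star_hom_unitary.
have selfadj_le b : star b = b -> nm (f b) <= nm b.
  move=> bS; have [b0|b0] := eqVneq (nm b) 0.
    by rewrite (nm0_eq0 b0) star_hom0 !nm0.
  have bp : 0 < nm b by rewrite lt_neqAle eq_sym b0 nm_ge0.
  have := @selfadj_le1 ((nm b)^-1%:C *: b); rewrite starZr bS nmZr.
  rewrite ger0_norm ?invr_ge0 ?nm_ge0 // mulVf // lexx star_homZ nmZr.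
  rewrite ger0_norm ?invr_ge0 ?nm_ge0 // => /(_ erefl isT).
  by rewrite ler_pdivrMl // mulr1.
rewrite -(@ler_pXn2r _ 2) ?nnegrE ?nm_ge0 // -!nm_cstar -star_homS -star_homM.
by apply: selfadj_le; rewrite starM starK.
Qed.

Lemma star_hom_continuous : continuous f.
Proof.
move=> a; apply/nm_continuousP => e e0.
have /nm_continuousP /(_ e e0) : {for a, continuous (@id A)} by exact: cvg_id.
apply: filterS => b; apply: le_lt_trans.
by rewrite -star_homB star_hom_nm_le.
Qed.

Lemma star_hom_rep (H : hilbertType R) (r : B -> H -> H) : star_rep r -> star_rep (r \o f).
Proof.
move=> rR; split => /=.
- by move=> c a b x; rewrite star_homP (star_repPl rR).
- by move=> c a x y; rewrite (star_repPr rR).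
- by move=> x; rewrite star_hom1 (star_rep1 rR).
- by move=> a b x; rewrite star_homM (star_repM rR).
- by move=> a x y; rewrite (star_repS rR) star_homS.
Qed.

End one.

Lemma star_hom_comp A B C (f : A -> B) (g : B -> C) :
  star_hom f -> star_hom g -> star_hom (g \o f).
Proof.
move=> fH gH; split => /=.
- by move=> c a b /=; rewrite (star_homP fH) (star_homP gH).
- by split => [|a b] /=; rewrite ?(star_hom1 fH) ?(star_hom1 gH) // (star_homM fH) (star_homM gH).
- by move=> a /=; rewrite (star_homS fH) (star_homS gH).
Qed.

Lemma star_hom_id A : star_hom (@id A).
Proof. by split. Qed.

Lemma star_hom_inv A B (f : A -> B) (g : B -> A) :
  star_hom f -> cancel f g -> cancel g f -> star_hom g.
Proof.
move=> fH fg gf; split.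
- by move=> c a b; apply: (can_inj fg); rewrite (star_homP fH) !gf.
- split => [|a b]; apply: (can_inj fg); first by rewrite gf (star_hom1 fH).
  by rewrite (star_homM fH) !gf.
- by move=> a; apply: (can_inj fg); rewrite (star_homS fH) !gf.
Qed.

End star_homs.

(** * Positivity of matrices over a C*-algebra *)

Lemma Re_real (R : realType) (c : R[i]) : conjc c = c -> c = (complex.Re c)%:C.
Proof.
case: c => a b [] h; congr Complex; lra.
Qed.

Lemma conj_ge0_real (R : realType) (c : R[i]) : 0 <= c -> conjc c = c.
Proof.
by case: c => a b; rewrite lecE /= => /andP[/eqP -> _]; rewrite oppr0.
Qed.

(* A sesquilinear form with real diagonal is hermitian. *)
Lemma real_polarization (R : realType) (u v : R[i]) :
  conjc (u + v) = u + v -> conjc ('i * u - 'i * v) = 'i * u - 'i * v ->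
  v = conjc u.
Proof.
case: u => a b; case: v => c d [] h1 [] /= h2; congr Complex; lra.
Qed.

(** Meant for the expansion of a form at [g + c g']: once the two diagonal terms are real, so is the
    cross term [u]. *)
Lemma real_cancel (R : realType) (c x y u : R[i]) :
  conjc (x + conjc c * c * y + u) = x + conjc c * c * y + u ->
  conjc x = x -> conjc y = y -> conjc u = u.
Proof.
move=> h /Re_real xe /Re_real ye; move: h; rewrite xe ye.
by case: c u => [a b] [e f] [] h; congr Complex; lra.
Qed.

(** If [a 0 = N + d] with [d > 0], each step gains at least [d], because [a ^ 2 / N >= a + d] as
    soon as [a >= N + d]. This contradicts boundedness. *)
Lemma log_convex_bounded (R : realType) (a : nat -> R) (N C : R) : 0 <= N ->
  (forall k, a k ^+ 2 <= N * a k.+1) -> (forall k, a k <= C) -> a 0%N <= N.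
Proof.
move=> N0 aS aC; rewrite leNgt; apply/negP => Na.
have Np : 0 < N.
  rewrite lt_neqAle N0 andbT; apply/eqP => N00.
  have := aS 0%N; rewrite -N00 mul0r leNgt => /negP; apply.
  by rewrite exprn_gt0 // N00.
pose d := a 0%N - N.
have dE : a 0%N = N + d by rewrite /d addrC subrK.
have dp : 0 < d by rewrite subr_gt0.
clearbody d.
have grow k : a 0%N + k%:R * d <= a k.
  elim: k => [|k ih]; first by rewrite mul0r addr0.
  have dk : 0 <= k%:R * d by rewrite mulr_ge0 // ltW.
  have ak : N + d <= a k by lra.
  rewrite -(ler_pM2l Np); apply: le_trans (aS k).
  rewrite -natr1 mulrDl mul1r.
  have : N * (a 0%N + k%:R * d) <= N * a k by rewrite ler_wpM2l.
  have : (N + d) * a k <= a k * a k by rewrite ler_wpM2r //; lra.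
  have : d * N <= d * a k by rewrite ler_wpM2l ?ltW //; lra.
  lra.
have C1 : 0 < `|C| + 1 by have := normr_ge0 C; lra.
have := archi_boundP (ltW (divr_gt0 C1 dp)).
set m := Num.bound _; rewrite ltr_pdivrMr // => h1.
by have := grow m; have := aC m; have := ler_norm C; lra.
Qed.

Section vectors.
Context {R : realType} {H : hilbertType R} {I : finType}.
Implicit Types (g h : I -> H).

Definition dotv g h : R[i] := \sum_p inner (g p) (h p).
Definition sqn g : R := \sum_p nm (g p) ^+ 2.

Lemma dotv_sqn g : dotv g g = (sqn g)%:C.
Proof. by rewrite /dotv /sqn rmorph_sum; apply: eq_bigr => p _; rewrite inner_nm. Qed.

Lemma sqn_ge0 g : 0 <= sqn g.
Proof. by apply: sumr_ge0 => p _; exact: sqr_ge0. Qed.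

Lemma sqn_ge g p : nm (g p) ^+ 2 <= sqn g.
Proof. by rewrite /sqn (bigD1 p) //= lerDl sumr_ge0 // => q _; exact: sqr_ge0. Qed.

Lemma dotvC g h : dotv g h = conjc (dotv h g).
Proof. by rewrite /dotv rmorph_sum; apply: eq_bigr => p _; rewrite inner_conj. Qed.

Lemma dotvPl (c : R[i]) g g' h :
  dotv (fun p => g p + c *: g' p) h = dotv g h + c * dotv g' h.
Proof.
by rewrite mulr_sumr -big_split; apply: eq_bigr => p _; rewrite innerDl innerZl.
Qed.

Lemma dotvPr (c : R[i]) g g' h :
  dotv h (fun p => g p + c *: g' p) = dotv h g + conjc c * dotv h g'.
Proof.
by rewrite mulr_sumr -big_split; apply: eq_bigr => p _; rewrite innerDr innerZr.
Qed.

Definition single (p : I) (x : H) : I -> H := fun s => if s == p then x else 0.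

Lemma dotv_single g p x : dotv g (single p x) = inner (g p) x.
Proof.
rewrite /dotv (bigD1 p) //= /single eqxx big1 ?addr0 // => q /negPf ->.
by rewrite inner0r.
Qed.

Lemma sqn_single p x : sqn (single p x) = nm x ^+ 2.
Proof. by apply: complexI; rewrite -dotv_sqn dotv_single /single eqxx inner_nm. Qed.

End vectors.

Section matrices.
Context {R : realType} {A : cstarAlgType R} {I : finType}.
Implicit Types (z w : I -> I -> A).

(** The entry [w p q] maps coordinate [p] to coordinate [q], hence the order of the factors:
    [act_sqmx] makes this the square for composition. *)
Definition sqmx w : I -> I -> A := fun p q => \sum_s w s q * w p s.

Definition herm z := forall p q, star (z p q) = z q p.

Lemma herm_sqmx w : herm w -> herm (sqmx w).
Proof.
move=> wS p q; rewrite star_sum; apply: eq_bigr => s _.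
by rewrite starM !wS.
Qed.

Section action.
Context {H : hilbertType R} (r : A -> H -> H) (rR : star_rep r).
Implicit Types (g h : I -> H).

Definition act z h : I -> H := fun q => \sum_p r (z p q) (h p).

Lemma act_sqmx w h : act (sqmx w) h =1 act w (act w h).
Proof.
move=> q; rewrite /act /sqmx.
under eq_bigr do rewrite (star_rep_suml rR).
rewrite exchange_big; apply: eq_bigr => s _ /=.
by rewrite (star_rep_sumr rR); apply: eq_bigr => p _; rewrite (star_repM rR).
Qed.

Lemma actP z (c : R[i]) g g' q :
  act z (fun p => g p + c *: g' p) q = act z g q + c *: act z g' q.
Proof.
rewrite /act scaler_sumr -big_split; apply: eq_bigr => p _ /=.
by rewrite (star_repDr rR) (star_repZr rR).
Qed.

Lemma act_single z p x q : act z (single p x) q = r (z p q) x.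
Proof.
rewrite /act (bigD1 p) //= /single eqxx big1 ?addr0 // => s /negPf ->.
by rewrite (star_rep0r rR).
Qed.

Lemma dotv_act z h h' :
  dotv (act z h) h' = \sum_p \sum_q inner (r (z p q) (h p)) (h' q).
Proof.
rewrite exchange_big; apply: eq_bigr => q _ /=.
by rewrite inner_suml.
Qed.

Lemma dotv_act_herm z h h' : herm z -> dotv (act z h) h' = dotv h (act z h').
Proof.
move=> zS; rewrite dotv_act; apply: eq_bigr => p _; rewrite inner_sumr.
by apply: eq_bigr => q _; rewrite (star_repS rR) zS.
Qed.

Lemma sqn_act w h : herm w ->
  dotv (act (sqmx w) h) h = (sqn (act w h))%:C.
Proof.
move=> wS; rewrite -dotv_sqn -[RHS](dotv_act_herm _ _ wS).
by apply: eq_bigr => q _; rewrite act_sqmx.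
Qed.

Lemma dotv_act_le z h : `|dotv (act z h) h| <= ((\sum_p \sum_q nm (z p q)) * sqn h)%:C.
Proof.
rewrite nmE lecR dotv_act; apply: (le_trans (nm_sum _ _ _)).
rewrite mulr_suml; apply: ler_sum => p _; apply: (le_trans (nm_sum _ _ _)).
rewrite mulr_suml; apply: ler_sum => q _; apply: (le_trans (nm_inner_le _ _)).
apply: (@le_trans _ _ (nm (z p q) * nm (h p) * nm (h q))).
  by rewrite ler_wpM2r ?nm_ge0 // (nm_star_rep_le rR).
rewrite -mulrA ler_wpM2l ?nm_ge0 //.
have := sqn_ge h p; have := sqn_ge h q; have := sqr_ge0 (nm (h p) - nm (h q)).
lra.
Qed.

(** A positive form is real on the diagonal, so polarization with [c = 1] and [c = i] makes it
    hermitian; faithfulness carries this back to the entries. *)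
Lemma pos_herm z : (forall a, (forall x, r a x = 0) -> a = 0) ->
  (forall h, 0 <= dotv (act z h) h) -> herm z.
Proof.
move=> rF z0 p q; apply/esym/eqP; rewrite -subr_eq0; apply/eqP/rF => x; apply: inner_eq0 => y.
have key (c : R[i]) : conjc (conjc c * dotv (act z (single q x)) (single p y) +
      c * dotv (act z (single p y)) (single q x)) =
   conjc c * dotv (act z (single q x)) (single p y) + c * dotv (act z (single p y)) (single q x).
  set g := single q x; set g' := single p y.
  have := conj_ge0_real (z0 (fun s => g s + c *: g' s)).
  have -> : dotv (act z (fun s => g s + c *: g' s)) (fun s => g s + c *: g' s) =
     dotv (act z g) g + (conjc c * c) * dotv (act z g') g' +
      (conjc c * dotv (act z g) g' + c * dotv (act z g') g).
    have -> : act z (fun s => g s + c *: g' s) = fun s => act z g s + c *: act z g' s.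
      by apply/funext => s; exact: actP.
    by rewrite dotvPl !dotvPr; ring.
  move/real_cancel; apply; exact: conj_ge0_real.
rewrite (star_repBl rR) innerBl -(star_repS2 rR) -[r (z q p) x](act_single z q x p) -dotv_single.
rewrite [inner x _]inner_conj -[r (z p q) y](act_single z p y q) -dotv_single.
apply/eqP; rewrite subr_eq0; apply/eqP.
apply: real_polarization.
  by have := key 1; rewrite conjc1 !mul1r addrC.
have := key 'i; have -> : conjc 'i = - 'i :> R[i] by apply/eqP; rewrite eq_complex /= oppr0 !eqxx.
by rewrite mulNr addrC.
Qed.

End action.

Context {H : hilbertType R} (pi : A -> H -> H) (piR : star_rep pi)
  (piF : forall a, (forall x, pi a x = 0) -> a = 0).

(** With [0 <= T <= 1], expand [0 <= <T (h - T h), h - T h>] and bound [<T h, h>] and [<T T h, T h>]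
    by the squared norms of [h] and [T h]. *)
Lemma pos_contraction w : herm w ->
  (forall h, 0 <= dotv (act pi w h) h) ->
  (forall h, dotv (act pi w h) h <= (sqn h)%:C) ->
  forall h, sqn (act pi w h) <= sqn h.
Proof.
move=> wS w0 w1 h; set T := act pi w.
have := w0 (fun p => h p + (-1) *: T h p).
rewrite -/T.
have -> : T (fun p => h p + (-1) *: T h p) = fun p => T h p + (-1) *: T (T h) p.
  by apply/funext => q; exact: actP.
rewrite dotvPl !dotvPr (dotv_act_herm piR (T h) h wS) -/T.
have -> : conjc (-1) = -1 :> R[i] by rewrite rmorphN rmorph1.
have := w1 h; have := w1 (T h); rewrite -/T dotv_sqn !mulN1r opprD opprK.
case: (dotv (T (T h)) (T h)) => a b; case: (dotv (T h) h) => c d.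
by rewrite !lecE /= => /andP[_ h1] /andP[_ h2] /andP[_]; lra.
Qed.

Definition sqiter w k := iter k sqmx w.

Lemma herm_sqiter w k : herm w -> herm (sqiter w k).
Proof. by move=> wS; elim: k => //= k; exact: herm_sqmx. Qed.

Lemma sqiter_contraction w k :
  (forall h, sqn (act pi w h) <= sqn h) ->
  forall h, sqn (act pi (sqiter w k) h) <= sqn h.
Proof.
move=> wc; elim: k => //= k ih h.
rewrite (_ : sqn _ = sqn (act pi (sqiter w k) (act pi (sqiter w k) h))).
  exact: le_trans (ih _) (ih _).
by apply: eq_bigr => q _; rewrite act_sqmx.
Qed.

Lemma sqiter_entry w k p q :
  (forall h, sqn (act pi w h) <= sqn h) -> nm (sqiter w k p q) <= 1.
Proof.
move=> wc; apply: (faithful_isometric piR piF) => // x; rewrite mul1r.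
rewrite -(@ler_pXn2r _ 2) ?nnegrE ?nm_ge0 // -[leRHS](sqn_single p).
apply: le_trans (sqiter_contraction k wc _).
by rewrite -(act_single piR (sqiter w k) p x q); exact: sqn_ge.
Qed.

Context {K : hilbertType R} (r : A -> K -> K) (rR : star_rep r).

(* The numbers [a_k = <w ^ (2 ^ k) h, h>] are log-convex, and bounded because
   the entries of the powers of [w] are. *)
Lemma contraction_transfer w : herm w ->
  (forall h, sqn (act pi w h) <= sqn h) ->
  forall h, dotv (act r w h) h <= (sqn h)%:C.
Proof.
move=> wS wc h.
have aE k : dotv (act r (sqiter w k) h) h =
    (complex.Re (dotv (act r (sqiter w k) h) h))%:C.
  apply: Re_real; rewrite -dotvC; apply/esym/dotv_act_herm => //.
  exact: herm_sqiter.
pose a k := complex.Re (dotv (act r (sqiter w k) h) h).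
pose N := sqn h.
have aS k : a k ^+ 2 <= N * a k.+1.
  have aSE : a k.+1 = sqn (act r (sqiter w k) h).
    by rewrite /a /= sqn_act //; exact: herm_sqiter.
  set T := act r (sqiter w k) h in aSE *.
  (* The squared norm of [T - s h]; its value at [s = a k / N] is the log-convexity. *)
  have ge0 (s : R) : 0 <= s ^+ 2 * N - 2 * s * a k + a k.+1.
    rewrite -ler0c; have := dotv_sqn (fun p => T p + (- s)%:C *: h p).
    rewrite dotvPl !dotvPr conjc_real !dotv_sqn [dotv h T]dotvC (aE k) -/(a k) conjc_real.
    rewrite -aSE -!(rmorphM, rmorphD) => /complexI e.
    have := sqn_ge0 (fun p => T p + (- s)%:C *: h p); rewrite -e ler0c -/N.
    by move: (a k) (a k.+1) => u v; lra.
  have [N0|N0] := eqVneq N 0.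
    rewrite N0 mul0r -(ler_pM2l (_ : 0 < 1 :> R)) // mulr0 mul1r.
    (* For [N = 0] the quadratic is affine in [s]. Unless [a k = 0], its value at this [s] is
       [- a k.+1 - 2], which is negative. *)
    have := ge0 (a k * ((a k.+1 + 1) / (a k ^+ 2))).
    have [->|ak0] := eqVneq (a k) 0; first by rewrite expr0n.
    have a1 : 0 <= a k.+1 by rewrite aSE sqn_ge0.
    rewrite N0 mulr0 add0r => h1; exfalso.
    have : 2 * (a k * ((a k.+1 + 1) / a k ^+ 2)) * a k = 2 * (a k.+1 + 1) by field.
    by lra.
  have Np : 0 < N by rewrite lt_neqAle eq_sym N0 sqn_ge0.
  have := ge0 (a k / N).
  have -> : (a k / N) ^+ 2 * N - 2 * (a k / N) * a k + a k.+1 = a k.+1 - a k ^+ 2 / N by field.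
  by rewrite subr_ge0 ler_pdivrMr // mulrC.
have [C aC] : exists C, forall k, a k <= C.
  exists ((\sum_(p : I) \sum_(q : I) 1) * N) => k.
  apply: (le_trans (ler_Re_nm _)); have := dotv_act_le rR (sqiter w k) h.
  rewrite nmE lecR => /le_trans; apply; rewrite ler_wpM2r ?sqn_ge0 //.
  by do 2![apply: ler_sum => ? _]; exact: sqiter_entry.
rewrite (aE 0%N) lecR.
exact: (@log_convex_bounded _ a N C (sqn_ge0 h)).
Qed.

(** [C] dominates the form of [z], so positivity in [pi] makes [w = 1 - z / C] a contraction there.
    Then [w <= 1] in [r], which says [z >= 0] in [r]. *)
Lemma pos_transfer (z : I -> I -> A) :
  (forall h, 0 <= \sum_p \sum_q inner (pi (z p q) (h p)) (h q)) ->
  forall h, 0 <= \sum_p \sum_q inner (r (z p q) (h p)) (h q).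
Proof.
move=> z0 h.
have {}z0 g : 0 <= dotv (act pi z g) g by rewrite dotv_act.
rewrite -dotv_act.
have zS := pos_herm piR piF z0.
pose C := \sum_p \sum_q nm (z p q) + 1.
have Cp : 0 < C.
  by rewrite ltr_wpDl // sumr_ge0 // => p _; rewrite sumr_ge0 // => q _; exact: nm_ge0.
pose w p q : A := (p == q)%:R%:C *: (1 : A) - C^-1%:C *: z p q.
have wS : herm w.
  by move=> p q; rewrite starB !starZr star1 zS eq_sym.
have wE (L : hilbertType R) (s : A -> L -> L) (g : I -> L) : star_rep s ->
    dotv (act s w g) g = (sqn g)%:C - C^-1%:C * dotv (act s z g) g.
  move=> sR; rewrite -dotv_sqn -mulNr -dotvPl; apply: eq_bigr => q _; congr (inner _ _).
  rewrite /act scaler_sumr.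
  have -> : g q = \sum_p (p == q)%:R%:C *: g p.
    by rewrite (bigD1 q) //= eqxx scale1r big1 ?addr0 // => p /negPf ->; rewrite scale0r.
  rewrite -big_split; apply: eq_bigr => p _ /=.
  by rewrite (star_repBl sR) !(star_repZl sR) (star_rep1 sR) scaleNr.
have wc : forall g, sqn (act pi w g) <= sqn g.
  apply: pos_contraction => // g; rewrite wE //.
    rewrite subr_ge0 -(ler_pM2l (_ : 0 < C%:C)) ?ltcR //.
    rewrite mulrA -!rmorphM /= mulfV ?gt_eqF // mul1r.
    apply: (@le_trans _ _ `|dotv (act pi z g) g|); first by rewrite ger0_norm.
    apply: (le_trans (dotv_act_le piR _ _)); rewrite lecR.
    by rewrite ler_wpM2r ?sqn_ge0 // lerDl.
  by rewrite lerBlDr lerDl mulr_ge0 // ler0c invr_ge0 ltW.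
have := contraction_transfer wS wc h; rewrite wE // lerBlDr lerDl.
by rewrite pmulr_rge0 // ltcR invr_gt0.
Qed.

End matrices.

(** * Homomorphisms out of spatial tensor products *)

Lemma dense_nm (R : realType) (V : normedModType R[i]) (S : set V) (x : V) (e : R) :
  dense S -> 0 < e -> exists2 y, S y & nm (x - y) < e.
Proof.
move=> dS e0.
have e0' : 0 < e%:C :> R[i] by rewrite ltcR.
have [y [/interior_subset By Sy]] := dS (ball x e%:C)°
  (ex_intro _ x (nbhs_singleton (nbhs_interior (nbhsx_ballx x _ e0')))) (@open_interior _ _).
by exists y => //; move: By; rewrite -ball_normE /= nmE ltcR.
Qed.

Lemma ge0_closed (R : realType) (u : R[i]) :
  (forall e : R, 0 < e -> exists2 v, 0 <= v & nm (u - v) <= e) -> 0 <= u.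
Proof.
move=> h.
have imh (e : R) : 0 < e -> `|complex.Im u| <= e.
  move=> /h [v v0]; apply: le_trans.
  rewrite -[complex.Im u]subr0 -(ger0_Im v0).
  case: u v {h v0} => a b [c d] /=; rewrite /nm normc_def /=.
  by rewrite -sqrtr_sqr ler_sqrt ?lerDr ?addr_ge0 ?sqr_ge0.
have reh (e : R) : 0 < e -> - e <= complex.Re u.
  move=> /h [v v0] uv.
  have := ler_Re_nm (v - u); rewrite nmB.
  by move: v0 uv; rewrite lecE => /andP[_]; case: u v {h imh} => a b [c d] /=; lra.
rewrite lecE /=; apply/andP; split.
  rewrite -normr_eq0; apply/eqP/le_anti; rewrite normr_ge0 andbT.
  by apply/ler_addgt0Pl => e e0; rewrite addr0 imh.
by apply/ler_addgt0Pl => e e0; have := reh e e0; lra.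
Qed.

Definition faithful (R : realType) (A : cstarAlgType R) (H : hilbertType R)
  (r : A -> H -> H) : Prop := forall a, (forall x, r a x = 0) -> a = 0.

Section form_continuity.
Context {R : realType} {A : cstarAlgType R} {H : hilbertType R}.
Context (r : A -> H -> H) (rR : star_rep r).

Lemma star_form_close (I : finType) (z : I -> I -> A) (h : I -> H) (e : R) : 0 < e ->
  exists2 d : R, 0 < d & forall h', (forall p, nm (h p - h' p) < d) ->
    nm (\sum_p \sum_q inner (r (z p q) (h p)) (h q) -
        \sum_p \sum_q inner (r (z p q) (h' p)) (h' q)) <= e.
Proof.
(* The [(p, q)] term changes by at most [d * nm (z p q)] times the bracket, in which [1] accounts
   for [nm (h' p) <= nm (h p) + 1]. *)
move=> e0; pose C := \sum_p \sum_q nm (z p q) * (nm (h p) + nm (h q) + 1).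
have C0 : 0 <= C.
  apply: sumr_ge0 => p _; apply: sumr_ge0 => q _.
  by have := nm_ge0 (h p); have := nm_ge0 (h q); have := nm_ge0 (z p q); nra.
have C1 : 0 < C + 1 by lra.
exists (Num.min 1 (e / (C + 1))); first by rewrite lt_min ltr01 divr_gt0.
move=> h' hh'; rewrite -sumrB.
have dC : C * Num.min 1 (e / (C + 1)) <= e.
  apply: (@le_trans _ _ (C * (e / (C + 1)))).
    by rewrite ler_wpM2l // ge_min lexx orbT.
  by rewrite mulrA ler_pdivrMr // mulrC ler_wpM2l ?ltW //; lra.
have d1 : Num.min 1 (e / (C + 1)) <= 1 by rewrite ge_min lexx.
move: dC d1 hh'; set d := Num.min _ _ => dC d1 hh'.
apply: le_trans dC; apply: (le_trans (nm_sum _ _ _)).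
rewrite mulr_suml; apply: ler_sum => p _; rewrite -sumrB.
apply: (le_trans (nm_sum _ _ _)).
rewrite mulr_suml; apply: ler_sum => q _.
have -> : inner (r (z p q) (h p)) (h q) - inner (r (z p q) (h' p)) (h' q) =
  inner (r (z p q) (h p - h' p)) (h q) + inner (r (z p q) (h' p)) (h q - h' q).
  by rewrite (star_repBr rR) innerBl innerBr addrA subrK.
apply: (le_trans (ler_nmD _ _)).
have b1 : nm (inner (r (z p q) (h p - h' p)) (h q)) <= nm (z p q) * d * nm (h q).
  apply: (le_trans (nm_inner_le _ _)); rewrite ler_wpM2r ?nm_ge0 //.
  apply: (le_trans (nm_star_rep_le rR _ _)); rewrite ler_wpM2l ?nm_ge0 //.
  exact: ltW.
have h'1 : nm (h' p) <= nm (h p) + 1.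
  have := ler_nmD (h p) (h' p - h p); rewrite addrC subrK nmB.
  by have := hh' p; lra.
have b2 : nm (inner (r (z p q) (h' p)) (h q - h' q)) <= nm (z p q) * (nm (h p) + 1) * d.
  apply: (le_trans (nm_inner_le _ _)); apply: ler_pM; rewrite ?nm_ge0 //; last exact: ltW.
  by apply: (le_trans (nm_star_rep_le rR _ _)); rewrite ler_wpM2l ?nm_ge0.
by move: b1 b2; lra.
Qed.

Lemma star_form_ge0_closed (I : finType) (z : I -> I -> A) (h : I -> H) :
  (forall d : R, 0 < d -> exists2 h', (forall p, nm (h p - h' p) < d) &
     0 <= \sum_p \sum_q inner (r (z p q) (h' p)) (h' q)) ->
  0 <= \sum_p \sum_q inner (r (z p q) (h p)) (h q).
Proof.
move=> happ; apply: ge0_closed => e /(star_form_close z h) [d d0 dh].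
have [h' hh' h'0] := happ d d0.
by exists (\sum_p \sum_q inner (r (z p q) (h' p)) (h' q)) => //; exact: dh.
Qed.

Lemma star_rep_ge0_closed (a : A) (x : H) :
  (forall d : R, 0 < d -> exists2 y, nm (x - y) < d & 0 <= inner (r a y) y) ->
  0 <= inner (r a x) x.
Proof.
move=> happ.
have := @star_form_ge0_closed 'I_1 (fun _ _ => a) (fun _ => x).
rewrite !big_ord1; apply => d /happ [y xy y0].
by exists (fun=> y) => //; rewrite !big_ord1.
Qed.

End form_continuity.

Section tens.
Context {R : realType} {A B T : cstarAlgType R} (i : A -> T) (j : B -> T).
Implicit Types (s : seq (A * B)) (a : A) (b : B).

(** An element of the algebraic tensor product is given by a list of pairs, so that the same list
    can be evaluated along different pairs of homomorphisms. *)
Definition tens s : T := \sum_(p <- s) i p.1 * j p.2.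

Lemma tens_cons p s : tens (p :: s) = i p.1 * j p.2 + tens s.
Proof. by rewrite /tens big_cons. Qed.

Lemma tens1 a b : tens [:: (a, b)] = i a * j b.
Proof. by rewrite /tens big_seq1. Qed.

Lemma tens_cat s1 s2 : tens (s1 ++ s2) = tens s1 + tens s2.
Proof. by rewrite /tens big_cat. Qed.

Lemma tens_scale c s : star_hom i -> tens [seq (c *: p.1, p.2) | p <- s] = c *: tens s.
Proof.
move=> iH; rewrite /tens big_map scaler_sumr; apply: eq_bigr => p _.
by rewrite (star_homZ iH) cstar_scalerAl.
Qed.

Lemma tens_sums x : sums (fun a b => i a * j b) x -> exists s, x = tens s.
Proof.
move=> [n [a [b ->]]]; exists [seq (a k, b k) | k <- enum 'I_n].
by rewrite /tens big_map big_enum.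
Qed.

Lemma tens_mul s1 s2 : star_hom i -> star_hom j ->
  (forall a b, i a * j b = j b * i a) ->
  tens [seq (p.1 * q.1, p.2 * q.2) | p <- s1, q <- s2] = tens s1 * tens s2.
Proof.
move=> iH jH ij; rewrite /tens big_allpairs_dep /= mulr_suml.
apply: eq_bigr => p _; rewrite mulr_sumr; apply: eq_bigr => q _ /=.
rewrite (star_homM iH) (star_homM jH) !mulrA; congr (_ * _).
by rewrite -!mulrA ij.
Qed.

Lemma tens_star s : star_hom i -> star_hom j ->
  (forall a b, i a * j b = j b * i a) ->
  tens [seq (star p.1, star p.2) | p <- s] = star (tens s).
Proof.
move=> iH jH ij; rewrite /tens big_map star_sum; apply: eq_bigr => p _ /=.
by rewrite starM (star_homS iH) (star_homS jH) -starM -ij starM.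
Qed.

End tens.

Section extension.
Context {R : realType} {A B T C : cstarAlgType R}.
Context (i : A -> T) (j : B -> T) (f : A -> C) (g : B -> C).
Hypotheses (iH : star_hom i) (jH : star_hom j) (fH : star_hom f) (gH : star_hom g).
Hypothesis ij : forall a b, i a * j b = j b * i a.
Hypothesis fg : forall a b, f a * g b = g b * f a.
Hypothesis ij_dense : forall x (e : R), 0 < e -> exists s, nm (x - tens i j s) < e.
Hypothesis bound : forall s, nm (tens f g s) <= nm (tens i j s).

(** The closure of the graph of [tens i j s |-> tens f g s]. It is stable under all operations, and
    [bound] makes it single-valued, so the extension is obtained without comparing approximating
    sequences. *)
Definition ext_rel (x : T) (c : C) : Prop :=
  forall e : R, 0 < e -> exists s, nm (x - tens i j s) < e /\ nm (c - tens f g s) < e.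

Lemma ext_rel_tens s : ext_rel (tens i j s) (tens f g s).
Proof. by move=> e e0; exists s; rewrite !subrr !nm0. Qed.

Lemma ext_rel_bound x c : ext_rel x c -> nm c <= nm x.
Proof.
move=> xc; apply/ler_addgt0Pl => e e0.
have [|s [xs cs]] := xc (e / 2); first by lra.
have := ler_nmD (c - tens f g s) (tens f g s); rewrite subrK.
have := ler_nmD (tens i j s - x) x; rewrite subrK nmB.
by have := bound s; lra.
Qed.

Lemma ext_rel_P k x c x' c' : ext_rel x c -> ext_rel x' c' ->
  ext_rel (k *: x + x') (k *: c + c').
Proof.
move=> xc xc' e e0; pose K := nm k + 1.
have K0 : 0 < K by rewrite /K; have := nm_ge0 k; lra.
have eK : 0 < e / (2 * K) by rewrite divr_gt0 // mulr_gt0.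
have [s [xs cs]] := xc _ eK.
have [|s' [xs' cs']] := xc' (e / 2); first by lra.
exists ([seq (k *: p.1, p.2) | p <- s] ++ s').
rewrite !tens_cat !tens_scale //.
have key (V : cstarAlgType R) (y z y' z' : V) : nm (y - z) < e / (2 * K) ->
    nm (y' - z') < e / 2 -> nm (k *: y + y' - (k *: z + z')) < e.
  move=> yz yz'; rewrite opprD addrACA -scalerBr.
  apply: (le_lt_trans (ler_nmD _ _)); rewrite nmZ.
  have : nm k * nm (y - z) <= e / 2.
    apply: (@le_trans _ _ (K * (e / (2 * K)))).
      by apply: ler_pM; rewrite ?nm_ge0 //; [rewrite /K; lra|exact: ltW].
    rewrite [leLHS](_ : _ = e / 2) //; field; lra.
  lra.
by split; exact: key.
Qed.

Lemma ext_rel_functional x c c' : ext_rel x c -> ext_rel x c' -> c = c'.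
Proof.
move=> xc xc'; have := ext_rel_bound (ext_rel_P (-1) xc xc').
rewrite !scaleN1r addNr nm0 => /nm_le0_eq0.
by move/eqP; rewrite addrC subr_eq0 => /eqP.
Qed.

Lemma ext_rel_M x c x' c' : ext_rel x c -> ext_rel x' c' -> ext_rel (x * x') (c * c').
Proof.
move=> xc xc' e e0; pose K := nm x + nm x' + nm c + nm c' + 1.
have := nm_ge0 x; have := nm_ge0 x'; have := nm_ge0 c; have := nm_ge0 c'.
move=> c'0 c0 x'0 x0.
have K0 : 0 < K by rewrite /K; lra.
pose d := Num.min 1 (e / (2 * K)).
have d0 : 0 < d by rewrite lt_min ltr01 divr_gt0 // mulr_gt0.
have d1 : d <= 1 by rewrite ge_min lexx.
have dK : d * K <= e / 2.
  apply: (@le_trans _ _ ((e / (2 * K)) * K)).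
    by apply: ler_wpM2r; [exact: ltW|rewrite ge_min lexx orbT].
  rewrite [leLHS](_ : _ = e / 2) //; field; lra.
have [s [xs cs]] := xc _ d0.
have [s' [xs' cs']] := xc' _ d0.
exists [seq (p.1 * q.1, p.2 * q.2) | p <- s, q <- s'].
rewrite !tens_mul //.
have key (V : cstarAlgType R) (y z y' z' : V) : nm (y - z) < d ->
    nm (y' - z') < d -> nm y + nm y' + 1 <= K -> nm (y * y' - z * z') < e.
  move=> yz yz' yK.
  have -> : y * y' - z * z' = (y - z) * y' + z * (y' - z').
    by rewrite mulrBl mulrBr addrA subrK.
  apply: (le_lt_trans (ler_nmD _ _)).
  have b1 := nmM_le (y - z) y'; have b2 := nmM_le z (y' - z').
  have zb : nm z <= nm y + 1.
    by have := ler_nmD (z - y) y; rewrite subrK nmB; lra.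
  have b3 : nm (y - z) * nm y' <= d * nm y' by rewrite ler_wpM2r ?nm_ge0 // ltW.
  have b4 : nm z * nm (y' - z') <= (nm y + 1) * d.
    by apply: ler_pM; rewrite ?nm_ge0 //; exact: ltW.
  have : d * (nm y + nm y' + 1) <= d * K by rewrite ler_wpM2l // ltW.
  lra.
by split; apply: key; rewrite // /K; lra.
Qed.

Lemma ext_rel_S x c : ext_rel x c -> ext_rel (star x) (star c).
Proof.
move=> xc e /xc [s [xs cs]]; exists [seq (star p.1, star p.2) | p <- s].
by rewrite !tens_star // -!starB !nm_star.
Qed.

Lemma ext_rel_total x : exists c, ext_rel x c.
Proof.
have small n : 0 < (n.+1%:R)^-1 :> R by rewrite invr_gt0.
have [s xs] := choice (fun n => ij_dense x (small n)).
have limit0 := @inv_succ_small R.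
have tB u v : nm (tens f g u - tens f g v) <= nm (tens i j u - tens i j v).
  have := bound (u ++ [seq (-1 *: p.1, p.2) | p <- v]).
  by rewrite !tens_cat !tens_scale // !scaleN1r.
have [e e0|c cs] := @nm_complete _ C (fun n => tens f g (s n)).
  have [|N hN] := limit0 (e / 2); first by lra.
  exists N => m n Nm Nn; apply: (le_lt_trans (tB _ _)).
  apply: (le_lt_trans (ler_nmdD x _ _)); rewrite nmB.
  rewrite (splitr e); apply: ltrD.
    exact: lt_trans (xs m) (hN _ Nm).
  exact: lt_trans (xs n) (hN _ Nn).
exists c => e e0; have [N1 h1] := limit0 e e0; have [N2 h2] := cs e e0.
exists (s (maxn N1 N2)); split; last exact/h2/leq_maxr.
apply: (lt_trans (xs _)); exact/h1/leq_maxl.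
Qed.

Lemma tensor_extension : exists F : T -> C,
  [/\ star_hom F, forall a, F (i a) = f a & forall b, F (j b) = g b].
Proof.
have [F xF] := choice ext_rel_total.
have F1 a b : F (i a * j b) = f a * g b.
  by apply: ext_rel_functional (xF _) _; rewrite -!tens1; exact: ext_rel_tens.
have Fi a : F (i a) = f a.
  by have := F1 a 1; rewrite (star_hom1 jH) (star_hom1 gH) !mulr1.
have Fj b : F (j b) = g b.
  by have := F1 1 b; rewrite (star_hom1 iH) (star_hom1 fH) !mul1r.
exists F; split => //; split.
- by move=> k x y; apply: ext_rel_functional (xF _) _; exact: ext_rel_P.
- split; first by rewrite -(star_hom1 iH) Fi (star_hom1 fH).
  by move=> x y; apply: ext_rel_functional (xF _) _; exact: ext_rel_M.
- by move=> x; apply: ext_rel_functional (xF _) _; exact: ext_rel_S.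
Qed.

End extension.

Section tensor_rep_def.
Context {R : realType} {A B T : cstarAlgType R} (i : A -> T) (j : B -> T).
Context {H K L : hilbertType R} (t : H -> K -> L).
Context (rA : A -> H -> H) (rB : B -> K -> K) (rT : T -> L -> L).

(* What is used of [spatial_tensor], in a form that is symmetric in the two
   factors. *)
Record tensor_rep : Prop := TensorRep {
  tr_i : star_hom i;
  tr_j : star_hom j;
  tr_dense : forall x (e : R), 0 < e -> exists s, nm (x - tens i j s) < e;
  tr_inner : forall h k h' k', inner (t h k) (t h' k') = inner h h' * inner k k';
  tr_tdense : forall x (e : R), 0 < e -> exists n (h : 'I_n -> H) (k : 'I_n -> K),
    nm (x - \sum_p t (h p) (k p)) < e;
  tr_pi : star_rep rA;
  tr_piF : faithful rA;
  tr_rho : star_rep rB;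
  tr_rhoF : faithful rB;
  tr_theta : star_rep rT;
  tr_thetaF : faithful rT;
  tr_eq : forall a b h k, rT (i a * j b) (t h k) = t (rA a h) (rB b k)
}.

End tensor_rep_def.

Lemma faithful_rep_faithful (R : realType) (A : cstarAlgType R) (H : hilbertType R)
  (rA : {bilinear A -> H -> H}) : faithful_rep rA -> faithful rA.
Proof.
by move=> pF a a0; apply: (rep_inj pF) => x; rewrite a0 linear0l.
Qed.

Lemma spatial_tensor_rep (R : realType) (A B T : cstarAlgType R) (i : A -> T) (j : B -> T) :
  spatial_tensor i j -> exists (H K L : hilbertType R) (t : H -> K -> L)
    (rA : A -> H -> H) (rB : B -> K -> K) (rT : T -> L -> L),
    tensor_rep i j t rA rB rT.
Proof.
move=> [iH jH ijd [H [K [L [t [rA [rB [rT [[tI td] piF rhoF thetaF e]]]]]]]]].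
exists H, K, L, t, rA, rB, rT; split => //; try exact: faithful_star_rep;
  try exact: faithful_rep_faithful.
- move=> x e0 /(dense_nm x ijd) [y /tens_sums [s ->] ?]; by exists s.
- move=> x e0 /(dense_nm x td) [y [n [h [k ->]]] ?]; by exists n, h, k.
Qed.

Section tensor_rep_theory.
Context {R : realType} {A B T : cstarAlgType R} {i : A -> T} {j : B -> T}.
Context {H K L : hilbertType R} {t : H -> K -> L}.
Context {rA : A -> H -> H} {rB : B -> K -> K} {rT : T -> L -> L}.
Hypothesis tr : tensor_rep i j t rA rB rT.

Local Notation iH := (tr_i tr).
Local Notation jH := (tr_j tr).
Local Notation piR := (tr_pi tr).
Local Notation rhoR := (tr_rho tr).
Local Notation thetaR := (tr_theta tr).

Lemma tr_eql a h k : rT (i a) (t h k) = t (rA a h) k.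
Proof. by rewrite -[i a]mulr1 -(star_hom1 jH) (tr_eq tr) (star_rep1 rhoR). Qed.

Lemma tr_eqr b h k : rT (j b) (t h k) = t h (rB b k).
Proof. by rewrite -[j b]mul1r -(star_hom1 iH) (tr_eq tr) (star_rep1 piR). Qed.

Lemma nm_elem h k : nm (t h k) = nm h * nm k.
Proof.
have := tr_inner tr h k h k; rewrite !inner_nm -rmorphM => /complexI.
rewrite -exprMn => /eqP; rewrite eqrXn2 ?mulr_ge0 ?nm_ge0 //.
by move/eqP.
Qed.

(** Both products act in the same way on elementary tensors, whose sums are dense, and [rT] is
    faithful. *)
Lemma tr_comm a b : i a * j b = j b * i a.
Proof.
apply/eqP; rewrite -subr_eq0; apply/eqP/(tr_thetaF tr) => x.
apply: nm_small => e e0; set z := i a * j b - j b * i a.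
have z1 : 0 < nm z + 1 by have := nm_ge0 z; lra.
have [n [h [k xhk]]] := tr_tdense tr x (divr_gt0 e0 z1).
have -> : rT z x = rT z (x - \sum_p t (h p) (k p)).
  rewrite (star_repBr thetaR) (star_rep_sumr thetaR) big1 ?subr0 // => p _.
  rewrite (star_repBl thetaR) (tr_eq tr) (star_repM thetaR) tr_eql tr_eqr.
  exact: subrr.
apply: (le_trans (nm_star_rep_le thetaR _ _)).
apply: (@le_trans _ _ ((nm z + 1) * (e / (nm z + 1)))).
  by apply: ler_pM; rewrite ?nm_ge0 //; [lra|exact: ltW].
by rewrite mulrC divfK // gt_eqF.
Qed.

Lemma tr_form (I J : finType) (s : seq (A * B)) (h : I -> H) (h' : J -> H)
    (k : I -> K) (k' : J -> K) :
  inner (rT (tens i j s) (\sum_p t (h p) (k p))) (\sum_q t (h' q) (k' q)) =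
  \sum_p \sum_q \sum_(u <- s) inner (rA u.1 (h p)) (h' q) * inner (rB u.2 (k p)) (k' q).
Proof.
rewrite (star_rep_sumr thetaR) inner_suml; apply: eq_bigr => p _.
rewrite inner_sumr; apply: eq_bigr => q _.
rewrite (star_rep_suml thetaR) inner_suml; apply: eq_bigr => u _.
by rewrite (tr_eq tr) (tr_inner tr).
Qed.

Lemma tr_theta_ge0 z :
  (forall n (h : 'I_n -> H) (k : 'I_n -> K),
     0 <= inner (rT z (\sum_p t (h p) (k p))) (\sum_p t (h p) (k p))) ->
  forall x, 0 <= inner (rT z x) x.
Proof.
move=> z0 x; apply: (star_rep_ge0_closed thetaR) => d d0.
by have [n [h [k xhk]]] := tr_tdense tr x d0; exists (\sum_p t (h p) (k p)).
Qed.

Lemma tr_flip : tensor_rep j i (fun k h => t h k) rB rA rT.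
Proof.
split; rewrite ?(tr_i tr, tr_j tr); try by case: tr.
- move=> x e e0; have [s xs] := tr_dense tr x e0.
  exists [seq (p.2, p.1) | p <- s]; rewrite [tens _ _ _](_ : _ = tens i j s) //.
  by rewrite /tens big_map; apply: eq_bigr => p _ /=; rewrite tr_comm.
- by move=> h k h' k'; rewrite (tr_inner tr) mulrC.
- by move=> x e e0; have [n [h [k xhk]]] := tr_tdense tr x e0; exists n, k, h.
- by move=> b a k h; rewrite -tr_comm (tr_eq tr).
Qed.

Lemma scale_rep (C : cstarAlgType R) (G : hilbertType R) (r : C -> G -> G)
  (rR : star_rep r) (I : Type) (s : seq I) (c : I -> R[i]) (F : I -> C) x y :
  inner (r (\sum_(u <- s) c u *: F u) x) y = \sum_(u <- s) c u * inner (r (F u) x) y.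
Proof.
rewrite (star_rep_suml rR) inner_suml; apply: eq_bigr => u _.
by rewrite (star_repZl rR) innerZl.
Qed.

(** One representation is replaced at a time. With the vectors of the other factor fixed, the form
    is that of a matrix over [A], then over [B], and [pos_transfer] applies; this is why positivity
    is transferred for matrices and not only for single elements. *)
Lemma tensor_pos (s : seq (A * B)) :
  (forall x, 0 <= inner (rT (tens i j s) x) x) ->
  forall (H' K' : hilbertType R) (r : A -> H' -> H') (r' : B -> K' -> K'),
  star_rep r -> star_rep r' ->
  forall (I : finType) (h : I -> H') (k : I -> K'),
  0 <= \sum_p \sum_q \sum_(u <- s) inner (r u.1 (h p)) (h q) * inner (r' u.2 (k p)) (k q).
Proof.
move=> s0 H' K' r r' rR r'R I h k.
have step1 (h0 : I -> H) (k0 : I -> K) :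
    0 <= \sum_p \sum_q \sum_(u <- s) inner (rA u.1 (h0 p)) (h0 q) * inner (rB u.2 (k0 p)) (k0 q).
  by rewrite -tr_form.
have step2 (k0 : I -> K) :
    0 <= \sum_p \sum_q \sum_(u <- s) inner (r u.1 (h p)) (h q) * inner (rB u.2 (k0 p)) (k0 q).
  have := pos_transfer piR (tr_piF tr) rR
    (z := fun p q => \sum_(u <- s) inner (rB u.2 (k0 p)) (k0 q) *: u.1).
  have E (G : hilbertType R) (r0 : A -> G -> G) (g : I -> G) : star_rep r0 ->
    \sum_p \sum_q inner (r0 (\sum_(u <- s) inner (rB u.2 (k0 p)) (k0 q) *: u.1) (g p)) (g q) =
    \sum_p \sum_q \sum_(u <- s) inner (r0 u.1 (g p)) (g q) * inner (rB u.2 (k0 p)) (k0 q).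
    move=> r0R; apply: eq_bigr => p _; apply: eq_bigr => q _; rewrite (scale_rep r0R).
    by apply: eq_bigr => u _; rewrite mulrC.
  rewrite -(E _ r) //; apply => g; rewrite (E _ rA) //; exact: piR.
have := pos_transfer rhoR (tr_rhoF tr) r'R
  (z := fun p q => \sum_(u <- s) inner (r u.1 (h p)) (h q) *: u.2).
have E (G : hilbertType R) (r0 : B -> G -> G) (g : I -> G) : star_rep r0 ->
  \sum_p \sum_q inner (r0 (\sum_(u <- s) inner (r u.1 (h p)) (h q) *: u.2) (g p)) (g q) =
  \sum_p \sum_q \sum_(u <- s) inner (r u.1 (h p)) (h q) * inner (r0 u.2 (g p)) (g q).
  by move=> r0R; apply: eq_bigr => p _; apply: eq_bigr => q _; rewrite (scale_rep r0R).
rewrite -(E _ r') //; apply => g; rewrite (E _ rB) //; exact: rhoR.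
Qed.

Section hom.
Context {C : cstarAlgType R} {G : hilbertType R} {r : C -> G -> G}.
Hypotheses (rR : star_rep r) (rF : faithful r).
Context {f : A -> C} {g : B -> C}.
Hypotheses (fH : star_hom f) (gH : star_hom g).
Hypothesis fg : forall a b, f a * g b = g b * f a.

(* Apply the hypothesis to [M ^ 2 - X^* X], where [M] is the norm of [X]. *)
Lemma tensor_bound :
  (forall s, (forall x, 0 <= inner (rT (tens i j s) x) x) ->
     forall y, 0 <= inner (r (tens f g s) y) y) ->
  forall s, nm (tens f g s) <= nm (tens i j s).
Proof.
move=> pos s; set M := nm (tens i j s).
have M0 : 0 <= M by exact: nm_ge0.
pose s2 := ((M ^+ 2)%:C *: (1 : A), (1 : B)) :: [seq (-1 *: p.1, p.2) | p <-
  [seq (p.1 * q.1, p.2 * q.2) | p <- [seq (star p.1, star p.2) | p <- s], q <- s]].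
have E (D : cstarAlgType R) (i' : A -> D) (j' : B -> D) : star_hom i' -> star_hom j' ->
    (forall a b, i' a * j' b = j' b * i' a) ->
    tens i' j' s2 = (M ^+ 2)%:C *: (1 : D) - star (tens i' j' s) * tens i' j' s.
  move=> i'H j'H c; rewrite tens_cons tens_scale // tens_mul // tens_star // scaleN1r.
  by rewrite (star_homZ i'H) (star_hom1 i'H) (star_hom1 j'H) mulr1.
have F (D : cstarAlgType R) (W : hilbertType R) (r0 : D -> W -> W) X w : star_rep r0 ->
    inner (r0 ((M ^+ 2)%:C *: (1 : D) - star X * X) w) w =
    (M ^+ 2 * nm w ^+ 2 - nm (r0 X w) ^+ 2)%:C.
  move=> r0R; rewrite (star_repBl r0R) innerBl (star_repZl r0R) (star_rep1 r0R) innerZl.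
  by rewrite inner_nm -(nm_star_rep_sqr r0R) -rmorphM -rmorphB.
apply: (faithful_isometric rR rF) => // y.
rewrite -(@ler_pXn2r _ 2) ?nnegrE ?mulr_ge0 ?nm_ge0 // exprMn -subr_ge0 -ler0c.
rewrite -(F _ _ _ _ _ rR) -(E _ _ _ fH gH fg); apply: pos => x.
rewrite (E _ _ _ iH jH tr_comm) (F _ _ _ _ _ thetaR) ler0c subr_ge0 -exprMn.
rewrite ler_pXn2r ?nnegrE ?mulr_ge0 ?nm_ge0 //.
exact: (nm_star_rep_le thetaR).
Qed.

Lemma tensor_hom :
  (forall s, (forall x, 0 <= inner (rT (tens i j s) x) x) ->
     forall y, 0 <= inner (r (tens f g s) y) y) ->
  exists F : T -> C, [/\ star_hom F, forall a, F (i a) = f a & forall b, F (j b) = g b].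
Proof.
move=> /tensor_bound bound; apply: tensor_extension => //.
- exact: iH.
- exact: jH.
- exact: tr_comm.
- exact: (tr_dense tr).
Qed.

End hom.
End tensor_rep_theory.

Lemma tensor_map (R : realType) (A B T A' B' T' : cstarAlgType R)
    (i : A -> T) (j : B -> T) (i' : A' -> T') (j' : B' -> T')
    (H K L H' K' L' : hilbertType R) (t : H -> K -> L) (t' : H' -> K' -> L')
    (rA : A -> H -> H) (rB : B -> K -> K) (rT : T -> L -> L)
    (rA' : A' -> H' -> H') (rB' : B' -> K' -> K') (rT' : T' -> L' -> L')
    (f : A -> A') (g : B -> B') :
  tensor_rep i j t rA rB rT -> tensor_rep i' j' t' rA' rB' rT' ->
  star_hom f -> star_hom g ->
  exists F : T -> T',
    [/\ star_hom F, forall a, F (i a) = i' (f a) & forall b, F (j b) = j' (g b)].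
Proof.
move=> tr tr' fH gH.
apply: (tensor_hom tr (tr_theta tr') (tr_thetaF tr')
  (star_hom_comp fH (tr_i tr')) (star_hom_comp gH (tr_j tr'))).
  by move=> a b /=; exact: tr_comm tr' _ _.
move=> s s0; apply: (tr_theta_ge0 tr') => n h k.
have -> : tens (i' \o f) (j' \o g) s = tens i' j' [seq (f p.1, g p.2) | p <- s].
  by rewrite /tens big_map.
rewrite (tr_form tr').
under eq_bigr do (under eq_bigr do rewrite big_map).
exact: (tensor_pos tr s0 (star_hom_rep fH (tr_pi tr')) (star_hom_rep gH (tr_rho tr'))).
Qed.

(** * Slice maps *)

Section slices.
Context {R : realType} {A B T : cstarAlgType R} {i : A -> T} {j : B -> T}.
Context {H K L : hilbertType R} {t : H -> K -> L}.
Context {rA : A -> H -> H} {rB : B -> K -> K} {rT : T -> L -> L}.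
Hypothesis tr : tensor_rep i j t rA rB rT.

(** [d] is the value at [z] of the slice map [omega (x) id], where [omega a = <a h, h'>] is a vector
    functional. *)
Definition is_slice (h h' : H) (z : T) (d : B) : Prop :=
  forall k k', inner (rB d k) k' = inner (rT z (t h k)) (t h' k').

Lemma is_slice_P h h' (c : R[i]) z z' d d' :
  is_slice h h' z d -> is_slice h h' z' d' -> is_slice h h' (c *: z + z') (c *: d + d').
Proof.
move=> zd zd' k k'; rewrite (star_repPl (tr_rho tr)) (star_repPl (tr_theta tr)).
by rewrite !innerDl !innerZl zd zd'.
Qed.

Lemma is_slice_bound h h' z d : is_slice h h' z d -> nm d <= nm h * nm h' * nm z.
Proof.
move=> zd; apply: (faithful_isometric (tr_rho tr) (tr_rhoF tr)).
  by rewrite !mulr_ge0 ?nm_ge0.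
move=> k; have [->|d0] := eqVneq (nm (rB d k)) 0; first by rewrite !mulr_ge0 ?nm_ge0.
have dp : 0 < nm (rB d k) by rewrite lt_neqAle eq_sym d0 nm_ge0.
rewrite -(ler_pM2r dp) -expr2.
have -> : nm (rB d k) ^+ 2 = complex.Re (inner (rB d k) (rB d k)) by rewrite inner_nm.
rewrite zd; apply: (le_trans (Re_inner_le _ _)); rewrite (nm_elem tr) mulrA.
rewrite ler_wpM2r ?nm_ge0 //.
apply: (@le_trans _ _ (nm z * (nm h * nm k) * nm h')).
  by rewrite ler_wpM2r ?nm_ge0 // -(nm_elem tr) (nm_star_rep_le (tr_theta tr)).
by rewrite [leLHS](_ : _ = nm h * nm h' * nm z * nm k) //; ring.
Qed.

Lemma is_slice_tens h h' s :
  is_slice h h' (tens i j s) (\sum_(u <- s) inner (rA u.1 h) h' *: u.2).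
Proof.
move=> k k'; rewrite (scale_rep (tr_rho tr)).
rewrite (star_rep_suml (tr_theta tr)) inner_suml; apply: eq_bigr => u _.
by rewrite (tr_eq tr) (tr_inner tr).
Qed.

Lemma is_slice_limit h h' z d (zn : nat -> T) (dn : nat -> B) :
  (forall n, is_slice h h' (zn n) (dn n)) ->
  (forall e : R, 0 < e -> exists n, nm (z - zn n) < e /\ nm (d - dn n) < e) ->
  is_slice h h' z d.
Proof.
move=> sl lim k k'; apply: nm_eq_small => e e0.
pose C := nm k * nm k' + nm h * nm k * (nm h' * nm k') + 1.
have C0 : 0 < C by rewrite ltr_wpDl // addr_ge0 ?mulr_ge0 ?nm_ge0.
have [n [zn_ dn_]] := lim _ (divr_gt0 e0 C0).
have -> : inner (rB d k) k' - inner (rT z (t h k)) (t h' k') =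
  inner (rB (d - dn n) k) k' - inner (rT (z - zn n) (t h k)) (t h' k').
  rewrite (star_repBl (tr_rho tr)) (star_repBl (tr_theta tr)) !innerBl sl.
  by ring.
apply: (le_trans (ler_nmB _ _)).
have b1 : nm (inner (rB (d - dn n) k) k') <= (e / C) * nm k * nm k'.
  apply: (le_trans (nm_inner_le _ _)); rewrite ler_wpM2r ?nm_ge0 //.
  apply: (le_trans (nm_star_rep_le (tr_rho tr) _ _)); rewrite ler_wpM2r ?nm_ge0 //.
  exact: ltW.
have b2 : nm (inner (rT (z - zn n) (t h k)) (t h' k')) <= (e / C) * (nm h * nm k) * (nm h' * nm k').
  rewrite -!(nm_elem tr); apply: (le_trans (nm_inner_le _ _)); rewrite ler_wpM2r ?nm_ge0 //.
  apply: (le_trans (nm_star_rep_le (tr_theta tr) _ _)); rewrite ler_wpM2r ?nm_ge0 //.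
  exact: ltW.
have eC : 0 < e / C by rewrite divr_gt0.
have : (e / C) * C = e by rewrite divfK // gt_eqF.
rewrite {2}/C; move: b1 b2 eC; move: (e / C) => v; nra.
Qed.

(** Finite sums have explicit slices, and [is_slice_bound] makes the slices of an approximating
    sequence Cauchy. *)
Lemma slice_exists h h' z : exists d, is_slice h h' z d.
Proof.
have small n : 0 < (n.+1%:R)^-1 :> R by rewrite invr_gt0.
have [s zs] := choice (fun n => tr_dense tr z (small n)).
have limit0 := @inv_succ_small R.
pose dn n := \sum_(u <- s n) inner (rA u.1 h) h' *: u.2.
have dz n : is_slice h h' (tens i j (s n)) (dn n) by exact: is_slice_tens.
pose C := nm h * nm h' + 1.
have C0 : 0 < C by rewrite ltr_wpDl // mulr_ge0 ?nm_ge0.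
have [e e0|d dlim] := @nm_complete _ B dn.
  have eC : 0 < e / (2 * C) by rewrite divr_gt0 // mulr_gt0.
  have [N hN] := limit0 _ eC.
  exists N => m n Nm Nn.
  have sl : is_slice h h' (tens i j (s m) - tens i j (s n)) (dn m - dn n).
    have := is_slice_P (-1) (dz n) (dz m).
    by rewrite !scaleN1r ![- _ + _]addrC.
  apply: (le_lt_trans (is_slice_bound sl)).
  have lt : nm (tens i j (s m) - tens i j (s n)) < e / (2 * C) + e / (2 * C).
    apply: (le_lt_trans (ler_nmdD z _ _)); rewrite nmB; apply: ltrD.
      exact: lt_trans (zs m) (hN _ Nm).
    exact: lt_trans (zs n) (hN _ Nn).
  apply: (@le_lt_trans _ _ ((nm h * nm h') * (e / (2 * C) + e / (2 * C)))).
    by rewrite ler_wpM2l ?mulr_ge0 ?nm_ge0 // ltW.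
  apply: (@lt_le_trans _ _ (C * (e / (2 * C) + e / (2 * C)))).
    by rewrite ltr_pM2r ?addr_gt0 // ltrDl.
  by rewrite [leLHS](_ : _ = e) //; field; lra.
exists d; apply: (is_slice_limit dz) => e e0.
have [N1 h1] := limit0 e e0; have [N2 h2] := dlim e e0.
exists (maxn N1 N2); split; last exact/h2/leq_maxr.
apply: (lt_trans (zs _)); exact/h1/leq_maxl.
Qed.

End slices.

Arguments is_slice {R B T H K L} t rB rT h h' z d.

(* With [D = D (x) D] along [lam], [mu], this is [sigma (x) id]: the target
   [AD = A (x) D] is [A (x) D (x) D], where [Lam] embeds the first two factors
   and [j \o mu] the last one. *)
Section triple.
Context {R : realType} {A D AD : cstarAlgType R} {i : A -> AD} {j : D -> AD}.
Context {H K L : hilbertType R} {t : H -> K -> L}.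
Context {rA : A -> H -> H} {rD : D -> K -> K} {rT : AD -> L -> L}.
Hypothesis tr : tensor_rep i j t rA rD rT.
Context {lam mu : D -> D}.
Context {H2 K2 L2 : hilbertType R} {t2 : H2 -> K2 -> L2}.
Context {r1 : D -> H2 -> H2} {r2 : D -> K2 -> K2} {r3 : D -> L2 -> L2}.
Hypothesis tr2 : tensor_rep lam mu t2 r1 r2 r3.
Context (Lam : AD -> AD) (LamH : star_hom Lam).
Hypothesis Lam_i : forall a, Lam (i a) = i a.
Hypothesis Lam_j : forall d, Lam (j d) = j (lam d).
Context (sigma : D -> AD) (sigmaH : star_hom sigma).

Let lamH : star_hom lam := tr_i tr2.
Let muH : star_hom mu := tr_j tr2.

(** Slicing consumes the first factor and [Lam] acts through [lam] on the second, so they commute on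
    finite sums; the rest is continuity. *)
Lemma slice_ext h h' x d :
  is_slice t rD rT h h' x d -> is_slice t rD rT h h' (Lam x) (lam d).
Proof.
move=> xd.
have small n : 0 < (n.+1%:R)^-1 :> R by rewrite invr_gt0.
have [s xs] := choice (fun n => tr_dense tr x (small n)).
pose dn n := \sum_(u <- s n) inner (rA u.1 h) h' *: u.2.
have dz n : is_slice t rD rT h h' (tens i j (s n)) (dn n) by exact: is_slice_tens.
have Lz n : is_slice t rD rT h h' (Lam (tens i j (s n))) (lam (dn n)).
  have -> : Lam (tens i j (s n)) = tens i j [seq (u.1, lam u.2) | u <- s n].
    rewrite /tens big_map (star_hom_sum LamH); apply: eq_bigr => u _.
    by rewrite (star_homM LamH) Lam_i Lam_j.
  have -> : lam (dn n) = \sum_(u <- [seq (u.1, lam u.2) | u <- s n]) inner (rA u.1 h) h' *: u.2.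
    rewrite big_map (star_hom_sum lamH); apply: eq_bigr => u _.
    by rewrite (star_homZ lamH).
  exact: is_slice_tens.
apply: (is_slice_limit tr Lz) => e e0.
pose C := nm h * nm h' + 1.
have C0 : 0 < C by rewrite ltr_wpDl // mulr_ge0 ?nm_ge0.
have [N hN] := inv_succ_small (divr_gt0 e0 C0).
have xN : nm (x - tens i j (s N)) < e / C by exact: lt_trans (xs N) (hN _ (leqnn N)).
have xN2 : C * nm (x - tens i j (s N)) < e by rewrite mulrC -ltr_pdivlMr.
exists N; rewrite -(star_homB LamH) -(star_homB lamH); split.
  apply: (le_lt_trans (star_hom_nm_le LamH _)); apply: le_lt_trans xN2.
  by rewrite -[leLHS]mul1r ler_wpM2r ?nm_ge0 // lerDr mulr_ge0 ?nm_ge0.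
apply: (le_lt_trans (star_hom_nm_le lamH _)).
have := is_slice_P tr (-1) (dz N) xd; rewrite !scaleN1r ![- _ + _]addrC.
move/(is_slice_bound tr)/le_lt_trans; apply; apply: le_lt_trans xN2.
by rewrite ler_wpM2r ?nm_ge0 // lerDl.
Qed.

Lemma triple_comm d d' : Lam (sigma d) * j (mu d') = j (mu d') * Lam (sigma d).
Proof.
move: (sigma d) => x; apply: nm_eq_small => e e0.
pose C := 2 * (nm (j (mu d')) + 1).
have C0 : 0 < C by rewrite mulr_gt0 // ltr_wpDl ?nm_ge0.
have [s xs] := tr_dense tr x (divr_gt0 e0 C0).
have comm : Lam (tens i j s) * j (mu d') = j (mu d') * Lam (tens i j s).
  rewrite /tens (star_hom_sum LamH) mulr_suml mulr_sumr; apply: eq_bigr => u _.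
  rewrite (star_homM LamH) Lam_i Lam_j mulrA -(tr_comm tr) -!mulrA.
  by rewrite -!(star_homM (tr_j tr)) (tr_comm tr2).
have -> : Lam x * j (mu d') - j (mu d') * Lam x =
  Lam (x - tens i j s) * j (mu d') - j (mu d') * Lam (x - tens i j s).
  rewrite !(star_homB LamH) mulrBl mulrBr comm.
  abel.
apply: (le_trans (ler_nmB _ _)).
have b := star_hom_nm_le LamH (x - tens i j s).
have b1 := nmM_le (Lam (x - tens i j s)) (j (mu d')).
have b2 := nmM_le (j (mu d')) (Lam (x - tens i j s)).
have b3 : nm (Lam (x - tens i j s)) * nm (j (mu d')) <= (e / C) * (nm (j (mu d')) + 1).
  apply: ler_pM; rewrite ?nm_ge0 //; last by rewrite lerDl.
  exact: le_trans b (ltW xs).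
have : (e / C) * C = e by rewrite divfK // gt_eqF.
by rewrite {2}/C; move: b1 b2 b3; rewrite [nm (j _) * nm _]mulrC; lra.
Qed.

(** The difficulty is that [sigma] takes values in [AD] and not in a single factor. Slicing turns
    each [sigma c] into a matrix over [D]; the representation of [D] is then changed twice, until
    [tensor_pos] applies to [rT \o sigma]. *)
Lemma triple_hom : exists F : D -> AD,
  [/\ star_hom F, forall d, F (lam d) = Lam (sigma d) & forall d, F (mu d) = j (mu d)].
Proof.
apply: (tensor_hom tr2 (tr_theta tr) (tr_thetaF tr)
  (star_hom_comp sigmaH LamH) (star_hom_comp muH (tr_j tr))).
  by move=> a b /=; exact: triple_comm.
move=> s s0; apply: (tr_theta_ge0 tr) => n h k.
have /choice [S0 S0P] : forall x : D * 'I_n * 'I_n, exists d,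
    is_slice t rD rT (h x.1.2) (h x.2) (sigma x.1.1) d.
  by move=> x; exact: slice_exists tr _ _ _.
pose S c p q := S0 (c, p, q).
have SP c p q : is_slice t rD rT (h p) (h q) (sigma c) (S c p q) by exact: S0P (c, p, q).
pose Q p q := tens lam mu [seq (S u.1 p q, u.2) | u <- s].
have -> : inner (rT (tens (Lam \o sigma) (j \o mu) s) (\sum_p t (h p) (k p)))
    (\sum_p t (h p) (k p)) = \sum_p \sum_q inner (rD (Q p q) (k p)) (k q).
  rewrite (star_rep_sumr (tr_theta tr)) inner_suml; apply: eq_bigr => p _.
  rewrite inner_sumr; apply: eq_bigr => q _.
  rewrite (star_rep_suml (tr_theta tr)) inner_suml.
  rewrite (star_rep_suml (tr_rho tr)) inner_suml big_map; apply: eq_bigr => u _ /=.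
  rewrite (star_repM (tr_theta tr)) (tr_eqr tr) (star_repM (tr_rho tr)).
  by rewrite (slice_ext (SP u.1 p q)).
(* Unlike [rD], the representation [r3] splits along [lam] and [mu]. *)
apply: (pos_transfer (tr_theta tr2) (tr_thetaF tr2) (tr_rho tr)) => zeta.
apply: (star_form_ge0_closed (tr_theta tr2)) => e e0.
have /choice [X XP] : forall p, exists X : {N & (('I_N -> H2) * ('I_N -> K2))%type},
    nm (zeta p - \sum_a t2 ((projT2 X).1 a) ((projT2 X).2 a)) < e.
  move=> p; have [N [h2 [k2 h2k2]]] := tr_tdense tr2 (zeta p) e0.
  by exists (existT _ N (h2, k2)).
exists (fun p => \sum_a t2 ((projT2 (X p)).1 a) ((projT2 (X p)).2 a)); first exact: XP.
(* The approximations of the vectors [zeta p] have different lengths, hence a dependent index. *)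
pose I := {p : 'I_n & 'I_(projT1 (X p))}.
pose h2 (u : I) := (projT2 (X (tag u))).1 (tagged u).
pose k2 (u : I) := (projT2 (X (tag u))).2 (tagged u).
pose w (u v : I) := \sum_(c <- s) inner (r2 c.2 (k2 u)) (k2 v) *: S c.1 (tag u) (tag v).
rewrite [leRHS](_ : _ = \sum_u \sum_v inner (r1 (w u v) (h2 u)) (h2 v)); last first.
  under eq_bigr do under eq_bigr do rewrite (tr_form tr2).
  under eq_bigr do rewrite exchange_big.
  rewrite sig_big_dep /=; apply: eq_bigr => u _.
  rewrite sig_big_dep /=; apply: eq_bigr => v _.
  rewrite (scale_rep (tr_pi tr2)) big_map; apply: eq_bigr => c _ /=.
  by rewrite mulrC.
(* Now [r1] is traded for [rD], in which slices unfold into coefficients of [rT \o sigma]. *)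
apply: (pos_transfer (tr_rho tr) (tr_rhoF tr) (tr_pi tr2)) => kap.
rewrite [leRHS](_ : _ = \sum_u \sum_v \sum_(c <- s)
    inner ((rT \o sigma) c.1 (t (h (tag u)) (kap u))) (t (h (tag v)) (kap v)) *
      inner (r2 c.2 (k2 u)) (k2 v)); last first.
  apply: eq_bigr => u _; apply: eq_bigr => v _; rewrite (scale_rep (tr_rho tr)).
  by apply: eq_bigr => c _; rewrite (SP c.1) mulrC.
exact: (tensor_pos tr2 s0 (star_hom_rep sigmaH (tr_theta tr)) (tr_rho tr2)).
Qed.

End triple.

(** * Paths of unitaries *)

Section continuity.
Context {R : realType} {T : topologicalType}.

Lemma continuous_mulC (A : cstarAlgType R) (f g : T -> A) :
  continuous f -> continuous g -> continuous (fun t => f t * g t).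
Proof.
move=> fC gC x; apply/nm_continuousP => e e0.
pose C := nm (f x) + nm (g x) + 1.
have f0 := nm_ge0 (f x); have g0 := nm_ge0 (g x).
have C0 : 0 < C by rewrite /C; lra.
pose d := Num.min 1 (e / (2 * C)).
have d0 : 0 < d by rewrite lt_min ltr01 divr_gt0 // mulr_gt0.
have d1 : d <= 1 by rewrite ge_min lexx.
have dC : d * C <= e / 2.
  apply: (@le_trans _ _ ((e / (2 * C)) * C)).
    by apply: ler_wpM2r; [exact: ltW|rewrite ge_min lexx orbT].
  rewrite [leLHS](_ : _ = e / 2) //; field; lra.
have /nm_continuousP /(_ d d0) fd := fC x.
have /nm_continuousP /(_ d d0) gd := gC x.
near=> y.
have fy : nm (f x - f y) < d by near: y.
have gy : nm (g x - g y) < d by near: y.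
have -> : f x * g x - f y * g y = (f x - f y) * g x + f y * (g x - g y).
  by rewrite mulrBl mulrBr addrA subrK.
apply: (le_lt_trans (ler_nmD _ _)).
have b1 := nmM_le (f x - f y) (g x); have b2 := nmM_le (f y) (g x - g y).
have fyb : nm (f y) <= nm (f x) + 1.
  by have := ler_nmD (f y - f x) (f x); rewrite subrK nmB; lra.
have b3 : nm (f x - f y) * nm (g x) <= d * nm (g x).
  by rewrite ler_wpM2r ?nm_ge0 // ltW.
have b4 : nm (f y) * nm (g x - g y) <= (nm (f x) + 1) * d.
  by apply: ler_pM; rewrite ?nm_ge0 //; exact: ltW.
have : d * (nm (f x) + nm (g x) + 1) <= d * C by [].
lra.
Unshelve. all: by end_near. Qed.

Lemma continuous_star (A : cstarAlgType R) (f : T -> A) :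
  continuous f -> continuous (fun t => star (f t)).
Proof.
move=> fC x; apply/nm_continuousP => e e0.
have /nm_continuousP /(_ e e0) := fC x.
by apply: filterS => y; rewrite -starB nm_star.
Qed.

Lemma continuous_addC (V : normedModType R[i]) (f g : T -> V) :
  continuous f -> continuous g -> continuous (fun t => f t + g t).
Proof. by move=> fC gC x; apply: cvgD; [exact: fC|exact: gC]. Qed.

Lemma continuous_lip (V W : normedModType R[i]) (f : T -> V) (g : T -> W) (C : R) :
  (forall x y, nm (g x - g y) <= C * nm (f x - f y)) -> continuous f -> continuous g.
Proof.
move=> fg fC x; apply/nm_continuousP => e e0.
have C0 : 0 < `|C| + 1 by have := normr_ge0 C; lra.
have /nm_continuousP /(_ _ (divr_gt0 e0 C0)) := fC x.
apply: filterS => y; rewrite ltr_pdivlMr // => h.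
apply: (le_lt_trans (fg _ _)); apply: le_lt_trans h.
rewrite mulrC ler_wpM2l ?nm_ge0 //; have := ler_norm C; lra.
Qed.

Lemma continuous_scale (V : normedModType R[i]) (f : T -> R) (v : V) :
  continuous f -> continuous (fun t => (f t)%:C *: v).
Proof.
move=> fC x; apply/nm_continuousP => e e0.
have v0 := nm_ge0 v; have v1 : 0 < nm v + 1 by lra.
have /cvgrPdist_lt /(_ _ (divr_gt0 e0 v1)) := fC x.
apply: filterS => y; rewrite ltr_pdivlMr // => h.
rewrite -scalerBl -rmorphB nmZr; apply: le_lt_trans h.
by rewrite ler_wpM2l // lerDl.
Qed.

End continuity.

Section clamp.
Context {R : realType}.

(** Retracts the line onto [[0, 1]], so that paths and homotopies can be continuous on all of [R],
    away from subspace topologies. *)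
Definition clamp (t : R) : R := Num.max 0 (Num.min 1 t).

Lemma clamp_bound t : 0 <= clamp t <= 1.
Proof. rewrite /clamp; have [?|?] := leP 1 t;
  [have [?|?] := leP 0 1|have [?|?] := leP 0 t]; lra. Qed.

Lemma clamp_le0 t : t <= 0 -> clamp t = 0.
Proof. rewrite /clamp => ?; have [?|?] := leP 1 t;
  [have [?|?] := leP 0 1|have [?|?] := leP 0 t]; lra. Qed.

Lemma clamp_ge1 t : 1 <= t -> clamp t = 1.
Proof. rewrite /clamp => ?; have [?|?] := leP 1 t;
  [have [?|?] := leP 0 1|have [?|?] := leP 0 t]; lra. Qed.

Lemma clamp_id t : 0 <= t <= 1 -> clamp t = t.
Proof. rewrite /clamp => ?; have [?|?] := leP 1 t;
  [have [?|?] := leP 0 1|have [?|?] := leP 0 t]; lra. Qed.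

Lemma clamp0 : clamp 0 = 0. Proof. exact: clamp_le0. Qed.
Lemma clamp1 : clamp 1 = 1. Proof. exact: clamp_ge1. Qed.

Lemma clampP t :
  [\/ t <= 0 /\ clamp t = 0, 0 <= t <= 1 /\ clamp t = t | 1 <= t /\ clamp t = 1].
Proof.
have [t0|t0] := leP t 0; first by constructor 1; rewrite clamp_le0.
have [t1|t1] := leP 1 t; first by constructor 3; rewrite clamp_ge1.
by constructor 2; rewrite clamp_id !ltW.
Qed.

Lemma clamp_lip s t : `|clamp s - clamp t| <= `|s - t|.
Proof.
have d1 := ler_norm (s - t).
have d2 : t - s <= `|s - t| by rewrite distrC ler_norm.
rewrite ler_norml.
by case: (clampP s) => -[? ->]; case: (clampP t) => -[? ->]; lra.
Qed.

Lemma clamp_continuous : continuous clamp.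
Proof.
move=> x; apply/cvgrPdist_lt => e e0.
have /cvgrPdist_lt /(_ e e0) : id y @[y --> x] --> x by exact: cvg_id.
by apply: filterS => y; apply: le_lt_trans; exact: clamp_lip.
Qed.

End clamp.

Section upath.
Context {R : realType} {A : cstarAlgType R}.
Implicit Types (u v w x : A).

Definition upath (w : A) (p : R -> A) : Prop :=
  [/\ continuous p, forall t, unitaries (p t), p 0 = 1 & p 1 = w].

Lemma upath_unitary w p : upath w p -> unitaries w.
Proof. by case=> _ pU _ <-. Qed.

Lemma upath1 : upath (1 : A) (fun=> 1).
Proof. by split=> // [x|t]; [exact: cvg_cst|exact: unitary1]. Qed.

Lemma upathM u v p q : upath u p -> upath v q -> upath (u * v) (fun t => p t * q t).
Proof.
move=> [pC pU p0 p1] [qC qU q0 q1]; split; rewrite ?p0 ?q0 ?p1 ?q1 ?mulr1 //.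
  exact: continuous_mulC.
by move=> t; exact: unitaryM.
Qed.

Lemma upath_star u p : upath u p -> upath (star u) (fun t => star (p t)).
Proof.
move=> [pC pU p0 p1]; split; rewrite ?p0 ?p1 ?star1 //.
  exact: continuous_star.
by move=> t; exact: unitaryV.
Qed.

(** For [w = a + i b] the path is [sqrt (1 - t ^ 2 b ^ 2) + i t b]. It ends at [w], and not at
    [- a + i b], because [w] is near [1]: then [1 - a] lies in the ball where [sqrt_unique]
    identifies it with [z 1]. *)
Lemma short_path w : unitaries w -> nm (w - 1) <= 1 / 2 ->
  exists2 p, upath w p & forall t, nm (p t - 1) <= 2 * nm (w - 1).
Proof.
move=> [w1 w2] w12.
(* [c = 1 / (2 i)], so that [b] is the imaginary part of [w]. *)
pose c : R[i] := - ((1 / 2)%:C * 'i).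
have cC : conjc c = - c.
  by apply/eqP; rewrite eq_complex /=; apply/andP; split; apply/eqP; ring.
have cc : c * c = - ((1 / 4)%:C).
  by apply/eqP; rewrite eq_complex /=; apply/andP; split; apply/eqP; field.
have ic : 'i * c = (1 / 2)%:C.
  by apply/eqP; rewrite eq_complex /=; apply/andP; split; apply/eqP; ring.
have nmc : nm c = 1 / 2.
  by rewrite /c nmN nmM nmi mulr1 nmR ger0_norm //; lra.
pose a : A := (1 / 2)%:C *: (w + star w).
pose b : A := c *: (w - star w).
have aS : star a = a by rewrite starZr starD starK addrC.
have bS : star b = b by rewrite starZc starB starK cC scaleNr -scalerN opprB.
have wE : a + 'i *: b = w.
  rewrite scalerA ic -scalerDr addrACA subrr addr0; exact: scale_halfD.
have ab : a * b = b * a.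
  rewrite mulZr -cstar_scalerAr -cstar_scalerAl mulrZ !scalerA mulrC; congr (_ *: _).
  by rewrite !mulrDl !mulrDr !mulNr !mulrN w1 w2; abel.
have abE : a * a + b * b = 1.
  rewrite mulZr mulrZ -cstar_scalerAr -cstar_scalerAl !scalerA -rmorphM cc scaleNr.
  have -> : 1 / 2 * (1 / 2) = 1 / 4 :> R by field.
  rewrite -scalerBr !mulrDl !mulrDr !mulNr !mulrN w1 w2.
  have -> : w * w + 1 + (1 + star w * star w) -
     (w * w - 1 + (- 1 - - (star w * star w))) = (1 + 1) + (1 + 1) :> A by abel.
  have -> : 1 / 4 = 1 / 2 * (1 / 2) :> R by field.
  by rewrite rmorphM -scalerA scale_halfD scale_halfD.
have nb : nm b <= nm (w - 1).
  rewrite nmZ nmc; have := ler_nmB (w - 1) (star w - 1).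
  have -> : w - 1 - (star w - 1) = w - star w by abel.
  have -> : nm (star w - 1) = nm (w - 1) by rewrite -(nm_star (w - 1)) starB star1.
  lra.
clearbody b.
have b0 := nm_ge0 b.
have bbS : star (b * b) = b * b by rewrite starM bS.
have b12 : nm b <= 1 / 2 by exact: le_trans nb w12.
have nbb : nm (b * b) <= nm b by apply: (le_trans (nmM_le _ _)); rewrite ler_piMl //; lra.
pose y (t : R) : A := (clamp t ^+ 2)%:C *: (b * b).
have ny t : nm (y t) <= nm b.
  rewrite nmZr ger0_norm ?sqr_ge0 //.
  have /andP[t0 t1] := clamp_bound t; apply: le_trans nbb.
  by rewrite ler_piMl ?nm_ge0 // expr_le1.
have y34 t : nm (y t) <= 3 / 4 by have := ny t; lra.
have /choice [z zP] : forall t, exists z, [/\ star z = z, nm z <= 1 / 2,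
    z + z = y t + z * z & b * z = z * b].
  move=> t; have [||z [zS _ ze zC zn]] := @sqrt_exists _ _ (y t).
  - by rewrite starZr bbS.
  - by have := y34 t; lra.
  exists z; split => //; [exact: zn|apply: zC].
  by rewrite mulrZ mulZr mulrA.
have zS t : star (z t) = z t by have [] := zP t.
have zn t : nm (z t) <= 1 / 2 by have [] := zP t.
have ze t : z t + z t = y t + z t * z t by have [] := zP t.
have bz t : b * z t = z t * b by have [] := zP t.
have zy t : nm (z t) <= nm (y t).
  have := sqrt_unique (zn t) (_ : nm 0 <= 1 / 2) (ze t) (_ : 0 + 0 = 0 + 0 * 0).
  by rewrite !subr0 mul0r addr0 nm0; apply => //; lra.
pose p t : A := (1 - z t) + 'i *: ((clamp t)%:C *: b).
exists p; last first.
  move=> t.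
  have -> : p t - 1 = - z t + 'i *: ((clamp t)%:C *: b).
    by rewrite /p; abel.
  apply: (le_trans (ler_nmD _ _)); rewrite nmN nmZ nmi mul1r nmZr.
  have /andP[t0 t1] := clamp_bound t; rewrite ger0_norm //.
  have : clamp t * nm b <= nm b by rewrite ler_piMl.
  by have := zy t; have := ny t; lra.
have clampC := @clamp_continuous R.
split.
- apply: continuous_addC.
    apply: (@continuous_lip _ _ _ _ y _ 1) => [s t|].
      have -> : 1 - z s - (1 - z t) = z t - z s by abel.
      by rewrite mul1r nmB; exact: sqrt_unique.
    apply: continuous_scale => t; apply: cvgM; exact: clampC.
  apply: (@continuous_lip _ _ _ _ (fun t => (clamp t)%:C *: b) _ 1) => [s t|].
    by rewrite -scalerBr nmZ nmi.
  exact: continuous_scale.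
- move=> t; apply: unitary_re_im.
  + by rewrite starB star1 zS.
  + by rewrite starZr bS.
  + by rewrite mulrZ mulZr mulrBl mulrBr mulr1 mul1r bz.
  + by rewrite (sqrt_1B (ze t)) mulrZ mulZr scalerA -rmorphM /y subrK.
- have z0 : z 0 = 0.
    apply: nm_le0_eq0; apply: (le_trans (zy 0)).
    by rewrite /y clamp0 expr0n scale0r nm0.
  by rewrite /p z0 subr0 clamp0 scale0r scaler0 addr0.
have z1 : z 1 = 1 - a.
  apply: nm_eq_small => e e0; apply: le_trans (ltW e0).
  have -> : 0 = nm (y 1 - b * b) by rewrite /y clamp1 expr1n scale1r subrr nm0.
  apply: sqrt_unique => //.
    have -> : 1 - a = (1 / 2)%:C *: ((1 - w) + (1 - star w)).
      rewrite -{1}(scale_halfD 1) -scalerBr; congr (_ *: _); abel.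
    rewrite nmZr ger0_norm; last by lra.
    have := ler_nmD (1 - w) (1 - star w).
    have -> : nm (1 - star w) = nm (1 - w) by rewrite -(nm_star (1 - w)) starB star1.
    have -> : nm (1 - w) = nm (w - 1) by exact: nmB.
    lra.
  have -> : b * b = 1 - a * a by rewrite -abE addrAC subrr add0r.
  by rewrite mulrBl !mulrBr !mulr1 mul1r; abel.
by rewrite /p z1 clamp1 scale1r subKr.
Qed.

Definition ucon w := exists p, upath w p.

Lemma ucon1 : ucon (1 : A). Proof. by exists (fun=> 1); exact: upath1. Qed.

Lemma ucon_unitary w : ucon w -> unitaries w.
Proof. by case=> p /upath_unitary. Qed.

Lemma uconM u v : ucon u -> ucon v -> ucon (u * v).
Proof. by case=> p up [q vq]; exists (fun t => p t * q t); exact: upathM. Qed.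

Lemma ucon_near u v : ucon u -> unitaries v -> nm (v - u) <= 1 / 2 -> ucon v.
Proof.
move=> uc vU vu; have uU := ucon_unitary uc.
have [|p wp _] := short_path (unitaryM (unitaryV uU) vU).
  by rewrite -uU.1 -mulrBr nmMu //; exact: unitaryV.
have -> : v = u * (star u * v) by rewrite mulrA uU.2 mul1r.
by apply: uconM => //; exists p.
Qed.

(** Unitaries at distance at most [1 / 2] are joined by a short path, so inside a connected set of
    unitaries the property [ucon] is both open and closed. *)
Lemma unitary_component_ucon w : unitary_component w -> ucon w.
Proof.
case=> C [C1 CU Cc] Cw.
have open_near (P : set A) : open [set x : A | exists2 u, P u & nm (x - u) < 1 / 2].
  rewrite openE => x [u Pu xu].
  have e0 : 0 < 1 / 2 - nm (x - u) by rewrite subr_gt0.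
  have /nm_continuousP /(_ _ e0) : {for x, continuous (@id A)} by exact: cvg_id.
  apply: filterS => y xy; exists u => //.
  by apply: (le_lt_trans (ler_nmdD x _ _)); rewrite nmB; lra.
suff : C `&` ucon = C by move=> CE; move: Cw; rewrite -CE => -[].
apply: Cc.
- by exists 1; split => //; exact: ucon1.
- exists [set x : A | exists2 u, (C `&` ucon) u & nm (x - u) < 1 / 2]; first exact: open_near.
  apply/seteqP; split => x [Cx].
    by move=> xc; split => //; exists x; rewrite ?subrr ?nm0 //; lra.
  by case=> u [Cu uc] xu; split => //; apply: (ucon_near uc (CU _ Cx)); exact: ltW.
exists (~` [set x : A | exists2 u, (C `&` ~` ucon) u & nm (x - u) < 1 / 2]).
  by apply: open_closedC; exact: open_near.
apply/seteqP; split => x [Cx].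
  move=> xc; split => // -[u [Cu nuc] xu]; apply: nuc.
  by apply: (ucon_near xc (CU _ Cu)); rewrite nmB ltW.
move=> nx; split => //; apply: contrapT => nxc; apply: nx.
by exists x; rewrite ?subrr ?nm0 //; lra.
Qed.

End upath.

(** * Commutators of unitaries and K_1 *)

Section mxcont.
Context {R : realType} {A : cstarAlgType R} {T : topologicalType}.

Lemma continuous_sumC (I : Type) (s : seq I) (F : I -> T -> A) :
  (forall k, continuous (F k)) -> continuous (fun t => \sum_(k <- s) F k t).
Proof.
move=> FC; elim: s => [|k s ih].
  rewrite (_ : (fun _ => _) = fun=> 0); first by move=> x; exact: cvg_cst.
  by apply/funext => t; rewrite big_nil.
rewrite (_ : (fun _ => _) = fun t => F k t + \sum_(l <- s) F l t).
  exact: continuous_addC.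
by apply/funext => t; rewrite big_cons.
Qed.

Definition mxcont n (X : T -> 'M[A]_n) := forall p q, continuous (fun t => X t p q).

Lemma mxcont_continuous n (X : T -> 'M[A]_n) : mxcont X -> continuous X.
Proof.
move=> XC t B [P tP PB]; have : \forall s \near t, forall p q, P p q (X s p q).
  apply: filter_forall => p; apply: filter_forall => q; exact: XC (tP p q).
by apply: filterS => s sP; exact: PB.
Qed.

Lemma mxcont_cst n (X : 'M[A]_n) : mxcont (fun=> X).
Proof. by move=> p q x; exact: cvg_cst. Qed.

Lemma mxcontD n (X Y : T -> 'M[A]_n) :
  mxcont X -> mxcont Y -> mxcont (fun t => X t + Y t).
Proof.
move=> XC YC p q; rewrite (_ : (fun _ => _) = fun t => X t p q + Y t p q).
  exact: continuous_addC.
by apply/funext => t; rewrite mxE.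
Qed.

Lemma mxcontM n (X Y : T -> 'M[A]_n) :
  mxcont X -> mxcont Y -> mxcont (fun t => X t *m Y t).
Proof.
move=> XC YC p q.
rewrite (_ : (fun _ => _) = fun t => \sum_s X t p s * Y t s q).
  by apply: continuous_sumC => s; exact: continuous_mulC.
by apply/funext => t; rewrite mxE.
Qed.

End mxcont.

Lemma mxcont_id (R : realType) (A : cstarAlgType R) n : mxcont (@id 'M[A]_n).
Proof.
move=> p q X B XB; exists (fun p' q' => if (p' == p) && (q' == q) then B else setT).
  by move=> p' q'; case: ifPn => [/andP[/eqP -> /eqP ->]//|_]; exact: filterT.
by move=> Y /(_ p q); rewrite !eqxx.
Qed.

Section mxunitary.
Context {R : realType} {A : cstarAlgType R}.

Lemma mxstarM n (X Y : 'M[A]_n) : mxstar (X *m Y) = mxstar Y *m mxstar X.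
Proof.
apply/matrixP => p q; rewrite !mxE star_sum; apply: eq_bigr => s _.
by rewrite !mxE starM.
Qed.

Lemma mxstarD n (X Y : 'M[A]_n) : mxstar (X + Y) = mxstar X + mxstar Y.
Proof. by apply/matrixP => p q; rewrite !mxE starD. Qed.

Lemma mxstar_scalar n (a : A) : mxstar (a%:M : 'M[A]_n) = (star a)%:M.
Proof.
apply/matrixP => p q; rewrite !mxE eq_sym.
by case: eqP => _; rewrite ?mulr1n // !mulr0n star0.
Qed.

Lemma unitaries_mx1 n : unitaries_mx (1%:M : 'M[A]_n).
Proof. by split; rewrite mxstar_scalar star1 mulmx1. Qed.

Lemma unitaries_mxM n (X Y : 'M[A]_n) :
  unitaries_mx X -> unitaries_mx Y -> unitaries_mx (X *m Y).
Proof.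
move=> [X1 X2] [Y1 Y2]; split; rewrite mxstarM.
  by rewrite mulmxA -(mulmxA (mxstar Y)) X1 mulmx1.
by rewrite mulmxA -(mulmxA X) Y2 mulmx1.
Qed.

Lemma component_mx_image (T : topologicalType) n (X : T -> 'M[A]_n) (C : set T) s t :
  mxcont X -> connected C -> C s -> C t -> (forall x, C x -> unitaries_mx (X x)) ->
  connected_component (@unitaries_mx R A n) (X s) (X t).
Proof.
move=> XC Cc Cs Ct XU.
apply: (@connected_component_max _ _ (X @` C)); last by exists t.
- by exists s.
- by move=> _ [x Cx <-]; exact: XU.
apply: connected_continuous_connected => //.
by apply: continuous_subspaceT; exact: mxcont_continuous.
Qed.

Lemma component_mx1 n : unitary_component_mx (1%:M : 'M[A]_n).
Proof. exact/connected_component_refl/unitaries_mx1. Qed.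

Lemma component_mxM n (X Y : 'M[A]_n) : unitary_component_mx X ->
  unitary_component_mx Y -> unitary_component_mx (X *m Y).
Proof.
move=> Xc Yc; apply: (connected_component_trans Xc).
rewrite -{1}[X]mulmx1.
apply: (component_mx_image (X := fun Z => X *m Z) (C := @unitary_component_mx R A n)).
- by apply: mxcontM; [exact: mxcont_cst|exact: mxcont_id].
- exact: component_connected.
- exact: component_mx1.
- exact: Yc.
- move=> Z /connected_component_sub ZU; apply: unitaries_mxM => //.
  exact: connected_component_sub Xc.
Qed.

(* [W a (rank1 e)] is multiplication by [a] along the real unit vector [e]. *)
Definition rank1 n (e : 'I_n -> R) : 'M[A]_n := \matrix_(p, q) ((e p * e q)%:C *: (1 : A)).

Definition W n (a : A) (P : 'M[A]_n) : 'M[A]_n := 1%:M + (a - 1)%:M *m P.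

Lemma rank1_scalar n (e : 'I_n -> R) (a : A) : rank1 e *m a%:M = a%:M *m rank1 e.
Proof.
apply/matrixP => p q; rewrite !mxE (bigD1 q) //= big1 ?addr0; last first.
  by move=> s /negPf sq; rewrite !mxE sq mulr0n mulr0.
rewrite (bigD1 p) //= big1 ?addr0; last first.
  by move=> s /negPf sq; rewrite !mxE eq_sym sq mulr0n mul0r.
by rewrite !mxE !eqxx !mulr1n mulZr mulrZ mul1r mulr1.
Qed.

Lemma rank1_mul n (e f : 'I_n -> R) :
  rank1 e *m rank1 f = \matrix_(p, q) ((e p * f q * \sum_s e s * f s)%:C *: (1 : A)).
Proof.
apply/matrixP => p q; rewrite !mxE mulr_sumr rmorph_sum scaler_suml.
apply: eq_bigr => s _; rewrite !mxE mulZr mulrZ mulr1 scalerA -rmorphM.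
by congr ((_)%:C *: _); ring.
Qed.

Lemma rank1_idem n (e : 'I_n -> R) : \sum_s e s * e s = 1 -> rank1 e *m rank1 e = rank1 e.
Proof. by move=> e1; rewrite rank1_mul e1; apply/matrixP => p q; rewrite !mxE mulr1. Qed.

Lemma rank1_orth n (e f : 'I_n -> R) : \sum_s e s * f s = 0 -> rank1 e *m rank1 f = 0.
Proof.
by move=> e0; rewrite rank1_mul e0; apply/matrixP => p q; rewrite !mxE mulr0 scale0r.
Qed.

Lemma mxstar_rank1 n (e : 'I_n -> R) : mxstar (rank1 e) = rank1 e.
Proof. by apply/matrixP => p q; rewrite !mxE starZr star1 mulrC. Qed.

Lemma W1 n (P : 'M[A]_n) : W 1 P = 1%:M.
Proof. by rewrite /W subrr (_ : 0%:M = 0) ?mul0mx ?addr0 //; exact: raddf0. Qed.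

Lemma W_mul n (e : 'I_n -> R) (a b : A) : \sum_s e s * e s = 1 ->
  W a (rank1 e) *m W b (rank1 e) = W (a * b) (rank1 e).
Proof.
move=> e1; rewrite /W mulmxDl mul1mx mulmxDr mulmx1.
rewrite -(mulmxA (a - 1)%:M) (mulmxA (rank1 e)) rank1_scalar -(mulmxA (b - 1)%:M).
rewrite rank1_idem // (mulmxA (a - 1)%:M) -scalar_mxM.
rewrite -addrA; congr (_ + _); rewrite -!mulmxDl; congr (_ *m _).
rewrite -!raddfD; congr (_%:M).
by rewrite /= mulrBl !mulrBr !mulr1 !mul1r; abel.
Qed.

Lemma W_comm n (e f : 'I_n -> R) (a b : A) : \sum_s e s * f s = 0 ->
  W a (rank1 e) *m W b (rank1 f) = W b (rank1 f) *m W a (rank1 e).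
Proof.
move=> ef.
have fe : \sum_s f s * e s = 0 by rewrite -[RHS]ef; apply: eq_bigr => s _; rewrite mulrC.
have E (e' f' : 'I_n -> R) (a' b' : A) : \sum_s e' s * f' s = 0 ->
    W a' (rank1 e') *m W b' (rank1 f') =
    1%:M + ((a' - 1)%:M *m rank1 e' + (b' - 1)%:M *m rank1 f').
  move=> ef'; rewrite /W mulmxDl mul1mx mulmxDr mulmx1.
  rewrite -(mulmxA (a' - 1)%:M) (mulmxA (rank1 e')) rank1_scalar -(mulmxA (b' - 1)%:M).
  by rewrite rank1_orth // !mulmx0 addr0 -addrA [X in 1%:M + X]addrC.
by rewrite !E // [X in 1%:M + X]addrC.
Qed.

Lemma mxstar_W n (e : 'I_n -> R) (a : A) : mxstar (W a (rank1 e)) = W (star a) (rank1 e).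
Proof.
by rewrite mxstarD mxstarM mxstar_rank1 !mxstar_scalar star1 rank1_scalar starB star1.
Qed.

Lemma unitary_W n (e : 'I_n -> R) (a : A) : \sum_s e s * e s = 1 ->
  unitaries a -> unitaries_mx (W a (rank1 e)).
Proof. by move=> e1 [a1 a2]; split; rewrite mxstar_W W_mul // ?a1 ?a2 W1. Qed.

Definition unit_vec n (p : 'I_n) : 'I_n -> R := fun s => (s == p)%:R.

Lemma sum_unit_vec n (p : 'I_n) (f : 'I_n -> R) : \sum_s unit_vec p s * f s = f p.
Proof.
rewrite (bigD1 p) //= /unit_vec eqxx mul1r big1 ?addr0 // => s /negPf ->.
by rewrite mul0r.
Qed.

(* Rotating [diag(1, v)] to [diag(v, 1)] connects the commutator of
   [diag(u, 1)] and [diag(v, 1)] to the identity. *)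
Lemma commutator_component n (p q : 'I_n) (u v : A) : p != q ->
  unitaries u -> unitaries v ->
  unitary_component_mx (W (u * v * star u * star v) (rank1 (unit_vec p))).
Proof.
move=> pq uU vU.
pose e (t : R) (s : 'I_n) : R := cos t * unit_vec p s + sin t * unit_vec q s.
have qp : unit_vec q p = 0 :> R by rewrite /unit_vec (negPf pq).
have pq' : unit_vec p q = 0 :> R by rewrite /unit_vec eq_sym (negPf pq).
have pp : unit_vec p p = 1 :> R by rewrite /unit_vec eqxx.
have qq : unit_vec q q = 1 :> R by rewrite /unit_vec eqxx.
have e1 t : \sum_s e t s * e t s = 1.
  transitivity (cos t * (\sum_s unit_vec p s * e t s) + sin t * (\sum_s unit_vec q s * e t s)).
    rewrite !mulr_sumr -big_split; apply: eq_bigr => s _ /=.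
    by rewrite /e; ring.
  rewrite !sum_unit_vec /e pp pq' qq qp -[RHS](cos2Dsin2 t); ring.
have p1 : \sum_s unit_vec p s * unit_vec p s = 1 by rewrite sum_unit_vec.
pose X t := W u (rank1 (unit_vec p)) *m W v (rank1 (e t)) *m
  W (star u) (rank1 (unit_vec p)) *m W (star v) (rank1 (e t)).
have XU t : unitaries_mx (X t).
  by apply/unitaries_mxM/unitary_W/unitaryV => //; apply/unitaries_mxM/unitary_W/unitaryV => //;
    apply/unitaries_mxM/unitary_W => //; exact: unitary_W.
have -> : W (u * v * star u * star v) (rank1 (unit_vec p)) = X 0.
  have -> : X 0 = W u (rank1 (unit_vec p)) *m W v (rank1 (unit_vec p)) *m
     W (star u) (rank1 (unit_vec p)) *m W (star v) (rank1 (unit_vec p)).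
    have e0 : e 0 = unit_vec p.
      by apply/funext => s; rewrite /e cos0 sin0 mul1r mul0r addr0.
    by rewrite /X e0.
  by rewrite !W_mul.
have X1 : X (trigo.pi / 2) = 1%:M.
  have e2 : e (trigo.pi / 2) = unit_vec q.
    by apply/funext => s; rewrite /e cos_pihalf sin_pihalf mul1r mul0r add0r.
  rewrite /X e2 -!mulmxA (mulmxA (W v _)) (@W_comm _ (unit_vec q) (unit_vec p)) ?sum_unit_vec //.
  rewrite -(mulmxA (W (star u) _)) W_mul ?sum_unit_vec // vU.2 W1 mulmx1.
  by rewrite W_mul // uU.2 W1.
rewrite /unitary_component_mx -X1.
have pi2 : 0 <= trigo.pi / 2 :> R by rewrite divr_ge0 // pi_ge0.
apply: (component_mx_image (C := `[0, trigo.pi / 2])).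
- have WC a : mxcont (fun t => W a (rank1 (e t))).
    apply: mxcontD; first exact: mxcont_cst.
    apply: mxcontM; first exact: mxcont_cst.
    move=> r s; rewrite (_ : (fun _ => _) = fun t => (e t r * e t s)%:C *: (1 : A)); last first.
      by apply/funext => t; rewrite mxE.
    apply: continuous_scale => t.
    have eC r' : e ^~ r' x @[x --> t] --> e t r'.
      apply: cvgD; apply: cvgM; try exact: cvg_cst.
        exact: continuous_cos.
      exact: continuous_sin.
    by apply: cvgM; exact: eC.
  apply: mxcontM; last exact: WC.
  apply: mxcontM; last exact: mxcont_cst.
  by apply: mxcontM; [exact: mxcont_cst|exact: WC].
- exact: segment_connected.
- by rewrite /= in_itv /= pi2 lexx.
- by rewrite /= in_itv /= pi2 lexx.
- by move=> t _; exact: XU.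
Qed.

End mxunitary.

Section K1.
Context {R : realType} {A : cstarAlgType R}.

(* [pad N X] is [diag(X, 1)] of size [N], described by its entries so that no
   dependent cast between sizes is needed. *)
Definition pad n N (X : 'M[A]_n) : 'M[A]_N := \matrix_(p, q)
  match insub (p : nat), insub (q : nat) : option 'I_n with
  | Some p', Some q' => X p' q'
  | _, _ => (p == q)%:R
  end.

Lemma stabilize_pad n k (X : 'M[A]_n) : stabilize k X = pad (n + k) X.
Proof.
apply/matrixP => p q; rewrite /stabilize [RHS]mxE mxE.
have insubl (p' : 'I_n) : insub (p' : nat) = Some p' by rewrite valK.
have insubr (p' : 'I_k) : insub (n + p')%N = None :> option 'I_n.
  by rewrite insubF // ltnNge leq_addr.
case: splitP => p' pp'; rewrite mxE; case: splitP => q' qq';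
  rewrite pp' qq' ?insubl ?insubr -?val_eqE /= ?pp' ?qq' ?mxE //.
- by rewrite (ltn_eqF (ltn_addr _ (ltn_ord p'))).
- by rewrite (gtn_eqF (ltn_addr _ (ltn_ord q'))).
- by rewrite eqn_add2l.
Qed.

Lemma castmx_pad n N M (e : N = M) (X : 'M[A]_n) : castmx (e, e) (pad N X) = pad M X.
Proof. by case: M / e; rewrite castmx_id. Qed.

Lemma pad_pad n N (X : 'M[A]_n) : (n <= N)%N ->
  pad (N + 1) X = block_mx (pad N X) 0 0 1%:M.
Proof.
move=> nN; apply/matrixP => p q; rewrite [LHS]mxE mxE.
have insubr (p' : 'I_1) : insub (N + p')%N = None :> option 'I_n.
  by rewrite insubF // ltnNge (leq_trans nN) // leq_addr.
case: splitP => p' pp'; rewrite mxE; case: splitP => q' qq';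
  rewrite pp' qq' ?insubr -?val_eqE /= ?pp' ?qq' ?mxE //.
- by rewrite (ltn_eqF (ltn_addr _ (ltn_ord p'))); case: (insub _).
- by rewrite (gtn_eqF (ltn_addr _ (ltn_ord q'))).
- by rewrite eqn_add2l.
Qed.

Lemma pad_scalar N (a : A) (p : 'I_N) : p = 0%N :> nat ->
  pad N (a%:M : 'M[A]_1) = W a (rank1 (unit_vec p)).
Proof.
move=> p0; apply/matrixP => r s; rewrite !mxE (bigD1 r) //= big1 ?addr0; last first.
  by move=> r' /negPf rr; rewrite !mxE eq_sym rr mulr0n mul0r.
rewrite !mxE eqxx mulr1n mulrZ mulr1 /unit_vec.
have E (u : 'I_N) : (u == p) = (u < 1)%N by rewrite -val_eqE /= p0 ltnS leqn0.
rewrite !E; case: insubP => [r' r1 r'E|/negPf r1]; last first.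
  by rewrite r1 mul0r scale0r addr0.
rewrite r1; case: insubP => [s' s1 s'E|/negPf s1]; last first.
  by rewrite s1 mulr0 scale0r addr0.
rewrite s1 mxE mulr1 scale1r.
have -> : r == s by rewrite -val_eqE /= -r'E -s'E !ord1.
by rewrite !ord1 eqxx mulr1n addrC subrK.
Qed.

Lemma K1_equivE n m (u : 'M[A]_n) (v : 'M[A]_m) : K1_equiv u v <->
  exists k l, (n + k = m + l)%N /\
    unitary_component_mx (pad (m + l) u *m mxstar (pad (m + l) v)).
Proof.
split=> [[k [l [e]]]|[k [l [e]]]].
  by rewrite !stabilize_pad castmx_pad; exists k, l.
by move=> c; exists k, l, e; rewrite !stabilize_pad castmx_pad.
Qed.

Lemma mxstar_block N (X : 'M[A]_N) :
  mxstar (block_mx X 0 0 1%:M : 'M[A]_(N + 1)) = block_mx (mxstar X) 0 0 1%:M.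
Proof.
rewrite /mxstar map_block_mx tr_block_mx; congr block_mx;
  apply/matrixP => p q; rewrite !mxE ?star0 //.
by rewrite !ord1 eqxx mulr1n star1.
Qed.

Lemma mul_block1 N (X Y : 'M[A]_N) :
  (block_mx X 0 0 1%:M : 'M[A]_(N + 1)) *m block_mx Y 0 0 1%:M = block_mx (X *m Y) 0 0 1%:M.
Proof. by rewrite mulmx_block !mulmx0 !mul0mx !mulmx1 !addr0 !add0r. Qed.

Lemma component_block N (X : 'M[A]_N) : unitary_component_mx X ->
  unitary_component_mx (block_mx X 0 0 1%:M : 'M[A]_(N + 1)).
Proof.
move=> Xc; have block1 : block_mx 1%:M 0 0 1%:M = 1%:M :> 'M[A]_(N + 1).
  exact: esym (scalar_mx_block _ _ _).
rewrite /unitary_component_mx -block1.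
apply: (component_mx_image (X := fun Z : 'M[A]_N => block_mx Z 0 0 1%:M : 'M[A]_(N + 1))
  (C := @unitary_component_mx R A N)).
- move=> p q; rewrite (_ : (fun _ => _) = fun Z : 'M[A]_N =>
    match fintype.split p, fintype.split q with
    | inl p', inl q' => Z p' q'
    | inr p', inr q' => (1%:M : 'M[A]_1) p' q'
    | _, _ => 0 end); last first.
    apply/funext => Z; rewrite mxE; case: (fintype.split p) => p'; rewrite mxE;
      by case: (fintype.split q) => q'; rewrite ?mxE.
  case: (fintype.split p) => p'; case: (fintype.split q) => q'; try exact: cst_continuous.
  exact: mxcont_id.
- exact: component_connected.
- exact: component_mx1.
- exact: Xc.
- move=> Z /connected_component_sub [Z1 Z2].
  by split; rewrite mxstar_block mul_block1 ?Z1 ?Z2 block1.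
Qed.

Lemma K1_equiv_commutator (u v a : A) m (w : 'M[A]_m) : unitaries u -> unitaries v ->
  K1_equiv (a%:M : 'M[A]_1) w ->
  K1_equiv ((u * v * star u * star v * a)%:M : 'M[A]_1) w.
Proof.
(* One more row and column make room for an index [q] different from [p], which the rotation
   needs. *)
move=> uU vU /K1_equivE [k [l [e c]]]; apply/K1_equivE; exists (k + 1)%N, (l + 1)%N.
split; first by rewrite !addnA e.
rewrite addnA; move: (m + l)%N e c (leq_addr l m) => N e c mN.
have N0 : (0 < N)%N by rewrite -e.
have p0 : (0 < N + 1)%N by rewrite addn1.
have q0 : (N < N + 1)%N by rewrite addn1.
pose p := Ordinal p0; pose q := Ordinal q0.
have pq : p != q by rewrite -val_eqE /= eq_sym -lt0n.
have cc := commutator_component pq uU vU.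
have mul := component_mxM cc (component_block c).
set c' := u * v * star u * star v in mul *.
have -> : pad (N + 1) ((c' * a)%:M : 'M[A]_1) =
    W c' (rank1 (unit_vec p)) *m pad (N + 1) (a%:M : 'M[A]_1).
  by rewrite !(@pad_scalar _ _ p) // W_mul // sum_unit_vec /unit_vec eqxx.
by rewrite -mulmxA !pad_pad // -?e ?leq_addr // mxstar_block mul_block1.
Qed.

Lemma K1_injective_commutator (u v : A) : K1_injective A ->
  unitaries u -> unitaries v -> ucon (u * v * star u * star v).
Proof.
move=> inj uU vU; set c := u * v * star u * star v.
have cU : unitaries c.
  by apply: unitaryM; [apply: unitaryM; [exact: unitaryM|exact: unitaryV]|exact: unitaryV].
have cS : star c = v * u * star v * star u by rewrite !starM !starK !mulrA.
(* A commutator factor does not change the class. One inclusion multiplies by [c], the other by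
   [star c], which is a commutator too. *)
have classes : K1_class (c%:M : 'M[A]_1) = K1_class (1%:M : 'M[A]_1).
  apply/seteqP; split=> w [wU cw]; split => //.
    rewrite -[X in X%:M]cU.1 cS; exact: K1_equiv_commutator.
  by rewrite -[c]mulr1; exact: K1_equiv_commutator.
apply: unitary_component_ucon.
have : unitary_class c c.
  exists 1; last by rewrite mul1r.
  exact/connected_component_refl/unitary1.
rewrite (inj _ _ cU unitary1 classes) => -[w wc <-].
by rewrite mulr1.
Qed.

End K1.

(** * Approximate unitary equivalence *)

Section approx_equiv.
Context {R : realType}.
Implicit Types A B C : cstarAlgType R.

Definition fin_equiv A B (f g : A -> B) : Prop := forall (F : seq A) (e : R), 0 < e ->
  exists2 u, unitaries u & forall x, x \in F -> nm (u * f x * star u - g x) < e.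

Lemma nm_conj_unitary A (u x : A) : unitaries u -> nm (u * x * star u) = nm x.
Proof. by move=> uU; rewrite nmuM ?nmMu //; exact: unitaryV. Qed.

Lemma conjB A (u x y : A) : u * x * star u - u * y * star u = u * (x - y) * star u.
Proof. by rewrite mulrBr mulrBl. Qed.

Lemma conjM A (u x y : A) : unitaries u ->
  u * x * star u * (u * y * star u) = u * (x * y) * star u.
Proof. by move=> uU; rewrite !mulrA -(mulrA _ (star u) u) uU.1 mulr1. Qed.

Lemma approx_fin_equiv A B (f g : A -> B) :
  approx_unitarily_equiv f g -> fin_equiv f g.
Proof.
move=> [u [uU ufg]] F e e0.
suff [N h] : exists N, forall n, (N <= n)%N -> forall x, x \in F ->
    nm (u n * f x * star (u n) - g x) < e.
  by exists (u N) => //; exact: h.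
elim: F => [|x F [N h]]; first by exists 0%N.
have /nm_cvgP /(_ e e0) [M _ hM] := ufg x.
exists (maxn N M) => n; rewrite geq_max => /andP[Nn Mn] y.
rewrite inE => /orP[/eqP -> |yF]; last exact: h.
by rewrite nmB; exact: hM.
Qed.

Lemma fin_equiv_sym A B (f g : A -> B) : fin_equiv f g -> fin_equiv g f.
Proof.
move=> fg F e e0; have [u uU h] := fg F e e0.
exists (star u); first exact: unitaryV.
move=> x /h; rewrite -(nm_conj_unitary _ (unitaryV uU)) starK mulrBr mulrBl.
by rewrite !mulrA uU.1 mul1r -mulrA uU.1 mulr1 nmB.
Qed.

Lemma fin_equiv_trans A B (f g h : A -> B) :
  fin_equiv f g -> fin_equiv g h -> fin_equiv f h.
Proof.
move=> fg gh F e e0.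
have [|u uU hu] := fg F (e / 2); first by lra.
have [|v vU hv] := gh F (e / 2); first by lra.
exists (v * u); first exact: unitaryM.
move=> x xF; have := hu x xF; rewrite -(nm_conj_unitary _ vU) mulrBr mulrBl => h1.
have := hv x xF; have := ler_nmdD (v * g x * star v) (v * u * f x * star (v * u)) (h x).
by move: h1; rewrite starM !mulrA; lra.
Qed.

Lemma fin_equiv_compl A B C (k : B -> C) (f g : A -> B) : star_hom k ->
  fin_equiv f g -> fin_equiv (k \o f) (k \o g).
Proof.
move=> kH fg F e e0; have [u uU h] := fg F e e0.
exists (k u); first exact: star_hom_unitary.
move=> x /h; apply: le_lt_trans => /=.
by rewrite -(star_homS kH) -!(star_homM kH) -(star_homB kH); exact: star_hom_nm_le.
Qed.

Lemma fin_equiv_compr A B C (k : A -> B) (f g : B -> C) :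
  fin_equiv f g -> fin_equiv (f \o k) (g \o k).
Proof.
move=> fg F e e0; have [u uU h] := fg (map k F) e e0.
by exists u => // x xF; apply: h; exact: map_f.
Qed.

End approx_equiv.

(* With [alpha] the flip and [beta = alpha (x) id]: [beta] and [alpha] are both
   equivalent to [beta \o lam = lam \o alpha], hence [mu = beta \o mu] is
   equivalent to [alpha \o mu = lam]. *)
Lemma half_flip (R : realType) (D : cstarAlgType R) (lam mu : D -> D)
    (H K L : hilbertType R) (t : H -> K -> L)
    (r1 : D -> H -> H) (r2 : D -> K -> K) (r3 : D -> L -> L) :
  tensor_rep lam mu t r1 r2 r3 -> fin_equiv id lam -> fin_equiv id mu.
Proof.
move=> tr idlam.
have [al [alH allam almu]] := tensor_map tr (tr_flip tr) (star_hom_id D) (star_hom_id D).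
have [be [beH belam bemu]] := tensor_map tr tr alH (star_hom_id D).
have e1 : fin_equiv be (lam \o al).
  have := fin_equiv_compl beH idlam; rewrite (_ : be \o lam = lam \o al) //.
  by apply/funext => x /=; exact: belam.
have e2 : fin_equiv be al.
  exact: fin_equiv_trans e1 (fin_equiv_sym (fin_equiv_compr al idlam)).
have := fin_equiv_compr mu e2.
rewrite (_ : be \o mu = mu); last by apply/funext => x /=; exact: bemu.
rewrite (_ : al \o mu = lam); last by apply/funext => x /=; exact: almu.
by move=> /fin_equiv_sym; exact: fin_equiv_trans.
Qed.

(** * Almost commuting unitaries in a self-absorbing algebra *)

Section commutators.
Context {R : realType} {A : cstarAlgType R}.
Implicit Types (u v w x y : A).

Lemma nm_comm_le u x y : unitaries u -> u * y = y * u ->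
  nm (u * x - x * u) <= 2 * nm (x - y).
Proof.
move=> uU uy; have -> : u * x - x * u = u * (x - y) - (x - y) * u.
  by rewrite mulrBr mulrBl uy; abel.
by apply: (le_trans (ler_nmB _ _)); rewrite nmMu // nmuM //; lra.
Qed.

Lemma nm_comm1_le u x : nm (u * x - x * u) <= 2 * nm (u - 1) * nm x.
Proof.
have -> : u * x - x * u = (u - 1) * x - x * (u - 1).
  by rewrite mulrBr mulrBl mul1r mulr1; abel.
apply: (le_trans (ler_nmB _ _)).
by have := nmM_le (u - 1) x; have := nmM_le x (u - 1); lra.
Qed.

Lemma nm_commM_le u v x : unitaries u -> unitaries v ->
  nm (u * v * x - x * (u * v)) <= nm (u * x - x * u) + nm (v * x - x * v).
Proof.
move=> uU vU; have -> : u * v * x - x * (u * v) = (u * x - x * u) * v + u * (v * x - x * v).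
  by rewrite mulrBl mulrBr !mulrA; abel.
by apply: (le_trans (ler_nmD _ _)); rewrite nmuM // nmMu.
Qed.

Lemma nm_conj_comm u x : unitaries u -> nm (u * x * star u - x) = nm (u * x - x * u).
Proof.
by move=> uU; rewrite -(nmuM (u * x * star u - x) uU) mulrBl -!mulrA uU.1 mulr1.
Qed.

End commutators.

Section self_absorbing.
Context {R : realType} {D : cstarAlgType R} {lam mu : D -> D}.
Hypotheses (lamH : star_hom lam) (muH : star_hom mu).
Hypothesis lm_comm : forall a b, lam a * mu b = mu b * lam a.
Hypothesis lm_dense : forall x (e : R), 0 < e -> exists s, nm (x - tens lam mu s) < e.
Hypotheses (lam_id : fin_equiv lam id) (mu_id : fin_equiv mu id).

(* Let [v] be a unitary flipping [lam] to [mu] and [q] a path to [w]: then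
   [v^* lam(q) v] almost commutes with [lam(F)], since [lam(q)] commutes with
   [mu(F)], and it ends near [lam(w)] if [w] almost commutes with the left
   legs of [v]. *)
Lemma basic_homotopy (F : seq D) (e : R) : 0 < e -> exists (G : seq D) (d : R),
  0 < d /\ forall w, ucon w -> (forall g, g \in G -> nm (w * g - g * w) < d) ->
  exists2 p, upath w p & forall t x, x \in F -> nm (p t * x - x * p t) < e.
Proof.
move=> e0; pose N := \sum_(x <- F) nm x.
have N0 : 0 <= N by apply: sumr_ge0 => x _; exact: nm_ge0.
have NF x : x \in F -> nm x <= N.
  by move=> xF; rewrite /N (big_rem x xF) /= lerDl sumr_ge0 // => y _; exact: nm_ge0.
(* [4 * eta <= 1 / 2] lets [short_path] apply to [E], and the commutators at the end are bounded by
   [16 * eta * N + 4 * eta]. *)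
pose eta := Num.min (1 / 8) (e / (16 * N + 5)).
have c0 : 0 < 16 * N + 5 by lra.
have eta0 : 0 < eta by rewrite lt_min divr_gt0 // divr_gt0.
have eta8 : eta <= 1 / 8 by rewrite ge_min lexx.
have etae : eta * (16 * N + 5) <= e by rewrite -ler_pdivlMr // ge_min lexx orbT.
clearbody eta N.
have [v vU vF] := fin_equiv_trans lam_id (fin_equiv_sym mu_id) F eta0.
have [s vs] := lm_dense v eta0.
(* [G] consists of the left legs of [v]; commutators with them get multiplied by the right legs,
   whose total norm is [M]. *)
pose M := \sum_(u <- s) nm (mu u.2).
have M0 : 0 <= M by apply: sumr_ge0 => u _; exact: nm_ge0.
have M1 : 0 < M + 1 by lra.
exists [seq u.1 | u <- s], (eta / (M + 1)); split; first by rewrite divr_gt0.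
move=> w [q wq] wG; have wU := upath_unitary wq.
have [qC qU q0 q1] := wq.
have lwU := star_hom_unitary lamH wU.
have wv : nm (lam w * v - v * lam w) <= 3 * eta.
  have b1 : nm (lam w * tens lam mu s - tens lam mu s * lam w) <= eta.
    have -> : lam w * tens lam mu s - tens lam mu s * lam w =
        \sum_(u <- s) lam (w * u.1 - u.1 * w) * mu u.2.
      rewrite /tens mulr_sumr mulr_suml -sumrB; apply: eq_bigr => u _.
      rewrite (star_homB lamH) !(star_homM lamH) mulrBl -!mulrA; congr (_ - _ * _).
      by rewrite lm_comm.
    apply: (le_trans (nm_sum _ _ _)).
    apply: (@le_trans _ _ (\sum_(u <- s) (eta / (M + 1)) * nm (mu u.2))).
      rewrite !big_seq; apply: ler_sum => u us; apply: (le_trans (nmM_le _ _)).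
      rewrite ler_wpM2r ?nm_ge0 //; apply: (le_trans (star_hom_nm_le lamH _)).
      by apply: ltW; apply: wG; exact: map_f.
    rewrite -mulr_sumr -/M mulrAC ler_pdivrMr // ler_wpM2l //; lra.
  have -> : lam w * v - v * lam w = (lam w * tens lam mu s - tens lam mu s * lam w) +
     (lam w * (v - tens lam mu s) - (v - tens lam mu s) * lam w).
    by rewrite mulrBr mulrBl; abel.
  apply: (le_trans (ler_nmD _ _)).
  have := ler_nmB (lam w * (v - tens lam mu s)) ((v - tens lam mu s) * lam w).
  by rewrite nmMu // nmuM //; move: b1 vs; lra.
have [p pU pF] := lam_id (w :: F) eta0.
(* [star v] takes [mu x] near [lam x] and [p] takes [lam x] near [x]. Hence [X t], which commutes
   with [c * mu x * star c], almost commutes with [x]. *)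
pose c := p * star v; have cU : unitaries c by apply: unitaryM => //; exact: unitaryV.
have pV := unitaryV pU; have vV := unitaryV vU; have cV := unitaryV cU.
pose X t := c * lam (q t) * star c.
have XU t : unitaries (X t).
  by apply: unitaryM => //; apply: unitaryM => //; exact: star_hom_unitary.
have x1w : nm (w - X 1) <= 4 * eta.
  have := ler_nmdD (p * lam w * star p) w (X 1).
  have h1 : nm (w - p * lam w * star p) < eta by rewrite nmB; exact: pF (mem_head _ _).
  have h2 : nm (v * lam w - lam w * v) <= 3 * eta by rewrite nmB.
  have -> : p * lam w * star p - X 1 = p * (star v * (v * lam w - lam w * v)) * star p.
    rewrite /X /c q1 starM starK mulrBr !mulrA vU.1 mul1r mulrBr mulrBl !mulrA.
    by rewrite -!mulrA.
  by rewrite nm_conj_unitary // nmMu //; move: h1 h2; lra.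
(* [X 1] is only close to [w]; a short path to [E] corrects the endpoint. *)
pose E := w * star (X 1).
have EU : unitaries E by apply: unitaryM => //; exact: unitaryV.
have E1 : nm (E - 1) = nm (w - X 1).
  by rewrite /E -(XU 1).2 -mulrBl nmuM //; exact/unitaryV/XU.
have [|r rE r1] := short_path EU; first by rewrite E1; lra.
have [rC rU r0 r1'] := rE.
exists (fun t => r t * X t).
  split.
  - apply: continuous_mulC => //; apply: continuous_mulC; last exact: cst_continuous.
    apply: continuous_mulC; first exact: cst_continuous.
    by move=> t; apply: continuous_comp; [exact: qC|exact: star_hom_continuous].
  - by move=> t; exact: unitaryM.
  - by rewrite r0 /X q0 (star_hom1 lamH) mulr1 cU.2 mulr1.
  - by rewrite r1' /E -mulrA (XU 1).1 mulr1.
move=> t x xF; apply: (le_lt_trans (nm_commM_le _ (rU t) (XU t))).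
have b1 : nm (r t * x - x * r t) <= 16 * eta * N.
  apply: (le_trans (nm_comm1_le _ _)).
  apply: ler_pM; rewrite ?mulr_ge0 ?nm_ge0 ?NF //.
  by have := r1 t; rewrite E1; move: x1w; lra.
have cx : nm (x - c * mu x * star c) <= 2 * eta.
  have := ler_nmdD (p * lam x * star p) x (c * mu x * star c).
  have h1 : nm (x - p * lam x * star p) < eta.
    by rewrite nmB; apply: pF; rewrite inE xF orbT.
  have -> : p * lam x * star p - c * mu x * star c = p * (star v * (v * lam x * star v - mu x) * v) * star p.
    rewrite /c starM starK !mulrBr !mulrBl !mulrA vU.1 mul1r.
    by rewrite -(mulrA (lam x)) vU.1 mulr1 mulrBr mulrBl !mulrA.
  rewrite nm_conj_unitary // nmuM // nmMu //.
  by have := vF x xF; move: h1; lra.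
have b2 : nm (X t * x - x * X t) <= 4 * eta.
  apply: (@le_trans _ _ (2 * nm (x - c * mu x * star c))); last by lra.
  apply: nm_comm_le => //.
  by rewrite /X !conjM // lm_comm.
by move: b1 b2 etae eta0; lra.
Qed.

(* Multiplying [u] by a copy of [u^*] that almost commutes with [be(F)] makes
   it a commutator up to a small error. *)
Lemma inner_approx_ucon (be : D -> D) : K1_injective D -> fin_equiv be id ->
  forall (F : seq D) (e : R), 0 < e ->
  exists2 u, ucon u & forall x, x \in F -> nm (u * be x * star u - x) < e.
Proof.
move=> inj be_id F e e0; pose eta := Num.min (1 / 2) (e / 3).
have eta0 : 0 < eta by rewrite lt_min !divr_gt0.
have eta2 : eta <= 1 / 2 by rewrite ge_min lexx.
have etae : 3 * eta <= e by rewrite -ler_pdivlMl // mulrC ge_min lexx orbT.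
clearbody eta.
have [u uU uF] := be_id F _ eta0.
have [s sU sF] := lam_id (map be F) eta0.
have [p pU pu] := fin_equiv_sym mu_id [:: u] eta0.
have {}pu : nm (p * u * star p - mu u) < eta by apply: pu; rewrite mem_head.
have sV := unitaryV sU; have pV := unitaryV pU; have uV := unitaryV uU.
(* [s] takes [lam (be x)] near [be x], so [z] almost commutes with [be x]. As [p] takes [u] near
   [mu u], [z] is also close to [r * star u * star r], and [u * z] to a commutator. *)
pose z := s * mu (star u) * star s.
have zU : unitaries z.
  by apply: unitaryM => //; apply: unitaryM => //; exact: star_hom_unitary.
pose r := s * p; have rU : unitaries r by exact: unitaryM.
exists (u * z).
  have := K1_injective_commutator inj uU rU.
  set c := u * r * star u * star r => cc.
  apply: (ucon_near cc); first exact: unitaryM.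
  have -> : u * z - c = u * (s * (mu (star u) - p * star u * star p) * star s).
    by rewrite /z /c /r starM !mulrBr !mulrBl !mulrA mulrBr !mulrA.
  rewrite nmMu // nm_conj_unitary // -nm_star starB.
  by rewrite (star_homS muH) starK !starM !starK mulrA nmB; exact: le_trans (ltW pu) eta2.
move=> x xF; rewrite starM.
have -> : u * z * be x * (star z * star u) - x =
   u * (z * be x * star z - be x) * star u + (u * be x * star u - x).
  by rewrite mulrBr mulrBl !mulrA addrA subrK.
apply: (le_lt_trans (ler_nmD _ _)); rewrite nm_conj_unitary // nm_conj_comm //.
have h1 : nm (u * be x * star u - x) < eta by exact: uF.
have h2 : nm (be x - s * lam (be x) * star s) < eta.
  by rewrite nmB; apply: sF; exact: map_f.
have : nm (z * be x - be x * z) <= 2 * nm (be x - s * lam (be x) * star s).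
  apply: nm_comm_le => //.
  by rewrite /z !conjM // lm_comm.
by move: h1 h2 etae => /=; lra.
Qed.

End self_absorbing.

(** * Homotopies of *-homomorphisms *)

Lemma continuous_compose (T U V : topologicalType) (f : T -> U) (g : U -> V) :
  continuous f -> continuous g -> continuous (fun t => g (f t)).
Proof. by move=> fC gC t; apply: continuous_comp; [exact: fC|exact: gC]. Qed.

Lemma clamp_affine_continuous (R : realType) (a b : R) :
  continuous (fun t => clamp (a * t - b)).
Proof.
apply: (@continuous_compose _ _ _ (fun t => a * t - b) clamp); last exact: clamp_continuous.
move=> t; apply: cvgB; last exact: cvg_cst.
by apply: cvgM; [exact: cvg_cst|exact: cvg_id].
Qed.

Section homotopies.
Context {R : realType}.
Implicit Types A B C : cstarAlgType R.

Definition total_homotopy A B (f g : A -> B) (h : R -> A -> B) : Prop :=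
  [/\ forall t, star_hom (h t), h 0 = f, h 1 = g & forall a, continuous (h ^~ a)].

Definition homot A B (f g : A -> B) := exists h, total_homotopy f g h.

Lemma homot_homotopic A B (f g : A -> B) : homot f g -> homotopic f g.
Proof.
move=> [h [hH h0 h1 hC]]; exists h; split => // a.
by apply: continuous_subspaceT; exact: hC.
Qed.

Lemma homot_sym A B (f g : A -> B) : homot f g -> homot g f.
Proof.
move=> [h [hH h0 h1 hC]]; exists (fun t => h (1 - t)); split => //.
- by rewrite subr0.
- by rewrite subrr.
- move=> a; apply: continuous_compose (hC a).
  by move=> t; apply: cvgB; [exact: cvg_cst|exact: cvg_id].
Qed.

(* At each time one of the two summands equals [g], so that concatenation
   needs no gluing of continuous functions. *)
Lemma homot_trans A B (f g k : A -> B) : homot f g -> homot g k -> homot f k.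
Proof.
move=> [h [hH h0 h1 hC]] [h' [hH' h0' h1' hC']].
pose H t a := h (clamp (2 * t - 0)) a + h' (clamp (2 * t - 1)) a - g a.
have HE t : H t = h (clamp (2 * t - 0)) \/ H t = h' (clamp (2 * t - 1)).
  have [t2|t2] := leP t (1 / 2); [left|right]; apply/funext => a; rewrite /H.
    by rewrite (clamp_le0 (t := 2 * t - 1)) ?h0' ?addrK //; lra.
  by rewrite (clamp_ge1 (t := 2 * t - 0)) ?h1; [abel|lra].
exists H; split.
- by move=> t; case: (HE t) => ->.
- apply/funext => a; rewrite /H mulr0 subr0 sub0r clamp0 clamp_le0 ?h0 ?h0' ?addrK //; lra.
- apply/funext => a; rewrite /H mulr1 (_ : 2 - 1 = 1); last by lra.
  rewrite clamp1 clamp_ge1 ?h1 ?h1'; [abel|lra].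
move=> a t; apply: cvgB; last exact: cvg_cst.
by apply: cvgD; [apply: (continuous_compose (@clamp_affine_continuous R 2 0) (hC a))|
  apply: (continuous_compose (@clamp_affine_continuous R 2 1) (hC' a))].
Qed.

Lemma homot_compl A B C (k : B -> C) (f g : A -> B) : star_hom k ->
  homot f g -> homot (k \o f) (k \o g).
Proof.
move=> kH [h [hH h0 h1 hC]]; exists (fun t => k \o h t); split.
- by move=> t; exact: star_hom_comp.
- by rewrite h0.
- by rewrite h1.
by move=> a; apply: (continuous_compose (hC a)); exact: star_hom_continuous.
Qed.

Lemma homot_compr A B C (k : A -> B) (f g : B -> C) : star_hom k ->
  homot f g -> homot (f \o k) (g \o k).
Proof.
move=> kH [h [hH h0 h1 hC]]; exists (fun t => h t \o k); split.
- by move=> t; exact: star_hom_comp.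
- by rewrite h0.
- by rewrite h1.
by move=> a; exact: hC.
Qed.

End homotopies.

(** * From approximately inner endomorphisms to homotopies *)

Lemma dense_sequence (R : realType) (A : cstarAlgType R) : separable_space A ->
  exists d : nat -> A, forall x (e : R), 0 < e -> exists n, nm (x - d n) < e.
Proof.
move=> [S /countable_injP [f fI] dS].
have /choice [d dP] : forall n, exists x, forall y, S y -> f y = n -> x = y.
  move=> n; have [[y [Sy fy]]|ny] := pselect (exists y, S y /\ f y = n).
    by exists y => z Sz fz; apply: fI; rewrite ?inE // fy.
  by exists 0 => y Sy fy; exfalso; apply: ny; exists y.
exists d => x e e0; have [y Sy xy] := dense_nm x dS e0.
by exists (f y); rewrite (dP _ y Sy).
Qed.

Lemma inner_star_hom (R : realType) (A B : cstarAlgType R) (f : A -> B) (u : B) :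
  star_hom f -> unitaries u -> star_hom (fun a => u * f a * star u).
Proof.
move=> fH uU; split.
- move=> c a b; rewrite (star_homP fH) mulrDr mulrDl.
  by rewrite -cstar_scalerAr -cstar_scalerAl.
- split=> [|a b]; first by rewrite (star_hom1 fH) mulr1 uU.2.
  by rewrite conjM // (star_homM fH).
- by move=> a; rewrite (star_homS fH) !starM starK mulrA.
Qed.

(* The path runs through [p n] on [[n, n + 1]]; [path_prod p n] is the product
   of the first [n] of these paths, each constant outside its interval. *)
Section concatenation.
Context {R : realType} {A : cstarAlgType R} (u : nat -> A) (p : nat -> R -> A).
Hypothesis p0 : upath (u 0%N) (p 0%N).
Hypothesis pS : forall n, upath (u n.+1 * star (u n)) (p n.+1).

Fixpoint path_prod n (t : R) : A :=
  if n is n.+1 then p n (clamp (1 * t - n%:R)) * path_prod n t else 1.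

(** A factor whose interval begins at or after [t] equals [1], so every integer bound of [t] gives
    the same value ([path_concatE]). *)
Definition path_concat (t : R) : A := path_prod (Num.bound t) t.

Let pP n : exists w, upath w (p n).
Proof. by case: n => [|n]; eexists; [exact: p0|exact: pS]. Qed.

Lemma path_prod_unitary n t : unitaries (path_prod n t).
Proof.
elim: n => [|n ih] /=; first exact: unitary1.
by apply: unitaryM => //; have [w []] := pP n.
Qed.

Lemma path_prod_continuous n : continuous (path_prod n).
Proof.
elim: n => [|n ih] /=; first exact: cst_continuous.
apply: continuous_mulC => //; have [w [pC _ _ _]] := pP n.
exact: (continuous_compose (@clamp_affine_continuous R 1 n%:R) pC).
Qed.

Lemma path_prod_stable m n t : t <= m%:R -> (m <= n)%N -> path_prod n t = path_prod m t.
Proof.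
move=> tm; elim: n => [|n ih]; first by rewrite leqn0 => /eqP ->.
rewrite leq_eqVlt => /orP[/eqP -> //|]; rewrite ltnS => mn /=.
rewrite clamp_le0; last first.
  by rewrite mul1r subr_le0; apply: (le_trans tm); rewrite ler_nat.
by have [w [_ _ -> _]] := pP n; rewrite mul1r ih.
Qed.

Lemma path_concatE n t : t <= n%:R -> path_concat t = path_prod n t.
Proof.
move=> tn; rewrite /path_concat; set m := Num.bound t.
have tm : t <= m%:R by exact/ltW/unstable.ltr_bound.
have [mn|/ltnW nm] := leqP m n; first by rewrite (path_prod_stable tm mn).
exact: path_prod_stable tn nm.
Qed.

Lemma path_concat_unitary t : unitaries (path_concat t).
Proof. exact: path_prod_unitary. Qed.

Lemma near_dist (t e : R) : 0 < e -> \forall s \near t, `|t - s| < e.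
Proof.
move=> e0; have /cvgrPdist_lt : id s @[s --> t] --> t by exact: cvg_id.
exact.
Qed.

Lemma path_concat_continuous : continuous path_concat.
Proof.
move=> t; apply/nm_continuousP => e e0; set N := Num.bound t.
have tN : t < N%:R by exact: unstable.ltr_bound.
have /nm_continuousP /(_ e e0) := @path_prod_continuous N t.
have d0 : 0 < N%:R - t by rewrite subr_gt0.
apply: filterS2 (near_dist t d0) => s; rewrite ltr_norml => ts.
by rewrite !(@path_concatE N) ?ltW //; lra.
Qed.

Lemma path_prod_end n t : n.+1%:R <= t -> path_prod n.+1 t = u n.
Proof.
elim: n => [|n ih] nt /=.
  rewrite mulr1 clamp_ge1; last by rewrite mul1r subr0.
  by have [_ _ _ ->] := p0.
have nt' : n.+1%:R <= t by apply: le_trans nt; rewrite ler_nat.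
rewrite clamp_ge1; last by rewrite mul1r lerBrDr nat1r.
have [_ _ _ ->] := pS n.
have uU : unitaries (u n) by rewrite -(ih nt'); exact: path_prod_unitary.
by have := ih nt' => /= ->; rewrite -mulrA uU.1 mulr1.
Qed.

Lemma path_concat_tail N t : N.+1%:R <= t ->
  exists n r, (N <= n)%N /\ path_concat t = p n.+1 r * u n.
Proof.
move=> Nt; have t0 : 0 <= t by apply: le_trans Nt; rewrite ler0n.
have /andP[mt tm] := truncn_itv t0; set m := Num.truncn t in mt tm.
have Nm : (N < m)%N.
  by rewrite -ltnS -(ltr_nat R); exact: le_lt_trans tm.
case: m Nm mt tm => // n Nn nt tn.
exists n, (clamp (1 * t - n.+1%:R)); split => //.
by rewrite (path_concatE (ltW tn)) -(path_prod_end nt).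
Qed.

End concatenation.

(** The half-line is compressed to [[0, 1)] by [t / (1 - t)]. Continuity at [1] is the last
    hypothesis, which is uniform in the parameter [r] of each piece. *)
Lemma asymptotic_homotopy (R : realType) (A B : cstarAlgType R) (be f : A -> B)
    (u : nat -> B) (p : nat -> R -> B) :
  star_hom be -> star_hom f ->
  upath (u 0%N) (p 0%N) -> (forall n, upath (u n.+1 * star (u n)) (p n.+1)) ->
  (forall a (e : R), 0 < e -> exists N, forall n r, (N <= n)%N ->
     nm (p n.+1 r * u n * be a * star (p n.+1 r * u n) - f a) < e) ->
  homot be f.
Proof.
move=> beH fH p0 pS lim.
pose U := path_concat p.
have UU t : unitaries (U t) by exact: path_concat_unitary p0 pS t.
pose g a t := U t * be a * star (U t).
have gC a : continuous (g a).
  have UC := path_concat_continuous p0 pS.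
  apply: continuous_mulC; last exact: continuous_star.
  by apply: continuous_mulC => //; exact: cst_continuous.
have gphi a (t : R) : t < 1 -> {for t, continuous (fun s : R => g a (s / (1 - s)))}.
  move=> t1; have tn : 1 - t != 0 by rewrite gt_eqF // subr_gt0.
  apply: (@continuous_comp _ _ _ (fun s : R => s / (1 - s)) (g a)); last exact: gC.
  apply: cvgM; first exact: cvg_id.
  by apply: cvgV => //; apply: cvgB; [exact: cvg_cst|exact: cvg_id].
pose h t a := if t < 1 then g a (t / (1 - t)) else f a.
exists h; split.
- move=> t; have [t1|/negPf t1] := boolP (t < 1).
    rewrite (_ : h t = g ^~ (t / (1 - t))); first exact: inner_star_hom.
    by apply/funext => a; rewrite /h t1.
  by rewrite (_ : h t = f) //; apply/funext => a; rewrite /h t1.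
- apply/funext => a; rewrite /h ltr01 mul0r /g /U.
  have -> : path_concat p 0 = 1 by exact: (path_concatE p0 pS (n := 0%N)).
  by rewrite star1 mul1r mulr1.
- by apply/funext => a; rewrite /h ltxx.
move=> a t; have [t1|t1] := ltP t 1.
  have := gphi a t t1.
  move=> /nm_continuousP gt; apply/nm_continuousP => e e0.
  have d0 : 0 < 1 - t by rewrite subr_gt0.
  apply: filterS2 (near_dist t d0) (gt e e0) => s; rewrite ltr_norml => ts.
  by rewrite /h t1 (_ : s < 1) //; lra.
apply/nm_continuousP => e e0; have [N hN] := lim a e e0.
have N2 : 0 < N.+2%:R :> R by rewrite ltr0n.
(* [1 - s < 1 / (N + 2)] means [s / (1 - s) > N + 1], the range of [path_concat_tail]. *)
have d0 : 0 < N.+2%:R^-1 :> R by rewrite invr_gt0.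
apply: filterS (near_dist t d0) => s; rewrite ltr_norml => ts.
have t1' : (t < 1) = false by rewrite ltNge t1.
rewrite /h t1'; case: ifP => s1; last by rewrite subrr nm0.
have sN : N.+1%:R <= s / (1 - s).
  rewrite ler_pdivlMr ?subr_gt0 //.
  have : N.+2%:R * (1 - s) <= 1.
    rewrite mulrC -ler_pdivlMr // div1r.
    by move: ts t1; move: (N.+2%:R^-1) => k; lra.
  by rewrite -[N.+2%:R]natr1; move: (N.+1%:R) => k; lra.
have [n [r [Nn UE]]] := path_concat_tail p0 pS sN.
by rewrite nmB /g /U UE; exact: hN.
Qed.

Section approx_inner.
Context {R : realType} {D : cstarAlgType R} {lam mu : D -> D}.
Hypotheses (lamH : star_hom lam) (muH : star_hom mu).
Hypothesis lm_comm : forall a b, lam a * mu b = mu b * lam a.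
Hypothesis lm_dense : forall x (e : R), 0 < e -> exists s, nm (x - tens lam mu s) < e.
Hypotheses (lam_id : fin_equiv lam id) (mu_id : fin_equiv mu id).
Hypotheses (Dsep : separable_space D) (Dinj : K1_injective D).

Lemma approx_inner_homot (be : D -> D) : star_hom be -> fin_equiv be id -> homot be id.
Proof.
move=> beH be_id.
have [d dd] := dense_sequence Dsep.
pose F n := [seq d k | k <- iota 0 n.+1].
pose eps n : R := n.+1%:R^-1.
have eps0 n : 0 < eps n by rewrite invr_gt0.
have /choice [G /choice [del Gdel]] := fun n =>
  basic_homotopy lamH lm_comm lm_dense lam_id mu_id (F n) (eps0 n).
have del0 n : 0 < del n by have [] := Gdel n.
(* [u n] enters the two quotients [w n] and [w n.-1], so it must respect the finite sets and
   tolerances of both; at [0] the two indices coincide. *)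
pose tau n := Num.min (eps n) (Num.min (del n / 2) (del n.-1 / 2)).
have tau0 n : 0 < tau n by rewrite !lt_min eps0 !divr_gt0.
have /choice [u uP] : forall n, exists u, ucon u /\
    forall x, x \in F n ++ G n ++ G n.-1 -> nm (u * be x * star u - x) < tau n.
  move=> n; have [u uc h] := inner_approx_ucon muH lm_comm lam_id mu_id Dinj
    be_id (F n ++ G n ++ G n.-1) (tau0 n).
  by exists u.
have uc n : ucon (u n) by have [] := uP n.
have uU n : unitaries (u n) by exact: ucon_unitary.
have uV n : unitaries (star (u n)) by exact: unitaryV.
pose w n := u n.+1 * star (u n).
have wc n : ucon (w n).
  apply: uconM => //; have [q qp] := uc n.
  by exists (fun t => star (q t)); exact: upath_star.
have wG n g : g \in G n -> nm (w n * g - g * w n) < del n.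
  move=> gG; rewrite -nm_conj_comm; last exact: unitaryM.
  have h1 : nm (g - u n * be g * star (u n)) < del n / 2.
    rewrite nmB; apply: (@lt_le_trans _ _ (tau n)).
      by apply: (uP n).2; rewrite !mem_cat gG orbT.
    by rewrite !ge_min lexx !orbT.
  have h2 : nm (u n.+1 * be g * star (u n.+1) - g) < del n / 2.
    apply: (@lt_le_trans _ _ (tau n.+1)).
      by apply: (uP n.+1).2; rewrite !mem_cat /= gG !orbT.
    by rewrite !ge_min lexx !orbT.
  have e1 : u n.+1 * be g * star (u n.+1) =
      w n * (u n * be g * star (u n)) * star (w n).
    rewrite /w starM starK !mulrA -(mulrA _ (star (u n)) (u n)) (uU n).1 mulr1.
    by rewrite -(mulrA _ (star (u n)) (u n)) (uU n).1 mulr1.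
  have := ler_nmdD (u n.+1 * be g * star (u n.+1)) (w n * g * star (w n)) g.
  rewrite {1}e1 conjB nm_conj_unitary; last exact: unitaryM.
  by move: h1 h2; lra.
have /choice [p pP] : forall n, exists p, upath (w n) p /\
    forall t x, x \in F n -> nm (p t * x - x * p t) < eps n.
  by move=> n; have [_ /(_ (w n) (wc n) (wG n)) [p wp h]] := Gdel n; exists p.
have [p0 up0] := uc 0%N.
(* The first piece may be any path to [u 0], since the limit sees only the tail. *)
pose P n := if n is n.+1 then p n else p0.
apply: (@asymptotic_homotopy _ _ _ be id u P beH (star_hom_id D)) => //.
  by move=> n; have [] := pP n.
move=> a e e0.
have [|k ak] := dd a (e / 4); first by lra.
have [|M hM] := @inv_succ_small R (e / 4); first by lra.
exists (maxn k M) => n r; rewrite geq_max => /andP[kn Mn] /=.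
have en : eps n < e / 4 by exact: hM.
have [[pC pU _ _] pF] := pP n.
have dF : d k \in F n by apply: map_f; rewrite mem_iota add0n ltnS.
have h1 : nm (u n * be (d k) * star (u n) - d k) < eps n.
  apply: (@lt_le_trans _ _ (tau n)); last by rewrite ge_min lexx.
  by apply: (uP n).2; rewrite mem_cat dF.
have h2 : nm (p n r * d k * star (p n r) - d k) < eps n.
  by rewrite nm_conj_comm //; exact: pF.
have puU : unitaries (p n r * u n) by exact: unitaryM.
have h3 : nm (p n r * u n * be a * star (p n r * u n) -
    p n r * u n * be (d k) * star (p n r * u n)) <= nm (a - d k).
  by rewrite conjB nm_conj_unitary // -(star_homB beH) star_hom_nm_le.
have h4 : nm (p n r * u n * be (d k) * star (p n r * u n) - p n r * d k * star (p n r)) < eps n.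
  have -> : p n r * u n * be (d k) * star (p n r * u n) =
      p n r * (u n * be (d k) * star (u n)) * star (p n r) by rewrite starM !mulrA.
  by rewrite conjB nm_conj_unitary.
have := ler_nmdD (p n r * u n * be (d k) * star (p n r * u n))
  (p n r * u n * be a * star (p n r * u n)) a.
have := ler_nmdD (p n r * d k * star (p n r))
  (p n r * u n * be (d k) * star (p n r * u n)) a.
have := ler_nmdD (d k) (p n r * d k * star (p n r)) a.
have e1 : nm (d k - a) < e / 4 by rewrite nmB.
by move: h2 h3 h4 e1 en ak; lra.
Qed.

End approx_inner.

(** The square is carried to [D] by [psi], the inverse of [phi], with [r3 \o phi] as representation;
    [phi] being equivalent to [i], the map [psi \o i] is equivalent to [psi \o phi = id]. *)
Lemma self_absorbing_tensor (R : realType) (D : cstarAlgType R) :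
  strongly_self_absorbing D -> exists (lam mu : D -> D) (H K L : hilbertType R)
    (t : H -> K -> L) (r1 : D -> H -> H) (r2 : D -> K -> K) (r3 : D -> L -> L),
  tensor_rep lam mu t r1 r2 r3 /\ fin_equiv id lam.
Proof.
move=> [_ [DD [i [j [phi [ij phiH [psi phiK psiK] phii]]]]]].
have psiH := star_hom_inv phiH phiK psiK.
have [H [K [L [t [r1 [r2 [r3 tr]]]]]]] := spatial_tensor_rep ij.
exists (psi \o i), (psi \o j), H, K, L, t, r1, r2, (r3 \o phi); split; last first.
  have := fin_equiv_compl psiH (approx_fin_equiv phii).
  by rewrite (_ : psi \o phi = id) //; apply/funext => x /=; exact: phiK.
split; try by case: tr.
- exact: star_hom_comp (tr_i tr) psiH.
- exact: star_hom_comp (tr_j tr) psiH.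
- move=> x e e0; have [s xs] := tr_dense tr (phi x) e0; exists s.
  have -> : tens (psi \o i) (psi \o j) s = psi (tens i j s).
    by rewrite /tens (star_hom_sum psiH); apply: eq_bigr => u _; rewrite (star_homM psiH).
  apply: le_lt_trans xs; rewrite -{1}(phiK x) -(star_homB psiH).
  exact: star_hom_nm_le.
- exact: star_hom_rep (tr_theta tr).
- move=> a a0; apply: (can_inj phiK); rewrite (star_hom0 phiH).
  by apply: (tr_thetaF tr) => x; exact: a0.
- by move=> a b h k /=; rewrite (star_homM phiH) !psiK (tr_eq tr).
Qed.

(* [Lam] is [id (x) lam]. *)
Lemma homot_tensor_id (R : realType) (A D AD : cstarAlgType R) (i : A -> AD) (j : D -> AD)
    (H K L : hilbertType R) (t : H -> K -> L)
    (rA : A -> H -> H) (rD : D -> K -> K) (rT : AD -> L -> L) (lam : D -> D) :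
  tensor_rep i j t rA rD rT -> homot lam id ->
  exists Lam : AD -> AD, [/\ star_hom Lam, forall a, Lam (i a) = i a,
    forall d, Lam (j d) = j (lam d) & homot Lam id].
Proof.
move=> tr [h [hH h0 h1 hC]].
have /choice [F FP] := fun s => tensor_map tr tr (star_hom_id A) (hH s).
have FH s : star_hom (F s) by have [] := FP s.
have Ft s l : F s (tens i j l) = \sum_(v <- l) i v.1 * j (h s v.2).
  rewrite /tens (star_hom_sum (FH s)); apply: eq_bigr => v _.
  by rewrite (star_homM (FH s)); have [_ -> ->] := FP s.
exists (F 0); split.
- exact: FH.
- by move=> a; have [_ ->] := FP 0.
- by move=> d; have [_ _ ->] := FP 0; rewrite h0.
exists F; split => //.
  apply/funext => x; apply: nm_eq_small => e e0.
  have [|l xl] := tr_dense tr x (e := e / 2); first by lra.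
  have E : F 1 (tens i j l) = tens i j l by rewrite Ft h1.
  have h2 : nm (F 1 x - tens i j l) <= nm (x - tens i j l).
    by rewrite -{1}E -(star_homB (FH 1)) star_hom_nm_le.
  have := ler_nmdD (tens i j l) (F 1 x) x.
  have : nm (tens i j l - x) < e / 2 by rewrite nmB.
  by move: xl h2 => /=; lra.
move=> x s; apply/nm_continuousP => e e0.
have [|l xl] := tr_dense tr x (e := e / 4); first by lra.
have : continuous (fun s => F s (tens i j l)).
  rewrite (_ : (fun _ => _) = fun s => \sum_(v <- l) i v.1 * j (h s v.2)); last first.
    by apply/funext => s'; exact: Ft.
  apply: continuous_sumC => v; apply: continuous_mulC; first exact: cst_continuous.
  exact: (continuous_compose (hC v.2) (star_hom_continuous (tr_j tr))).
have e4 : 0 < e / 4 by lra.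
move=> /(_ s) /nm_continuousP /(_ _ e4); apply: filterS => s' h1'.
have := ler_nmdD (F s (tens i j l)) (F s x) (F s' x).
have := ler_nmdD (F s' (tens i j l)) (F s (tens i j l)) (F s' x).
have h2 : nm (F s x - F s (tens i j l)) <= nm (x - tens i j l).
  by rewrite -(star_homB (FH s)) star_hom_nm_le.
have h3 : nm (F s' (tens i j l) - F s' x) <= nm (tens i j l - x).
  by rewrite -(star_homB (FH s')) star_hom_nm_le.
have : nm (tens i j l - x) < e / 4 by rewrite nmB.
by move: xl h1' h2 h3; lra.
Qed.

(* [sigma] is homotopic to [sigma (x) 1], hence, through [sigma (x) id] and the
   homotopy between the two embeddings of [D] in [D (x) D], to the embedding of
   the last factor of [A (x) D (x) D]. *)
Lemma star_homs_homot (R : realType) (D A AD : cstarAlgType R) (i : A -> AD) (j : D -> AD) :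
  spatial_tensor i j ->
  separable_space D -> strongly_self_absorbing D -> K1_injective D ->
  forall f g : D -> AD, star_hom f -> star_hom g -> homot f g.
Proof.
move=> /spatial_tensor_rep [H [K [L [t [rA [rD [rT tr]]]]]]] Dsep.
move=> /self_absorbing_tensor [lam [mu [H2 [K2 [L2 [t2 [r1 [r2 [r3 [tr2 idlam]]]]]]]]]] Dinj.
have lamH := tr_i tr2; have muH := tr_j tr2.
have idmu := half_flip tr2 idlam.
have lam_id := fin_equiv_sym idlam; have mu_id := fin_equiv_sym idmu.
have homotid be := approx_inner_homot lamH muH (tr_comm tr2) (tr_dense tr2) lam_id mu_id
  Dsep Dinj (be := be).
have lamh := homotid _ lamH lam_id; have muh := homotid _ muH mu_id.
have lammu := homot_trans lamh (homot_sym muh).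
have [Lam [LamH Lami Lamj Lamh]] := homot_tensor_id tr lamh.
have key f : star_hom f -> homot f (j \o mu).
  move=> fH; have [F [FH Flam Fmu]] := triple_hom tr tr2 LamH Lami Lamj fH.
  apply: homot_trans (homot_sym (homot_compr fH Lamh)) _.
  have := homot_compl FH lammu.
  rewrite (_ : F \o lam = Lam \o f); last by apply/funext => x /=; exact: Flam.
  by rewrite (_ : F \o mu = j \o mu) //; apply/funext => x /=; exact: Fmu.
by move=> f g fH gH; apply: homot_trans (key f fH) (homot_sym (key g gH)).
Qed.

(* AD, with i : a |-> a (x) 1 and j : d |-> 1 (x) d, is A (x) D. *)
Theorem corollary3p3 (R : realType) (D A AD : cstarAlgType R)
    (i : A -> AD) (j : D -> AD) :
  spatial_tensor i j ->
  separable_space D -> strongly_self_absorbing D -> K1_injective D ->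
  exists c : set (D -> AD), homotopy_classes D AD = [set c].
Proof.
move=> ij Dsep Dssa Dinj; have jH : star_hom j by case: ij.
have all_homot := star_homs_homot ij Dsep Dssa Dinj.
have classE (f : D -> AD) : star_hom f -> [set g | homotopic f g] = [set g | star_hom g].
  move=> fH; apply/seteqP; split => g /=.
    by move=> [h [hH _ <- _]]; apply: hH; rewrite in_itv /= lexx ler01.
  by move=> gH; apply: homot_homotopic; exact: all_homot.
exists [set g | star_hom g]; apply/seteqP; split => c /=.
  by move=> [f fH <-]; exact: classE.
(* [j] witnesses that there is at least one class. *)
by move=> ->; exists j => //; exact: classE.
Qed.
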